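(* Let $L\subset\mathbb{T}_{\mathbb{C}}M$ be a complex Dirac structure with constant real index $r$ and constant order $s$ over a $(2n+r)$-dimensional manifold $M$. If $L$ has constant type $n$, then there exist a transverse CR structure $(D,\Delta,J)$ on $M$ and a real two-form $B\in\Omega^2(M)$ such that $L=e^{B}L_{(D,\Delta,J)}$.
   Context: $\mathbb{T}M:=TM\oplus T^*M$ carries the pairing $\langle X+\xi,Y+\eta\rangle=\frac12(\eta(X)+\xi(Y))$ and the Dorfman bracket $[X+\xi,Y+\eta]=[X,Y]+\mathcal{L}_X\eta-\imath_Y d\xi$; $\mathbb{T}_{\mathbb{C}}M$ is its complexification. A complex Dirac structure is a smooth lagrangian subbundle $L\subset\mathbb{T}_{\mathbb{C}}M$ whose sections are closed under the Dorfman bracket. With $E_L:=\mathrm{pr}_{T_{\mathbb{C}}M}L$ and $\mathrm{Re}$ denoting the real elements of a conjugation-invariant subspace, put $\Delta_L:=\mathrm{Re}(E_L\cap\overline{E_L})$, $D_L:=\mathrm{Re}(E_L+\overline{E_L})$. Invariants: real index $=\mathrm{rank}(L\cap\overline{L})$; order $=\dim M-\mathrm{rank}\,D_L$; type $=\frac12(\mathrm{rank}\,D_L-\mathrm{rank}\,\Delta_L)$. A transverse CR structure $(S,R,J)$ consists of regular (smooth, constant rank) distributions $R\subseteq S\subseteq TM$, with $R$ integrable, and a bundle map $J:S/R\to S/R$ with $J^2=-\mathrm{Id}$ such that, for the (complexified) projection $q:TM\to TM/R$, the distribution $E=q^{-1}(\ker(J-i\,\mathrm{Id}))\subset T_{\mathbb{C}}M$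 is regular and involutive. Its associated complex Dirac structure is $L_{(S,R,J)}:=E\oplus\mathrm{Ann}\,E$. For a two-form $B$ (not necessarily closed), $e^B(X+\xi)=X+\xi+\imath_XB$. *)

(* Defs.v *)
From HB Require Import structures.
From mathcomp Require Import all_boot all_order all_algebra.
From mathcomp Require Import complex.
From mathcomp Require Import all_classical all_reals all_analysis.

Set Implicit Arguments.
Unset Strict Implicit.
Unset Printing Implicit Defensive.
Import Order.TTheory GRing.Theory Num.Theory numFieldNormedType.Exports.
Local Open Scope classical_set_scope.
Local Open Scope ring_scope.

Section SmoothFunctions.
Variable R : realType.

(* f is C^(k+1) on U when it is (Frechet) differentiable at every point of U
   and all its partial derivatives are C^k on U. *)
Fixpoint Ck_on m (k : nat) (U : set 'rV[R]_m) (f : 'rV[R]_m -> R) : Prop :=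
  match k with
  | 0 => forall x, U x -> {for x, continuous f}
  | k'.+1 => (forall x, U x -> differentiable f x) /\
             (forall j : 'I_m, Ck_on k' U (fun x => 'D_(delta_mx 0 j) f x))
  end.

Definition smooth_on m (U : set 'rV[R]_m) (f : 'rV[R]_m -> R) : Prop :=
  forall k, Ck_on k U f.

Definition smooth_map_on m m' (U : set 'rV[R]_m) (f : 'rV[R]_m -> 'rV[R]_m') :
  Prop := forall j, smooth_on U (fun x => f x 0 j).

Definition csmooth_on m (U : set 'rV[R]_m) (f : 'rV[R]_m -> R[i]) : Prop :=
  smooth_on U (fun x => complex.Re (f x)) /\
  smooth_on U (fun x => complex.Im (f x)).

Definition cpartial m (j : 'I_m) (f : 'rV[R]_m -> R[i]) (x : 'rV[R]_m) : R[i] :=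
  Complex ('D_(delta_mx 0 j) (fun y => complex.Re (f y)) x)
          ('D_(delta_mx 0 j) (fun y => complex.Im (f y)) x).

End SmoothFunctions.

(* The inverse charts are total functions; only their values on the image of
   the chart matter. *)
Record manifold (R : realType) (m : nat) := Manifold {
  carrier :> topologicalType;
  manifold_hausdorff : hausdorff_space carrier;
  manifold_countable : @second_countable carrier;
  chart_index : Type;
  chart_dom : chart_index -> set carrier;
  chart : chart_index -> carrier -> 'rV[R]_m;
  chart_inv : chart_index -> 'rV[R]_m -> carrier;
  chart_dom_open : forall i, open (chart_dom i);
  chart_cover : forall p, exists i, chart_dom i p;
  chart_image_open : forall i, open (chart i @` chart_dom i);
  chartK : forall i p, chart_dom i p -> chart_inv i (chart i p) = p;
  chart_continuous :
    forall i p, chart_dom i p -> {for p, continuous (chart i)};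
  chart_inv_continuous : forall i x, (chart i @` chart_dom i) x ->
    {for x, continuous (chart_inv i)};
  transition_smooth : forall i j,
    smooth_map_on (chart i @` (chart_dom i `&` chart_dom j))
                  (chart j \o chart_inv i)
}.

(* Fibre of the complexified generalized tangent bundle: pairs (X, xi) of a
   complex tangent vector and a complex covector, both as row vectors, the
   evaluation xi(X) being (xi *m X^T) 0 0. *)
Notation gtan R m := ('rV[R[i]]_m * 'rV[R[i]]_m)%type.

Section LinearAlgebra.
Variables (R : realType) (m : nat).
Local Notation C := R[i].
Local Notation rvec := 'rV[R]_m.
Local Notation cvec := 'rV[C]_m.

Definition cmx a b (A : 'M[R]_(a, b)) : 'M[C]_(a, b) :=
  map_mx (real_complex R) A.
Definition re_mx a b (A : 'M[C]_(a, b)) : 'M[R]_(a, b) :=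
  map_mx (@complex.Re R) A.
Definition im_mx a b (A : 'M[C]_(a, b)) : 'M[R]_(a, b) :=
  map_mx (@complex.Im R) A.
Definition conj_mx a b (A : 'M[C]_(a, b)) : 'M[C]_(a, b) := map_mx conjc A.

Definition complexify (V : {vspace rvec}) : {vspace cvec} :=
  <<[seq cmx v | v <- vbasis V]>>%VS.

Definition conj_gtan (u : gtan R m) : gtan R m := (conj_mx u.1, conj_mx u.2).

(* Conjugates of a basis of W span the conjugate of W (lemma mem_conj_space). *)
Definition conj_space (V : vectType C) (cj : V -> V) (W : {vspace V}) :
  {vspace V} := <<[seq cj w | w <- vbasis W]>>%VS.

(* Re W is the kernel of v |-> v_C mod W, written as an R-linear map by
   separating real and imaginary parts (lemma mem_real_part). *)
Definition real_part (W : {vspace cvec}) : {vspace rvec} :=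
  lker (linfun (fun v : rvec =>
    let w := cmx v - projv W (cmx v) in (re_mx w, im_mx w) : rvec * rvec)).

Definition ann (W : {vspace cvec}) : {vspace cvec} :=
  lker (linfun (fun xi : cvec =>
    \row_(k < \dim W) (xi *m ((vbasis W)`_k)^T) 0 0)).

Definition pairing (u v : gtan R m) : C :=
  2^-1 * ((v.2 *m u.1^T) 0 0 + (u.2 *m v.1^T) 0 0).

Definition tangent_part (L : {vspace gtan R m}) : {vspace cvec} :=
  (linfun (fun u : gtan R m => u.1) @: L)%VS.

Definition plus_ann (W : {vspace cvec}) : {vspace gtan R m} :=
  (linfun (fun X : cvec => (X, 0) : gtan R m) @: W +
   linfun (fun xi : cvec => (0, xi) : gtan R m) @: ann W)%VS.

(* A bilinear form B(X, Y) = X *m B *m Y^T has i_X B = X *m B. *)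
Definition exp_form (B : 'M[R]_m) (u : gtan R m) : gtan R m :=
  (u.1, u.2 + u.1 *m cmx B).

Definition exp_form_space (B : 'M[R]_m) (W : {vspace gtan R m}) : {vspace gtan R m} :=
  (linfun (exp_form B) @: W)%VS.

(* q^-1 (ker (J - i Id)) for the map v |-> v *m J on S / F. *)
Definition cr_fibre (S F : {vspace rvec}) (J : 'M[R]_m) : {vspace cvec} :=
  (complexify S :&:
   linfun (fun v : cvec => v *m cmx J - 'i%C *: v) @^-1: complexify F)%VS.

End LinearAlgebra.

Section LinearAlgebraTheory.
Variables (R : realType) (m : nat).
Local Notation C := R[i].
Local Notation rvec := 'rV[R]_m.
Local Notation cvec := 'rV[C]_m.

Lemma linfunE (K : fieldType) (aT rT : vectType K) (f : aT -> rT) (v : aT) :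
  linear f -> linfun f v = f v.
Proof.
move=> flin.
pose ff : {linear aT -> rT} := HB.pack f (GRing.isLinear.Build K aT rT _ f flin).
exact: (lfunE ff v).
Qed.

Lemma span_ind (K : fieldType) (V : vectType K) (X : seq V) (P : V -> Prop) :
  P 0 -> (forall x y, P x -> P y -> P (x + y)) ->
  (forall a x, P x -> P (a *: x)) -> (forall x, x \in X -> P x) ->
  forall v, v \in <<X>>%VS -> P v.
Proof.
move=> P0 PD PZ PX v /(@coord_span _ _ _ (in_tuple X)) ->.
elim/big_ind: _ => // i _; apply: PZ; apply: PX.
by rewrite mem_nth.
Qed.

Lemma mem_conj_space (V : vectType C) (cj : V -> V) (W : {vspace V}) v :
  {morph cj : x y / x + y} -> (forall (a : C) x, cj (a *: x) = conjc a *: cj x) ->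
  involutive cj -> (v \in conj_space cj W) = (cj v \in W).
Proof.
move=> cjD cjZ cjK.
have cj0 : cj 0 = 0 by rewrite -(scale0r 0) cjZ conjc0 !scale0r.
apply/idP/idP => [|cv].
  apply: (@span_ind _ _ _ (fun v => cj v \in W)) => [|x y ? ?|a x ?|_ /mapP[x xW ->]].
  - by rewrite cj0 mem0v.
  - by rewrite cjD memvD.
  - by rewrite cjZ memvZ.
  - by rewrite cjK vbasis_mem.
rewrite -[v]cjK; move: (cj v) cv => w; rewrite -{1}(span_basis (vbasisP W)).
apply: (@span_ind _ _ _ (fun w => cj w \in conj_space cj W)) => [|x y ? ?|a x ?|x xW].
- by rewrite cj0 mem0v.
- by rewrite cjD memvD.
- by rewrite cjZ memvZ.
- by rewrite memv_span // map_f.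
Qed.

Lemma re_cmx a b (A : 'M[R]_(a, b)) : re_mx (cmx A) = A.
Proof. by apply/matrixP => i j; rewrite !mxE. Qed.

Lemma im_cmx a b (A : 'M[R]_(a, b)) : im_mx (cmx A) = 0.
Proof. by apply/matrixP => i j; rewrite !mxE. Qed.

Lemma complex_mxE a b (A : 'M[C]_(a, b)) :
  A = cmx (re_mx A) + 'i%C *: cmx (im_mx A).
Proof. by apply/matrixP => i j; rewrite !mxE; exact: complexE. Qed.

Lemma cmxD a b (A B : 'M[R]_(a, b)) : cmx (A + B) = cmx A + cmx B.
Proof. exact: map_mxD. Qed.

Lemma cmxZ a b (c : R) (A : 'M[R]_(a, b)) : cmx (c *: A) = c%:C%C *: cmx A.
Proof. exact: map_mxZ. Qed.

Lemma re_mxD a b (A B : 'M[C]_(a, b)) : re_mx (A + B) = re_mx A + re_mx B.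
Proof. by apply/matrixP => i j; rewrite !mxE; case: (A i j) (B i j) => ? ? []. Qed.

Lemma im_mxD a b (A B : 'M[C]_(a, b)) : im_mx (A + B) = im_mx A + im_mx B.
Proof. by apply/matrixP => i j; rewrite !mxE; case: (A i j) (B i j) => ? ? []. Qed.

Lemma re_mxZ a b (c : C) (A : 'M[C]_(a, b)) :
  re_mx (c *: A) = complex.Re c *: re_mx A - complex.Im c *: im_mx A.
Proof. by apply/matrixP => i j; rewrite !mxE; case: c (A i j) => ? ? []. Qed.

Lemma im_mxZ a b (c : C) (A : 'M[C]_(a, b)) :
  im_mx (c *: A) = complex.Re c *: im_mx A + complex.Im c *: re_mx A.
Proof.
by apply/matrixP => i j; rewrite !mxE; case: c (A i j) => ? ? [? ?].
Qed.

Lemma mem_complexify (V : {vspace rvec}) (v : cvec) :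
  (v \in complexify V) = (re_mx v \in V) && (im_mx v \in V).
Proof.
apply/idP/andP => [|[hre him]].
  apply: (@span_ind _ _ _ (fun v : cvec => re_mx v \in V /\ im_mx v \in V)).
  - have -> : (0 : cvec) = cmx 0 by rewrite /cmx map_mx0.
    by rewrite re_cmx im_cmx mem0v.
  - by move=> x y [? ?] [? ?]; rewrite re_mxD im_mxD !memvD.
  - by move=> a x [? ?]; rewrite re_mxZ im_mxZ memvB ?memvD ?memvZ.
  - by move=> _ /mapP[x xV ->]; rewrite re_cmx im_cmx mem0v vbasis_mem.
have cV u : u \in V -> cmx u \in complexify V.
  rewrite -{1}(span_basis (vbasisP V)).
  apply: (@span_ind _ _ _ (fun u => cmx u \in complexify V)) => [|x y ? ?|a x ?|x xV].
  - by rewrite /cmx map_mx0 mem0v.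
  - by rewrite cmxD memvD.
  - by rewrite cmxZ memvZ.
  - by rewrite memv_span // map_f.
by rewrite [v]complex_mxE memvD ?memvZ ?cV.
Qed.

Lemma mem_real_part (W : {vspace cvec}) (v : rvec) :
  (v \in real_part W) = (cmx v \in W).
Proof.
rewrite memv_ker linfunE /=; last first.
  move=> a x y; rewrite cmxD cmxZ linearD linearZ /=.
  set X := cmx x; set Y := cmx y; set p := projv W.
  have -> : a%:C%C *: X + Y - (a%:C%C *: p X + p Y) =
            a%:C%C *: (X - p X) + (Y - p Y).
    by rewrite scalerBr opprD addrACA.
  move: (X - p X) (Y - p Y) => X' Y'.
  by rewrite re_mxD im_mxD re_mxZ im_mxZ /= !scale0r subr0 addr0.
apply/eqP/idP => [[h1 h2]|vW].
  have /eqP : cmx v - projv W (cmx v) = 0.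
    by rewrite [LHS]complex_mxE h1 h2 /cmx map_mx0 scaler0 addr0.
  by rewrite subr_eq0 => /eqP ->; rewrite memv_proj.
by rewrite projv_id // subrr; congr pair; apply/matrixP => i j; rewrite !mxE.
Qed.

Lemma mem_ann (W : {vspace cvec}) (xi : cvec) :
  reflect (forall X, X \in W -> (xi *m X^T) 0 0 = 0) (xi \in ann W).
Proof.
rewrite memv_ker linfunE /=; last first.
  by move=> a x y; apply/rowP => k; rewrite !mxE mulr_sumr -big_split; apply: eq_bigr => j _;
    rewrite !mxE mulrDl mulrA.
apply: (iffP eqP) => [h X /coord_vbasis ->|h].
  rewrite linear_sum mulmx_sumr summxE big1 // => k _.
  rewrite linearZ /= -scalemxAr mxE.
  by have /rowP/(_ k) := h; rewrite !mxE => ->; rewrite mulr0.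
apply/rowP => k; rewrite mxE h ?mxE //.
by rewrite vbasis_mem // mem_nth // size_tuple.
Qed.

Lemma mem_tangent_part (L : {vspace gtan R m}) (X : cvec) :
  reflect (exists xi, (X, xi) \in L) (X \in tangent_part L).
Proof.
have lE u : linfun (fun u : gtan R m => u.1) u = u.1 by rewrite linfunE.
apply: (iffP memv_imgP) => [[[Y xi] uL ->]|[xi uL]].
  by exists xi; rewrite lE.
by exists (X, xi) => //; rewrite lE.
Qed.

Lemma mem_plus_ann (W : {vspace cvec}) (u : gtan R m) :
  (u \in plus_ann W) = (u.1 \in W) && (u.2 \in ann W).
Proof.
have l1 X : linfun (fun X : cvec => (X, 0) : gtan R m) X = (X, 0).
  by rewrite linfunE // => a x y; congr pair; rewrite /= scaler0 addr0.
have l2 X : linfun (fun X : cvec => (0, X) : gtan R m) X = (0, X).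
  by rewrite linfunE // => a x y; congr pair; rewrite /= scaler0 addr0.
apply/idP/andP => [/memv_addP[_ /memv_imgP[X XW ->] [_ /memv_imgP[xi xiW ->] ->]]|].
  by rewrite l1 l2 /= addr0 add0r.
case: u => X xi /= [XW xiW].
have -> : ((X, xi) : gtan R m) = ((X, 0) : gtan R m) + (0, xi).
  by congr pair; rewrite /= ?addr0 ?add0r.
by rewrite memv_add // -?l1 -?l2 memv_img.
Qed.

Lemma mem_exp_form_space (B : 'M[R]_m) (W : {vspace gtan R m}) (u : gtan R m) :
  reflect (exists2 w, w \in W & u = exp_form B w) (u \in exp_form_space B W).
Proof.
have lE w : linfun (exp_form B) w = exp_form B w.
  rewrite linfunE // => a x y; congr pair => /=.
  by rewrite mulmxDl -scalemxAl scalerDr addrACA.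
by apply: (iffP memv_imgP) => -[w wW ->]; exists w; rewrite ?lE.
Qed.

Lemma mem_cr_fibre (S F : {vspace rvec}) (J : 'M[R]_m) (v : cvec) :
  (v \in cr_fibre S F J) =
  (v \in complexify S) && (v *m cmx J - 'i%C *: v \in complexify F).
Proof.
rewrite memv_cap -memv_preim linfunE // => a x y.
rewrite mulmxDl -scalemxAl scalerDr opprD addrACA scalerBr !scalerA.
by rewrite (mulrC a).
Qed.

End LinearAlgebraTheory.

Section Geometry.
Variables (R : realType) (m : nat) (M : manifold R m).
Local Notation C := R[i].
Local Notation rvec := 'rV[R]_m.
Local Notation cvec := 'rV[C]_m.

(* The tangent space at p is R^m through a chosen preferred chart at p, and
   the cotangent space its dual. Thus a vector field is a map M -> 'rV[R]_m,
   whose value at p lists the components in the basis d/dx_k of the preferred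
   chart at p, and similarly for forms and complexified sections. *)
Definition chart_at (p : M) : chart_index M := projT1 (cid (chart_cover p)).

(* v *m coord_change i j p are the components in chart j of the tangent vector
   at p with components v in chart i. *)
Definition coord_change (i j : chart_index M) (p : M) : 'M[R]_m :=
  jacobian (chart j \o chart_inv i) (chart i p).

(* Local expressions in chart i: vectors are pushed forward to the chart,
   covectors and bilinear forms are pulled back from the preferred one. *)
Definition local_vec i (X : M -> rvec) (x : rvec) : rvec :=
  let p := chart_inv i x in X p *m coord_change (chart_at p) i p.
Definition local_cvec i (X : M -> cvec) (x : rvec) : cvec :=
  let p := chart_inv i x in X p *m cmx (coord_change (chart_at p) i p).
Definition local_ccovec i (xi : M -> cvec) (x : rvec) : cvec :=
  let p := chart_inv i x in xi p *m (cmx (coord_change i (chart_at p) p))^T.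
Definition local_form i (B : M -> 'M[R]_m) (x : rvec) : 'M[R]_m :=
  let p := chart_inv i x in
  let K := coord_change i (chart_at p) p in K *m B p *m K^T.

Definition smooth_vec (U : set M) (X : M -> rvec) : Prop :=
  forall i k, smooth_on (chart i @` (chart_dom i `&` U))
                        (fun x => local_vec i X x 0 k).
Definition smooth_cvec (U : set M) (X : M -> cvec) : Prop :=
  forall i k, csmooth_on (chart i @` (chart_dom i `&` U))
                         (fun x => local_cvec i X x 0 k).
Definition smooth_ccovec (U : set M) (xi : M -> cvec) : Prop :=
  forall i k, csmooth_on (chart i @` (chart_dom i `&` U))
                         (fun x => local_ccovec i xi x 0 k).
Definition smooth_gtan (U : set M) (a : M -> gtan R m) : Prop :=
  smooth_cvec U (fun p => (a p).1) /\ smooth_ccovec U (fun p => (a p).2).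

Definition real_two_form (B : M -> 'M[R]_m) : Prop :=
  (forall p, (B p)^T = - B p) /\
  (forall i k l, smooth_on (chart i @` chart_dom i)
                           (fun x => local_form i B x k l)).

(* [X,Y]^k = X^j d_j Y^k - Y^j d_j X^k,
   (L_X eta)_k = X^j d_j eta_k + eta_j d_k X^j,
   (i_Y d xi)_k = Y^j (d_j xi_k - d_k xi_j). *)
Definition lie_coord (X Y : rvec -> cvec) (x : rvec) : cvec :=
  \row_k \sum_j (X x 0 j * cpartial j (fun y => Y y 0 k) x
                 - Y x 0 j * cpartial j (fun y => X y 0 k) x).
Definition lie_derivative_coord (X eta : rvec -> cvec) (x : rvec) : cvec :=
  \row_k \sum_j (X x 0 j * cpartial j (fun y => eta y 0 k) x
                 + eta x 0 j * cpartial k (fun y => X y 0 j) x).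
Definition contract_d_coord (Y xi : rvec -> cvec) (x : rvec) : cvec :=
  \row_k \sum_j Y x 0 j * (cpartial j (fun y => xi y 0 k) x
                           - cpartial k (fun y => xi y 0 j) x).

(* At p these are computed in the preferred chart at p. *)
Definition lie_bracket (X Y : M -> cvec) (p : M) : cvec :=
  let i := chart_at p in
  lie_coord (local_cvec i X) (local_cvec i Y) (chart i p).

Definition dorfman (a b : M -> gtan R m) (p : M) : gtan R m :=
  let i := chart_at p in
  let X := local_cvec i (fun q => (a q).1) in
  let xi := local_ccovec i (fun q => (a q).2) in
  let Y := local_cvec i (fun q => (b q).1) in
  let eta := local_ccovec i (fun q => (b q).2) in
  (lie_coord X Y (chart i p),
   lie_derivative_coord X eta (chart i p) - contract_d_coord Y xi (chart i p)).

(* W is a smooth subbundle of rank k of the bundle with fibre V whose smooth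
   sections are given by smooth_sec: it has smooth local frames. *)
Definition subbundle (K : fieldType) (V : vectType K)
    (smooth_sec : set M -> (M -> V) -> Prop) (k : nat) (W : M -> {vspace V}) :
  Prop :=
  forall p : M, exists (U : set M) (X : 'I_k -> M -> V),
    [/\ open U, U p, forall l, smooth_sec U (X l) &
        forall q, U q -> basis_of (W q) [seq X l q | l <- enum 'I_k]].

(* Sections are taken over arbitrary open subsets of M. *)
Definition section_on (K : fieldType) (V : vectType K)
    (smooth_sec : set M -> (M -> V) -> Prop) (W : M -> {vspace V})
    (U : set M) (X : M -> V) : Prop :=
  smooth_sec U X /\ forall p, U p -> X p \in W p.

Definition bracket_closed (K : fieldType) (V : vectType K)
    (smooth_sec : set M -> (M -> V) -> Prop)
    (bracket : (M -> V) -> (M -> V) -> M -> V) (W : M -> {vspace V}) : Prop :=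
  forall (U : set M) (a b : M -> V), open U ->
    section_on smooth_sec W U a -> section_on smooth_sec W U b ->
    forall p, U p -> bracket a b p \in W p.

Definition regular_distribution (D : M -> {vspace rvec}) : Prop :=
  exists k, subbundle smooth_vec k D.
Definition regular_cdistribution (E : M -> {vspace cvec}) : Prop :=
  exists k, subbundle smooth_cvec k E.
Definition cinvolutive (E : M -> {vspace cvec}) : Prop :=
  bracket_closed smooth_cvec lie_bracket E.

(* Through each point p passes an integral manifold, parametrized by an
   injective immersion sigma of an open neighbourhood W of 0 in R^k. *)
Definition integrable_distribution (F : M -> {vspace rvec}) : Prop :=
  forall p : M, exists (k : nat) (W : set 'rV[R]_k) (sigma : 'rV[R]_k -> M),
    [/\ open W, W 0 & sigma 0 = p] /\
    [/\ forall w, W w -> {for w, continuous sigma},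
        forall w w', W w -> W w' -> sigma w = sigma w' -> w = w',
        forall i, smooth_map_on (W `&` sigma @^-1` chart_dom i)
                                (chart i \o sigma) &
        forall w, W w ->
          let T := jacobian (chart (chart_at (sigma w)) \o sigma) w in
          row_free T /\ forall v, (v \in F (sigma w)) = (v <= T)%MS].

Definition lagrangian (L : {vspace gtan R m}) : Prop :=
  forall u, (u \in L) <-> (forall v, v \in L -> pairing u v = 0).

Record complex_dirac (L : M -> {vspace gtan R m}) : Prop := ComplexDirac {
  dirac_subbundle : exists k, subbundle smooth_gtan k L;
  dirac_lagrangian : forall p, lagrangian (L p);
  dirac_closed : bracket_closed smooth_gtan dorfman L
}.

Section Invariants.
Variable L : M -> {vspace gtan R m}.

Definition E_L (p : M) : {vspace cvec} := tangent_part (L p).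
Definition Delta_L (p : M) : {vspace rvec} :=
  real_part (E_L p :&: conj_space (@conj_mx R 1 m) (E_L p))%VS.
Definition D_L (p : M) : {vspace rvec} :=
  real_part (E_L p + conj_space (@conj_mx R 1 m) (E_L p))%VS.

Definition real_index (p : M) : nat :=
  \dim (L p :&: conj_space (@conj_gtan R m) (L p))%VS.
Definition dirac_order (p : M) : nat := (m - \dim (D_L p))%N.
(* The difference is always even, so the truncated half is exact. *)
Definition dirac_type (p : M) : nat := (\dim (D_L p) - \dim (Delta_L p))./2.

End Invariants.

(* A bundle map S / F -> S / F is represented by fibrewise endomorphisms
   v |-> v *m J p preserving S and F; only the induced map on S / F matters,
   and tcr_J_smooth says that this induced map takes (local) smooth sections to
   smooth sections. *)
Record transverse_CR (S F : M -> {vspace rvec}) (J : M -> 'M[R]_m) : Prop :=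
  TransverseCR {
  tcr_sub : forall p, (F p <= S p)%VS;
  tcr_regular_S : regular_distribution S;
  tcr_regular_F : regular_distribution F;
  tcr_integrable : integrable_distribution F;
  tcr_J_S : forall p v, v \in S p -> v *m J p \in S p;
  tcr_J_F : forall p v, v \in F p -> v *m J p \in F p;
  tcr_J_smooth : forall (U : set M) (X : M -> rvec) p, open U -> U p ->
    section_on smooth_vec S U X ->
    exists (V : set M) (Y : M -> rvec),
      [/\ open V, V p, V `<=` U, section_on smooth_vec S V Y &
          forall q, V q -> Y q - X q *m J q \in F q];
  tcr_J_square : forall p v, v \in S p -> v *m J p *m J p + v \in F p;
  tcr_regular_E : regular_cdistribution (fun p => cr_fibre (S p) (F p) (J p));
  tcr_involutive_E : cinvolutive (fun p => cr_fibre (S p) (F p) (J p))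
}.

Definition dirac_of_CR (S F : M -> {vspace rvec}) (J : M -> 'M[R]_m) (p : M) :
  {vspace gtan R m} := plus_ann (cr_fibre (S p) (F p) (J p)).

End Geometry.

(* Main.v *)
(* Write E = E_L, D = D_L and Delta = Delta_L. When the type is maximal, counting dimensions
   shows that L \cap Lbar projects onto E \cap Ebar, so the two-form eps(X, Y) = xi(Y) on E,
   X + xi in L, is real on Delta. Locally this gives smooth real frames d of Delta and (d, a, b)
   of D such that (d, a + ib) spans E, and a real two-form B restricting to eps on E: twice the
   real part of the pullback of eps along a projection D_C -> E, minus eps on Delta, which would
   otherwise count twice. The condition B|_E = eps is affine in B, so local solutions glue by
   cutoff functions, and L = e^B (E + Ann E). The section X + i_X B of L shows that E is
   involutive, hence so is Delta. J is multiplication by i on E / Delta_C. Finally, the fields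
   (d N)^-1 d, with N a constant matrix, commute, and the time-one maps of their flows
   parametrise the leaves of Delta. *)

(* The count behind the first step: L \cap Lbar has dimension r = m - 2n, where m is the dimension
   of M. Its part over the zero vector annihilates D and its projection lies in E \cap Ebar, so r <=
   (m - dim D) + dim Delta, and type n leaves no slack. The order then fixes dim D = m - s and dim
   Delta = r - s, so that frames of constant size can exist. The first obstacle is the smoothness of
   the intersection Delta: a frame of E whose first rows are real at one point does not keep them
   real nearby, and has to be corrected through coordinates in a real frame of D. The second is J,
   which is canonical only modulo Delta: it is chosen point by point, and smoothness is proved for
   its class. The leaves bypass the general theorem on smooth dependence of flows on parameters.
   Because the fields commute, the derivative of the time-one map sigma at u is the frame X = (d
   N)^-1 d at sigma(u), so the smoothness of sigma bootstraps from that of X; and X N = 1 gives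
   sigma(u) N = sigma(0) N + u, hence injectivity. *)
Require Import Defs.
From HB Require Import structures.
From mathcomp Require Import all_boot all_order all_algebra.
From mathcomp Require Import complex.
From mathcomp Require Import all_classical all_reals all_analysis.
From mathcomp Require Import ring lra zify.

Set Implicit Arguments.
Unset Strict Implicit.
Unset Printing Implicit Defensive.
Import Order.TTheory GRing.Theory Num.Theory numFieldNormedType.Exports.
Local Open Scope classical_set_scope.
Local Open Scope ring_scope.

(** * Smooth functions and matrices *)

Section Calculus.
Variable R : realType.

(** An epsilon form of Frechet differentiability that also identifies the differential. Components,
    locally equal functions, time-one maps of flows and the flat function at 0 are all handled
    through it. *)
Lemma differentiable_crit (V W : normedModType R) (f : V -> W) (x : V)
    (df : {linear V -> W}) : continuous df ->
  (forall e : R, 0 < e ->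
    \forall h \near (0 : V), `|f (h + x) - f x - df h| <= e * `|h|) ->
  differentiable f x /\ 'd f x = df :> (V -> W).
Proof.
move=> dfc small.
have fE : f \o shift x = cst (f x) + df +o_ (0 : V) id.
  apply/eqaddoP => e /small; apply: filterS => h.
  by rewrite /= /cst opprD addrA.
have dE : 'd f x = df :> (V -> W) by exact: diff_unique fE.
split=> //; apply/diff_locallyP; split; first by rewrite dE.
by rewrite dE fE.
Qed.

Lemma differentiable_small (V W : normedModType R) (f : V -> W) (x : V) :
  differentiable f x -> forall e : R, 0 < e ->
  \forall h \near (0 : V), `|f (h + x) - f x - 'd f x h| <= e * `|h|.
Proof.
move=> /diff_locallyP[_ /eqaddoP fE] e /fE; apply: filterS => h.
by rewrite /= /cst opprD addrA.
Qed.

Lemma near_eq_differentiable (V W : normedModType R) (f g : V -> W) (x : V) :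
  {near x, f =1 g} -> differentiable f x -> differentiable g x.
Proof.
move=> fg df; have fgx := nbhs_singleton fg.
have [|//] := @differentiable_crit V W g x ('d f x) (diff_continuous df).
move=> e e0; near=> h.
rewrite -(_ : f (h + x) = g (h + x)); last first.
  near: h; move: fg; rewrite (near_shift 0) /= subr0.
  by apply: filterS => h /=.
rewrite -fgx; near: h; exact: differentiable_small.
Unshelve. all: by end_near. Qed.

Section Vectors.
Variable V : normedModType R.

Lemma rV_normP m (v : 'rV[R]_m) (e : R) : 0 <= e ->
  (`|v| <= e) <-> (forall j, `|v 0 j| <= e).
Proof.
move=> e0; rewrite {1}/Num.Def.normr /= mx_normrE; split=> [h j|h].
  by apply: le_trans h; exact: (le_bigmax _ (fun ij => `|v ij.1 ij.2|) (0, j)).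
by apply: bigmax_le => // -[i j] _ /=; rewrite ord1.
Qed.

Lemma rV_norm_coord m (v : 'rV[R]_m) j : `|v 0 j| <= `|v|.
Proof. exact: (rV_normP v (normr_ge0 v)).1. Qed.

Lemma coord_cvg_rV m (F : set_system V) (FF : Filter F) (f : V -> 'rV[R]_m) (l : 'rV[R]_m) :
  (forall j, (f x 0 j) @[x --> F] --> (l 0 j : R)) -> f x @[x --> F] --> l.
Proof.
move=> fc; apply/cvgrPdist_le => e e0; near=> x.
apply/rV_normP; first exact: ltW.
near: x; apply: filter_forall => j.
by near do rewrite !mxE; exact: ((cvgrPdist_le _ _).1 (fc j)).
Unshelve. all: by end_near. Qed.

Lemma differentiable_rV m (f : V -> 'rV[R]_m) (x : V) :
  (forall j, differentiable (fun y => f y 0 j) x) -> differentiable f x.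
Proof.
move=> df.
pose L (h : V) : 'rV[R]_m := \row_j 'd (fun y => f y 0 j) x h.
have Llin : linear L.
  by move=> a u v; apply/rowP => j; rewrite !mxE linearP.
pose LL : {linear V -> 'rV[R]_m} := HB.pack L (GRing.isLinear.Build _ _ _ _ L Llin).
have [||//] := @differentiable_crit V 'rV[R]_m f x LL.
  move=> y; apply: coord_cvg_rV => j /=.
  rewrite mxE (_ : (fun x0 => _) = 'd (fun y => f y 0 j) x); first exact: diff_continuous.
  by apply/funext => z; rewrite mxE.
move=> e e0; near=> h; apply/rV_normP; first by rewrite mulr_ge0 // ltW.
near: h; apply: filter_forall => j.
by near do rewrite !mxE; exact: (differentiable_small (df j)).
Unshelve. all: by end_near. Qed.

Lemma differentiable_rV_coord m (f : V -> 'rV[R]_m) (x : V) j :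
  differentiable f x -> differentiable (fun y => f y 0 j) x.
Proof.
move=> df; apply: (@differentiable_comp R V 'rV[R]_m R f (fun M : 'rV[R]_m => M 0 j) x df).
exact: differentiable_coord.
Qed.

End Vectors.

Section Ck.
Variable m : nat.
Implicit Types (U V : set 'rV[R]_m) (f g : 'rV[R]_m -> R).

Lemma Ck_on_sub k U V f : V `<=` U -> Ck_on k U f -> Ck_on k V f.
Proof.
elim: k f => [|k IH] f VU /=; first by move=> h x /VU/h.
by move=> [h1 h2]; split=> [x /VU/h1 //|j]; apply: IH.
Qed.

(** [Ck_on] only sees the germs of f at the points of the set, so V may be any set containing x. *)
Lemma Ck_on_local k U f :
  (forall x, U x -> exists2 V, V x & Ck_on k V f) -> Ck_on k U f.
Proof.
elim: k f => [|k IH] f loc /=; first by move=> x /loc[V Vx]; apply.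
split=> [x /loc[V Vx [+ _]]|j]; first exact.
by apply: IH => x /loc[V Vx [_ h]]; exists V => //; exact: h.
Qed.

(** On an open set the two functions agree near each point, so their partial derivatives agree on
    the set too and the induction goes on. *)
Lemma eq_Ck_on k U f g : open U -> (forall x, U x -> f x = g x) ->
  Ck_on k U f -> Ck_on k U g.
Proof.
move=> oU; elim: k f g => [|k IH] f g fg /=.
  move=> h x Ux; have nfg : {near x, f =1 g}.
    by apply: filterS (open_nbhs_nbhs (conj oU Ux)) => y /fg.
  rewrite /prop_for /continuous_at -(fg x Ux).
  by apply: (cvg_trans (near_eq_cvg nfg)); exact: h.
move=> [h1 h2]; have nfg x : U x -> {near x, f =1 g}.
  by move=> Ux; apply: filterS (open_nbhs_nbhs (conj oU Ux)) => y /fg.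
split=> [x Ux|j]; first exact: near_eq_differentiable (nfg x Ux) (h1 x Ux).
by apply: IH (h2 j) => x Ux; apply: near_eq_derive; exact: nfg.
Qed.

Lemma Ck_onW k U f : Ck_on k.+1 U f -> Ck_on k U f.
Proof.
elim: k f => [|k IH] f [h1 h2].
  by move=> x /h1; exact: differentiable_continuous.
by split=> // j; apply: IH.
Qed.

Lemma Ck_on_cst k U (c : R) : Ck_on k U (cst c).
Proof.
elim: k c => [|k IH] c /=; first by move=> x _; exact: cst_continuous.
split=> [x _|j]; first exact: differentiable_cst.
by under [X in Ck_on _ _ X]funext do rewrite derive_cst; exact: IH.
Qed.

Lemma Ck_onD k U f g : open U -> Ck_on k U f -> Ck_on k U g ->
  Ck_on k U (fun x => f x + g x).
Proof.
move=> oU; elim: k f g => [|k IH] f g /=.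
  by move=> fc gc x Ux; apply: continuousD; [exact: fc|exact: gc].
move=> [f1 f2] [g1 g2]; split=> [x Ux|j].
  by apply: differentiableD; [exact: f1|exact: g1].
apply: eq_Ck_on (IH _ _ (f2 j) (g2 j)) => // x Ux.
by rewrite -deriveD //; apply: diff_derivable; [exact: f1|exact: g1].
Qed.

Lemma Ck_onM k U f g : open U -> Ck_on k U f -> Ck_on k U g ->
  Ck_on k U (fun x => f x * g x).
Proof.
move=> oU; elim: k f g => [|k IH] f g.
  by move=> fc gc x Ux; apply: continuousM; [exact: fc|exact: gc].
move=> Cf Cg; have [f1 f2] := Cf; have [g1 g2] := Cg; split=> [x Ux|j].
  by apply: differentiableM; [exact: f1|exact: g1].
have := Ck_onD oU (IH _ _ (Ck_onW Cf) (g2 j)) (IH _ _ (Ck_onW Cg) (f2 j)).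
apply: eq_Ck_on => // x Ux.
by rewrite -[LHS]deriveM //; apply: diff_derivable; [exact: f1|exact: g1].
Qed.

Lemma Ck_on_sum k U (I : Type) (s : seq I) (F : I -> 'rV[R]_m -> R) : open U ->
  (forall i, Ck_on k U (F i)) -> Ck_on k U (fun x => \sum_(i <- s) F i x).
Proof.
move=> oU CF; elim: s => [|i s IH].
  by under [X in Ck_on _ _ X]funext do rewrite big_nil; exact: Ck_on_cst.
by under [X in Ck_on _ _ X]funext do rewrite big_cons; exact: Ck_onD.
Qed.

Lemma Ck_on_coord k U j : Ck_on k U (fun x => x 0 j).
Proof.
case: k => [|k] /=; first by move=> x _; exact: coord_continuous.
split=> [x _|l]; first exact: differentiable_coord.
rewrite (_ : (fun x => _) = cst ((delta_mx 0 l : 'rV[R]_m) 0 j)).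
  exact: Ck_on_cst.
apply/funext => x /=.
have clin : linear (fun y : 'rV[R]_m => y 0 j) by move=> a u v; rewrite !mxE.
pose cc : {linear 'rV[R]_m -> R} := HB.pack (fun y : 'rV[R]_m => y 0 j)
  (GRing.isLinear.Build _ _ _ _ _ clin).
rewrite deriveE; last exact: differentiable_coord.
rewrite (diff_lin (f := cc)) //; exact: coord_continuous.
Qed.

Lemma Ck_onV k U f : open U -> (forall x, U x -> f x != 0) -> Ck_on k U f ->
  Ck_on k U (fun x => (f x)^-1).
Proof.
move=> oU f0; elim: k => [|k IH] Cf.
  by move=> x Ux; apply: continuousV; [exact: f0|exact: Cf].
have /IH Ck := Ck_onW Cf; have [f1 f2] := Cf; split=> [x Ux|j].
  by apply: differentiableV; [exact: f1|exact: f0].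
have := Ck_onM oU (Ck_on_cst k U (-1)) (Ck_onM oU (Ck_onM oU Ck Ck) (f2 j)).
apply: eq_Ck_on => // x Ux; rewrite deriveV ?f0 //; last exact/diff_derivable/f1.
by rewrite /cst mulN1r scaleNr expr2 invfM.
Qed.

End Ck.

Lemma linear_delta_sum n (V : lmodType R) (L : {linear 'rV[R]_n -> V}) (v : 'rV[R]_n) :
  L v = \sum_l v 0 l *: L (delta_mx 0 l).
Proof. by rewrite {1}[v]row_sum_delta linear_sum; under eq_bigr do rewrite linearZ. Qed.

Lemma derive_sum_partial n (f : 'rV[R]_n -> R) x v : differentiable f x ->
  'D_v f x = \sum_l v 0 l * 'D_(delta_mx 0 l) f x.
Proof.
move=> df; rewrite deriveE // linear_delta_sum.
by apply: eq_bigr => l _; rewrite deriveE.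
Qed.

Lemma derive_rV_coord n (V : normedModType R) (g : V -> 'rV[R]_n) x v l :
  differentiable g x -> ('D_v g x) 0 l = 'D_v (fun y => g y 0 l) x.
Proof. by move=> dg; rewrite derive_mx ?mxE //; exact: diff_derivable. Qed.

Lemma derive_comp_partial (V : normedModType R) n (g : V -> 'rV[R]_n) (f : 'rV[R]_n -> R) x v :
  differentiable g x -> differentiable f (g x) ->
  'D_v (f \o g) x = \sum_l 'D_v (fun y => g y 0 l) x * 'D_(delta_mx 0 l) f (g x).
Proof.
move=> dg df; rewrite deriveE; last exact: differentiable_comp.
rewrite diff_comp //= -deriveE // derive_sum_partial //.
by apply: eq_bigr => l _; rewrite -deriveE // derive_rV_coord.
Qed.

(** By the chain rule the partials of f o g are sums of products of partials of g with (partials of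
    f) o g. The induction hypothesis applies to each partial of f, with g weakened by one degree. *)
Lemma Ck_on_comp k m n (U : set 'rV[R]_m) (V : set 'rV[R]_n) (g : 'rV[R]_m -> 'rV[R]_n) f :
  open U -> (forall x, U x -> V (g x)) ->
  (forall j, Ck_on k U (fun x => g x 0 j)) -> Ck_on k V f ->
  Ck_on k U (f \o g).
Proof.
move=> oU UV; elim: k f => [|k IH] f Cg Cf.
  move=> x Ux; apply: continuous_comp; last exact/Cf/UV.
  by apply: (@coord_cvg_rV 'rV[R]_m _ (nbhs x)) => j; exact: Cg.
have [f1 f2] := Cf.
have dg x : U x -> differentiable g x.
  by move=> Ux; apply: differentiable_rV => j; have [+ _] := Cg j; exact.
split=> [x Ux|j].
  by apply: differentiable_comp; [exact: dg|exact/f1/UV].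
have CW l : Ck_on k U (fun x => g x 0 l) by exact/Ck_onW/Cg.
suff : Ck_on k U (fun x => \sum_l 'D_(delta_mx 0 j) (fun y => g y 0 l) x *
                                   'D_(delta_mx 0 l) f (g x)).
  apply: eq_Ck_on => // x Ux; rewrite -derive_comp_partial //; first exact: dg.
  exact/f1/UV.
apply: Ck_on_sum => // l; apply: Ck_onM => //; first by have [_] := Cg l; exact.
exact: IH CW (f2 l).
Qed.

(** * Mean value estimates, Taylor remainders and the symmetry of second derivatives *)

Section MeanValue.
Variable m : nat.
Implicit Types (U : set 'rV[R]_m) (f : 'rV[R]_m -> R).

Lemma is_derive_line (V W : normedModType R) (g : V -> W) (x v : V) (t : R) :
  derivable g (t *: v + x) v ->
  is_derive t (1 : R) (fun s : R => g (s *: v + x)) ('D_v g (t *: v + x)).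
Proof.
move=> dg.
have E : (fun h : R => h^-1 *: (((fun s : R => g (s *: v + x)) \o shift t) (h *: (1 : R)) -
             g (t *: v + x))) =
         (fun h : R => h^-1 *: ((g \o shift (t *: v + x)) (h *: v) - g (t *: v + x))).
  apply/funext => h /=; rewrite -[h *: (1 : R)]/(h * 1) mulr1.
  by rewrite scalerDl addrA.
by split; [rewrite /derivable E|rewrite /derive E].
Qed.

Lemma nbhs_rVP (x : 'rV[R]_m) (A : set 'rV[R]_m) : nbhs x A <->
  exists2 e : R, 0 < e & forall y, `|y - x| < e -> A y.
Proof.
split=> [/nbhs_ballP[e e0 eA]|[e e0 eA]].
  by exists e => // y yx; apply: eA; rewrite -ball_normE /ball_ /= distrC.
by apply/nbhs_ballP; exists e => // y; rewrite -ball_normE /ball_ /= distrC; exact: eA.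
Qed.

Lemma segment_in_ball (x0 x y : 'rV[R]_m) (e t : R) : 0 <= t <= 1 ->
  `|x - x0| < e -> `|y - x0| < e -> `|t *: (y - x) + x - x0| < e.
Proof.
move=> /andP[t0 t1] xe ye.
have -> : t *: (y - x) + x - x0 = t *: (y - x0) + (1 - t) *: (x - x0).
  by apply/rowP => j; rewrite !mxE; ring.
apply: le_lt_trans (ler_normD _ _) _; rewrite !normrZ !ger0_norm ?subr_ge0 //.
have [->|tn] := eqVneq t 0; first by rewrite mul0r add0r subr0 mul1r.
have tp : 0 < t by rewrite lt_def tn.
have : t * `|y - x0| < t * e by rewrite ltr_pM2l.
have : (1 - t) * `|x - x0| <= (1 - t) * e by rewrite ler_wpM2l ?subr_ge0 // ltW.
move=> h1 h2; have := ltr_leD h2 h1; congr (_ < _); ring.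
Qed.

Lemma mean_value_segment f (x y : 'rV[R]_m) :
  (forall t : R, 0 <= t <= 1 -> differentiable f (t *: (y - x) + x)) ->
  exists2 t : R, 0 <= t <= 1 &
    f y - f x = \sum_l (y - x) 0 l * 'D_(delta_mx 0 l) f (t *: (y - x) + x).
Proof.
move=> df.
have dl (t : R) : 0 <= t <= 1 ->
    is_derive t (1 : R) (fun s : R => f (s *: (y - x) + x)) ('D_(y - x) f (t *: (y - x) + x)).
  by move=> /df d; apply: is_derive_line; exact: diff_derivable.
have [||t] := @MVT R (fun s : R => f (s *: (y - x) + x))
    (fun t => 'D_(y - x) f (t *: (y - x) + x)) 0 1 ltr01.
- by move=> t; rewrite in_itv /= => /andP[t0 t1]; apply: dl; rewrite !ltW.
- apply: continuous_in_subspaceT => s; rewrite inE /= in_itv /= => s01.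
  by have [d _] := dl s s01; apply: differentiable_continuous; exact/derivable1_diffP.
rewrite in_itv /= => /andP[t0 t1]; have t01 : 0 <= t <= 1 by rewrite !ltW.
rewrite scale1r scale0r subrK add0r subr0 mulr1 => ->; exists t => //.
by rewrite derive_sum_partial //; exact: df.
Qed.

Lemma Ck_on_locally_lipschitz U f x0 : open U -> U x0 -> Ck_on 1 U f ->
  exists e C, [/\ 0 < e, 0 < C, forall y, `|y - x0| < e -> U y &
    forall x y, `|x - x0| < e -> `|y - x0| < e -> `|f y - f x| <= C * `|y - x|].
Proof.
move=> oU Ux0 [f1 f2].
have : \forall x \near x0, U x /\ forall j, `|'D_(delta_mx 0 j) f x| <=
      `|'D_(delta_mx 0 j) f x0| + 1.
  near=> x; split; first by near: x; exact: (open_nbhs_nbhs (conj oU Ux0)).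
  near: x; apply: filter_forall => j.
  have /cvgrPdist_le/(_ 1 ltr01) := f2 j x0 Ux0.
  apply: filterS => x h; rewrite -lerBlDl; apply: le_trans h.
  by rewrite distrC; exact: lerB_dist.
move/nbhs_rVP => [e e0 he].
(* The last + 1 keeps C positive when m = 0. *)
pose C := \sum_(j < m) (`|'D_(delta_mx 0 j) f x0| + 1) + 1.
exists e, C; split=> //.
- by rewrite ltr_wpDl // sumr_ge0 // => j _; rewrite addr_ge0.
- by move=> y /he[].
move=> x y xe ye.
have seg (t : R) (t01 : 0 <= t <= 1) : `|t *: (y - x) + x - x0| < e by exact: segment_in_ball.
have [t /seg/he[_ ht] ->] : exists2 t : R, 0 <= t <= 1 &
    f y - f x = \sum_l (y - x) 0 l * 'D_(delta_mx 0 l) f (t *: (y - x) + x).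
  by apply: mean_value_segment => t /seg/he[/f1].
apply: le_trans (ler_norm_sum _ _ _) _; rewrite mulrDl mul1r mulr_suml.
rewrite ler_wpDr //; apply: ler_sum => j _; rewrite normrM mulrC.
by apply: ler_pM => //; exact: rV_norm_coord.
Unshelve. all: by end_near. Qed.

(** Radii can be shrunk and constants enlarged finitely often, so that the estimates for all entries
    of a matrix share one ball and one constant. *)
Lemma common_radius (I : finType) (P : I -> R -> R -> Prop) :
  (forall i e C e' C', P i e C -> 0 < e' -> e' <= e -> C <= C' -> P i e' C') ->
  (forall i, exists e C, [/\ 0 < e, 0 < C & P i e C]) ->
  exists e C, [/\ 0 < e, 0 < C & forall i, P i e C].
Proof.
move=> mono ex; suff [e [C [e0 C0 h]]] : exists e C, [/\ 0 < e, 0 < C &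
    forall i, i \in enum I -> P i e C].
  by exists e, C; split=> // i; apply: h; rewrite mem_enum.
elim: (enum I) => [|i s [e [C [e0 C0 IH]]]]; first by exists 1, 1; split.
have [e' [C' [e'0 C'0 h]]] := ex i.
have m0 : 0 < Num.min e e' by rewrite lt_min e0.
exists (Num.min e e'), (Num.max C C'); split=> //; first by rewrite lt_max C0.
move=> j; rewrite inE => /predU1P[->|/IH]; last first.
  by move=> /mono; apply=> //; rewrite ?ge_min ?le_max lexx.
by apply: mono h _ _ _ => //; rewrite ?ge_min ?le_max lexx orbT.
Qed.

(** The mean value theorem evaluates the partials at a point of the segment, and their Lipschitz
    bound turns the error into a quadratic one, uniformly in the base point x. *)
Lemma Ck_on_taylor U f x0 : open U -> U x0 -> Ck_on 2 U f ->
  exists e C, [/\ 0 < e, 0 < C, forall y, `|y - x0| < e -> U y &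
    forall x y, `|x - x0| < e -> `|y - x0| < e ->
    `|f y - f x - \sum_l (y - x) 0 l * 'D_(delta_mx 0 l) f x| <= C * `|y - x| ^+ 2].
Proof.
move=> oU Ux0 Cf; have [f1 f2] := Cf.
pose P (j : 'I_m) (e C : R) := (forall y, `|y - x0| < e -> U y) /\
    forall x y, `|x - x0| < e -> `|y - x0| < e ->
    `|'D_(delta_mx 0 j) f y - 'D_(delta_mx 0 j) f x| <= C * `|y - x|.
have [||e [C [e0 C0 h]]] := @common_radius 'I_m P.
- move=> j e C e' C' [h1 h2] _ ee CC; split=> [y ye|x y xe ye].
    by apply: h1; exact: lt_le_trans ee.
  apply: le_trans (h2 _ _ (lt_le_trans xe ee) (lt_le_trans ye ee)) _.
  exact: ler_wpM2r.
- move=> j; have [e [C [e0 C0 h1 h2]]] := Ck_on_locally_lipschitz oU Ux0 (f2 j).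
  by exists e, C; split.
have /nbhs_rVP[e1 e10 he1] := open_nbhs_nbhs (conj oU Ux0).
pose e' := Num.min e e1; pose C' := m%:R * C + 1.
exists e', C'; split=> [|||x y].
- by rewrite lt_min e0.
- by rewrite ltr_wpDl // mulr_ge0 // ltW.
- by move=> y; rewrite lt_min => /andP[_ /he1].
rewrite !lt_min => /andP[xe xe1] /andP[ye ye1].
have [t t01 ->] : exists2 t : R, 0 <= t <= 1 &
    f y - f x = \sum_l (y - x) 0 l * 'D_(delta_mx 0 l) f (t *: (y - x) + x).
  by apply: mean_value_segment => t t01; apply: f1; apply: he1; exact: segment_in_ball.
rewrite -sumrB; apply: le_trans (ler_norm_sum _ _ _) _.
have -> : C' * `|y - x| ^+ 2 = \sum_(j < m) (C * `|y - x| ^+ 2) + `|y - x| ^+ 2.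
  by rewrite sumr_const card_ord /C' mulrDl mul1r -mulrA mulr_natl.
rewrite ler_wpDr ?exprn_ge0 //; apply: ler_sum => j _.
rewrite -mulrBr normrM expr2 mulrA mulrC; apply: ler_pM => //.
  apply: le_trans ((h j).2 _ _ xe _) _; first exact: segment_in_ball.
  apply: ler_wpM2l; first exact: ltW.
  by case/andP: t01 => t0 t1; rewrite addrK normrZ ler_piMl // ger0_norm.
exact: rV_norm_coord.
Qed.

Lemma partial_commute U f x i j : open U -> U x -> Ck_on 3 U f ->
  'D_(delta_mx 0 i) ('D_(delta_mx 0 j) f) x = 'D_(delta_mx 0 j) ('D_(delta_mx 0 i) f) x.
Proof.
move=> oU Ux Cf; have [f1 f2] := Cf.
have [e [C [e0 C0 hU]]] := Ck_on_taylor oU Ux (f2 i).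
have [e' [C' [e'0 C'0 hU']]] := Ck_on_taylor oU Ux (f2 j).
have nd k : `|delta_mx 0 k : 'rV[R]_m| <= 1.
  apply/rV_normP => // l; rewrite mxE; case: (_ && _); rewrite ?normr1 ?normr0 //.
have dsum k l (y z : R) (F : 'I_m -> R) : \sum_h (y *: delta_mx 0 k + z *: delta_mx 0 l : 'rV[R]_m) 0 h * F h =
    y * F k + z * F l.
  under eq_bigr do rewrite !mxE eqxx /= mulrDl.
  rewrite big_split /= (bigD1 k) //= eqxx mulr1 big1 => [|h /negbTE ->]; last by rewrite mulr0 mul0r.
  rewrite (bigD1 l) //= eqxx mulr1 big1 => [|h /negbTE ->]; last by rewrite mulr0 mul0r.
  by rewrite !addr0.
(* The second difference of f over a small parallelogram, seen as a difference of
   increments in direction k, is h^2 D_l D_k f x up to O(h^3). *)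
have key k l (d D : R) : 0 < d -> 0 < D -> (forall y, `|y - x| < d -> U y) ->
  (forall x0 y, `|x0 - x| < d -> `|y - x| < d ->
    `|'D_(delta_mx 0 k) f y - 'D_(delta_mx 0 k) f x0 -
      \sum_o (y - x0) 0 o * 'D_(delta_mx 0 o) ('D_(delta_mx 0 k) f) x0| <= D * `|y - x0| ^+ 2) ->
  forall h : R, 0 < h -> h * 2 < d ->
  `|f (h *: delta_mx 0 k + h *: delta_mx 0 l + x) - f (h *: delta_mx 0 l + x)
    - f (h *: delta_mx 0 k + x) + f x
    - h ^+ 2 * 'D_(delta_mx 0 l) ('D_(delta_mx 0 k) f) x| <= D * 5 * h ^+ 3.
  move=> d0 D0 dU tay h h0 hd.
  pose A : 'rV[R]_m := delta_mx 0 k; pose B : 'rV[R]_m := delta_mx 0 l.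
  have small (s t : R) : 0 <= s <= h -> 0 <= t <= h -> `|s *: A + t *: B| <= h * 2.
    move=> /andP[s0 sh] /andP[t0 th]; apply: le_trans (ler_normD _ _) _.
    rewrite !normrZ !ger0_norm // mulr_natr mulr2n.
    by apply: lerD; rewrite -[leRHS]mulr1; apply: ler_pM => //; exact: nd.
  have inU (s t : R) : 0 <= s <= h -> 0 <= t <= h -> U (s *: A + t *: B + x).
    by move=> sh th; apply: dU; rewrite addrK; apply: le_lt_trans hd; exact: small.
  have h0h : 0 <= h <= h by rewrite lexx ltW.
  have o0h : (0 : R) <= 0 <= h by rewrite lexx ltW.
  pose phi (s : R) := f (s *: A + (h *: B + x)) - f (s *: A + x).
  have dphi (s : R) : 0 <= s <= h -> is_derive s (1 : R) phi
      ('D_A f (s *: A + (h *: B + x)) - 'D_A f (s *: A + x)).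
    move=> sh; have d1 : differentiable f (s *: A + (h *: B + x)).
      by apply: f1; rewrite addrA; exact: inU.
    have d2 : differentiable f (s *: A + x).
      by apply: f1; have := inU _ _ sh o0h; rewrite scale0r addr0.
    apply: is_deriveB; apply: is_derive_line; exact: diff_derivable.
  have [||s] := @MVT R phi (fun s => 'D_A f (s *: A + (h *: B + x)) - 'D_A f (s *: A + x)) 0 h h0.
  - by move=> s; rewrite in_itv /= => /andP[s0 sh]; apply: dphi; rewrite !ltW.
  - apply: continuous_in_subspaceT => s; rewrite inE /= in_itv /= => sh.
    by have [? _] := dphi s sh; apply: differentiable_continuous; exact/derivable1_diffP.
  rewrite in_itv /= => /andP[s0 sh]; rewrite subr0.
  have s0h : 0 <= s <= h by rewrite !ltW.
  rewrite /phi !scale0r !add0r addrA => phiE.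
  have -> : f (h *: A + h *: B + x) - f (h *: B + x) - f (h *: A + x) + f x =
      f (h *: A + h *: B + x) - f (h *: A + x) - (f (h *: B + x) - f x) by ring.
  rewrite phiE.
  have t1 := tay x (s *: A + (h *: B + x)); rewrite subrr normr0 in t1.
  have t2 := tay x (s *: A + x); rewrite subrr normr0 in t2.
  have n1 : s *: A + (h *: B + x) - x = s *: A + h *: B by rewrite addrA addrK.
  have n2 : s *: A + x - x = s *: A + 0 *: B by rewrite addrK scale0r addr0.
  rewrite n1 dsum in t1; rewrite n2 dsum in t2.
  have l1 := le_lt_trans (small _ _ s0h h0h) hd; have l2 := le_lt_trans (small _ _ s0h o0h) hd.
  have {}t1 := t1 d0 l1; have {}t2 := t2 d0 l2.
  have b1 : `|s *: A + h *: B| ^+ 2 <= (h * 2) ^+ 2.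
    by rewrite ler_pXn2r ?nnegrE ?mulr_ge0 ?(ltW h0) //; exact: small.
  have b2 : `|s *: A + 0 *: B| ^+ 2 <= h ^+ 2.
    rewrite scale0r addr0 normrZ ger0_norm ?(ltW s0) // ler_pXn2r ?nnegrE ?mulr_ge0 ?(ltW h0) ?(ltW s0) //.
    by rewrite -[leRHS]mulr1; apply: ler_pM; rewrite ?(ltW s0) ?(ltW sh) ?nd.
  set X := 'D_A f (s *: A + (h *: B + x)) in t1 *.
  set Y := 'D_A f (s *: A + x) in t2 *.
  set Z := 'D_A f x in t1 t2.
  set P := 'D_A ('D_A f) x in t1 t2; set Q := 'D_B ('D_A f) x in t1 t2 *.
  have -> : (X - Y) * h - h ^+ 2 * Q =
     h * ((X - Z - (s * P + h * Q)) - (Y - Z - (s * P + 0 * Q))) by ring.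
  (* The points s A + h B and s A are at distance at most 2h and h from 0, so the two Taylor
     remainders add up to D (4 + 1) h^2. *)
  rewrite normrM gtr0_norm //; apply: le_trans (_ : h * (D * (h * 2) ^+ 2 + D * h ^+ 2) <= _); last first.
    by rewrite le_eqVlt; apply/orP; left; apply/eqP; ring.
  rewrite ler_pM2l //; apply: le_trans (ler_normB _ _) _; apply: lerD.
    by apply: le_trans t1 _; rewrite ler_pM2l.
  by apply: le_trans t2 _; rewrite ler_pM2l.
move=> taj tai.
set P := LHS; set Q := RHS.
apply/eqP; rewrite -subr_eq0; apply/negPn/negP => PQ.
have PQ0 : 0 < `|P - Q| by rewrite normr_gt0.
pose d := Num.min e e'; have d0 : 0 < d by rewrite lt_min e0.
pose K := (C + C') * 5; have K0 : 0 < K by rewrite mulr_gt0 // addr_gt0.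
(* This h keeps the parallelogram in both balls and gives h K <= |P - Q| / 2, so the two O(h^3)
   estimates of the same second difference contradict P <> Q. *)
pose h := Num.min (d / 3) (`|P - Q| / K / 2).
have h0 : 0 < h by rewrite lt_min !divr_gt0.
have hd : h * 2 < d.
  have : h <= d / 3 by rewrite ge_min lexx.
  by move: d0; lra.
have hK : h * K <= `|P - Q| / 2.
  have : h <= `|P - Q| / K / 2 by rewrite ge_min lexx orbT.
  rewrite -(ler_pM2r K0) => /le_trans; apply.
  by rewrite mulrAC divfK // gt_eqF.
have hde : h * 2 < e by apply: lt_le_trans hd _; rewrite ge_min lexx.
have hde' : h * 2 < e' by apply: lt_le_trans hd _; rewrite ge_min lexx orbT.
have k1 := key i j e C e0 C0 hU tai h h0 hde.
have k2 := key j i e' C' e'0 C'0 hU' taj h h0 hde'.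
rewrite [h *: delta_mx 0 j + _]addrC -/P in k2; rewrite -/Q in k1.
have : `|h ^+ 2 * (P - Q)| <= K * h ^+ 3.
  rewrite /K !mulrDl; apply: le_trans (lerD k1 k2); apply: le_trans (ler_normB _ _).
  by rewrite le_eqVlt; apply/orP; left; apply/eqP; congr (`|_|); ring.
rewrite normrM ger0_norm ?exprn_ge0 ?(ltW h0) //.
have -> : K * h ^+ 3 = h ^+ 2 * (h * K) by ring.
rewrite ler_pM2l ?exprn_gt0 // => /le_trans/(_ hK).
by rewrite leNgt ltr_pdivrMr // ltr_pMr // ltr1n.
Qed.

End MeanValue.

(** * Smooth real and complex matrix-valued functions *)

Definition smooth_mx m a b (U : set 'rV[R]_m) (A : 'rV[R]_m -> 'M[R]_(a, b)) : Prop :=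
  forall i j, smooth_on U (fun x => A x i j).

Definition csmooth_mx m a b (U : set 'rV[R]_m) (A : 'rV[R]_m -> 'M[R[i]]_(a, b)) : Prop :=
  smooth_mx U (fun x => re_mx (A x)) /\ smooth_mx U (fun x => im_mx (A x)).

Section SmoothMatrices.
Variable m : nat.
Implicit Types (U V : set 'rV[R]_m).

Lemma smooth_on_sub U V f : V `<=` U -> smooth_on U f -> smooth_on V f.
Proof. by move=> VU sf k; exact: Ck_on_sub (sf k). Qed.

Lemma smooth_on_local U f :
  (forall x, U x -> exists2 V, V x & smooth_on V f) -> smooth_on U f.
Proof.
by move=> loc k; apply: Ck_on_local => x /loc[V Vx sf]; exists V.
Qed.

Lemma eq_smooth_on U f g : open U -> (forall x, U x -> f x = g x) ->
  smooth_on U f -> smooth_on U g.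
Proof. by move=> oU fg sf k; exact: eq_Ck_on (sf k). Qed.

Lemma smooth_on_cst U (c : R) : smooth_on U (cst c).
Proof. by move=> k; exact: Ck_on_cst. Qed.

Lemma smooth_onD U f g : open U -> smooth_on U f -> smooth_on U g ->
  smooth_on U (fun x => f x + g x).
Proof. by move=> oU sf sg k; exact: Ck_onD. Qed.

Lemma smooth_onM U f g : open U -> smooth_on U f -> smooth_on U g ->
  smooth_on U (fun x => f x * g x).
Proof. by move=> oU sf sg k; exact: Ck_onM. Qed.

Lemma smooth_onV U f : open U -> (forall x, U x -> f x != 0) ->
  smooth_on U f -> smooth_on U (fun x => (f x)^-1).
Proof. by move=> oU f0 sf k; exact: Ck_onV. Qed.

Lemma smooth_on_sum U (I : Type) (s : seq I) (P : pred I) (F : I -> 'rV[R]_m -> R) : open U ->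
  (forall i, P i -> smooth_on U (F i)) -> smooth_on U (fun x => \sum_(i <- s | P i) F i x).
Proof.
move=> oU sF k; under [X in Ck_on _ _ X]funext do rewrite big_mkcond.
apply: Ck_on_sum => // i; case Pi: (P i); first exact: sF.
exact: Ck_on_cst.
Qed.

Lemma smooth_on_prod U (I : Type) (s : seq I) (P : pred I) (F : I -> 'rV[R]_m -> R) : open U ->
  (forall i, P i -> smooth_on U (F i)) -> smooth_on U (fun x => \prod_(i <- s | P i) F i x).
Proof.
move=> oU sF; elim: s => [|i s IH].
  under [X in smooth_on _ X]funext do rewrite big_nil; exact: smooth_on_cst.
under [X in smooth_on _ X]funext do rewrite big_cons.
by case Pi: (P i) => //; apply: smooth_onM => //; exact: sF.
Qed.

Lemma smooth_on_comp n (U : set 'rV[R]_n) V (g : 'rV[R]_n -> 'rV[R]_m) f :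
  open U -> (forall x, U x -> V (g x)) ->
  smooth_map_on U g -> smooth_on V f -> smooth_on U (fun x => f (g x)).
Proof. by move=> oU UV sg sf k; apply: Ck_on_comp (sf k) => // j; exact: sg. Qed.

Lemma smooth_on_partial U f j : smooth_on U f -> smooth_on U ('D_(delta_mx 0 j) f).
Proof. by move=> sf k; have [_] := sf k.+1; exact. Qed.

Lemma smooth_on_differentiable U f x : smooth_on U f -> U x -> differentiable f x.
Proof. by move=> sf Ux; have [+ _] := sf 1%N; exact. Qed.

Lemma smooth_on_continuous U f x : smooth_on U f -> U x -> {for x, continuous f}.
Proof. by move=> sf Ux; exact: (sf 0%N). Qed.

Lemma smooth_map_differentiable n U (g : 'rV[R]_m -> 'rV[R]_n) x :
  smooth_map_on U g -> U x -> differentiable g x.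
Proof.
by move=> sg Ux; apply: differentiable_rV => j; exact: smooth_on_differentiable (sg j) Ux.
Qed.

Lemma smooth_mx_sub a b U V (A : 'rV[R]_m -> 'M[R]_(a, b)) :
  V `<=` U -> smooth_mx U A -> smooth_mx V A.
Proof. by move=> VU sA i j; exact: smooth_on_sub (sA i j). Qed.

Lemma eq_smooth_mx a b U (A B : 'rV[R]_m -> 'M[R]_(a, b)) : open U ->
  (forall x, U x -> A x = B x) -> smooth_mx U A -> smooth_mx U B.
Proof.
by move=> oU AB sA i j; apply: eq_smooth_on (sA i j) => // x /AB ->.
Qed.

Lemma smooth_mx_cst a b U (A : 'M[R]_(a, b)) : smooth_mx U (fun=> A).
Proof. by move=> i j; exact: smooth_on_cst. Qed.

Lemma smooth_mxD a b U (A B : 'rV[R]_m -> 'M[R]_(a, b)) : open U ->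
  smooth_mx U A -> smooth_mx U B -> smooth_mx U (fun x => A x + B x).
Proof.
move=> oU sA sB i j; under [X in smooth_on _ X]funext do rewrite mxE.
exact: smooth_onD.
Qed.

Lemma smooth_mxZ a b U f (A : 'rV[R]_m -> 'M[R]_(a, b)) : open U ->
  smooth_on U f -> smooth_mx U A -> smooth_mx U (fun x => f x *: A x).
Proof.
move=> oU sf sA i j; under [X in smooth_on _ X]funext do rewrite mxE.
exact: smooth_onM.
Qed.

Lemma smooth_mxN a b U (A : 'rV[R]_m -> 'M[R]_(a, b)) : open U ->
  smooth_mx U A -> smooth_mx U (fun x => - A x).
Proof.
move=> oU sA; under [X in smooth_mx _ X]funext do rewrite -scaleN1r.
by apply: smooth_mxZ => //; exact: smooth_on_cst.
Qed.

Lemma smooth_mxB a b U (A B : 'rV[R]_m -> 'M[R]_(a, b)) : open U ->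
  smooth_mx U A -> smooth_mx U B -> smooth_mx U (fun x => A x - B x).
Proof. by move=> oU sA sB; apply: smooth_mxD => //; exact: smooth_mxN. Qed.

Lemma smooth_mxM a b c U (A : 'rV[R]_m -> 'M[R]_(a, b)) (B : 'rV[R]_m -> 'M[R]_(b, c)) :
  open U -> smooth_mx U A -> smooth_mx U B -> smooth_mx U (fun x => A x *m B x).
Proof.
move=> oU sA sB i j; under [X in smooth_on _ X]funext do rewrite mxE.
by apply: smooth_on_sum => // k _; exact: smooth_onM.
Qed.

Lemma smooth_mxT a b U (A : 'rV[R]_m -> 'M[R]_(a, b)) :
  smooth_mx U A -> smooth_mx U (fun x => (A x)^T).
Proof. by move=> sA i j; under [X in smooth_on _ X]funext do rewrite mxE; exact: sA. Qed.

Lemma smooth_mx_col a1 a2 b U (A : 'rV[R]_m -> 'M[R]_(a1, b)) (B : 'rV[R]_m -> 'M[R]_(a2, b)) :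
  smooth_mx U A -> smooth_mx U B -> smooth_mx U (fun x => col_mx (A x) (B x)).
Proof.
move=> sA sB i j; under [X in smooth_on _ X]funext do rewrite mxE.
by case: (fintype.split i) => k; [exact: sA|exact: sB].
Qed.

Lemma smooth_mx_row a b1 b2 U (A : 'rV[R]_m -> 'M[R]_(a, b1)) (B : 'rV[R]_m -> 'M[R]_(a, b2)) :
  smooth_mx U A -> smooth_mx U B -> smooth_mx U (fun x => row_mx (A x) (B x)).
Proof.
move=> sA sB i j; under [X in smooth_on _ X]funext do rewrite mxE.
by case: (fintype.split j) => k; [exact: sA|exact: sB].
Qed.

Lemma smooth_mx_usub a1 a2 b U (A : 'rV[R]_m -> 'M[R]_(a1 + a2, b)) :
  smooth_mx U A -> smooth_mx U (fun x => usubmx (A x)).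
Proof. by move=> sA i j; under [X in smooth_on _ X]funext do rewrite mxE; exact: sA. Qed.

Lemma smooth_mx_dsub a1 a2 b U (A : 'rV[R]_m -> 'M[R]_(a1 + a2, b)) :
  smooth_mx U A -> smooth_mx U (fun x => dsubmx (A x)).
Proof. by move=> sA i j; under [X in smooth_on _ X]funext do rewrite mxE; exact: sA. Qed.

Lemma smooth_mx_lsub a b1 b2 U (A : 'rV[R]_m -> 'M[R]_(a, b1 + b2)) :
  smooth_mx U A -> smooth_mx U (fun x => lsubmx (A x)).
Proof. by move=> sA i j; under [X in smooth_on _ X]funext do rewrite mxE; exact: sA. Qed.

Lemma smooth_mx_rsub a b1 b2 U (A : 'rV[R]_m -> 'M[R]_(a, b1 + b2)) :
  smooth_mx U A -> smooth_mx U (fun x => rsubmx (A x)).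
Proof. by move=> sA i j; under [X in smooth_on _ X]funext do rewrite mxE; exact: sA. Qed.

Lemma smooth_det a U (A : 'rV[R]_m -> 'M[R]_a) : open U ->
  smooth_mx U A -> smooth_on U (fun x => \det (A x)).
Proof.
move=> oU sA; apply: smooth_on_sum => // s _; apply: smooth_onM => //.
  exact: smooth_on_cst.
by apply: smooth_on_prod => // i _; exact: sA.
Qed.

(** Cramer's rule: the adjugate is polynomial in the entries, and the determinant does not
    vanish. *)
Lemma smooth_invmx a U (A : 'rV[R]_m -> 'M[R]_a) : open U ->
  (forall x, U x -> A x \in unitmx) -> smooth_mx U A ->
  smooth_mx U (fun x => invmx (A x)).
Proof.
move=> oU uA sA; apply: (@eq_smooth_mx _ _ _ (fun x => (\det (A x))^-1 *: \adj (A x))) => //.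
  by move=> x /uA uAx; rewrite /invmx uAx.
apply: smooth_mxZ => //.
  apply: smooth_onV => //; last exact: smooth_det.
  by move=> x /uA; rewrite unitmxE unitfE.
move=> i j; under [X in smooth_on _ X]funext do rewrite mxE /cofactor.
apply: smooth_onM => //; first exact: smooth_on_cst.
apply: smooth_det => // k l; under [X in smooth_on _ X]funext do rewrite !mxE.
exact: sA.
Qed.

Lemma smooth_mx_comp n a b (U : set 'rV[R]_n) V (g : 'rV[R]_n -> 'rV[R]_m)
    (A : 'rV[R]_m -> 'M[R]_(a, b)) :
  open U -> (forall x, U x -> V (g x)) ->
  smooth_map_on U g -> smooth_mx V A -> smooth_mx U (fun x => A (g x)).
Proof. by move=> oU UV sg sA i j; exact: smooth_on_comp UV sg (sA i j). Qed.

Lemma re_mxM a b c (A : 'M[R[i]]_(a, b)) (B : 'M[R[i]]_(b, c)) :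
  re_mx (A *m B) = re_mx A *m re_mx B - im_mx A *m im_mx B.
Proof.
apply/matrixP => i j; rewrite !mxE raddf_sum /= -sumrB.
by apply: eq_bigr => k _; rewrite !mxE; case: (A i k) (B k j) => ? ? [].
Qed.

Lemma im_mxM a b c (A : 'M[R[i]]_(a, b)) (B : 'M[R[i]]_(b, c)) :
  im_mx (A *m B) = re_mx A *m im_mx B + im_mx A *m re_mx B.
Proof.
apply/matrixP => i j; rewrite !mxE raddf_sum /= -big_split /=.
by apply: eq_bigr => k _; rewrite !mxE; case: (A i k) (B k j) => ? ? [].
Qed.

Lemma csmooth_mx_sub a b U V (A : 'rV[R]_m -> 'M[R[i]]_(a, b)) :
  V `<=` U -> csmooth_mx U A -> csmooth_mx V A.
Proof. by move=> VU [h1 h2]; split; exact: smooth_mx_sub VU _. Qed.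

Lemma eq_csmooth_mx a b U (A B : 'rV[R]_m -> 'M[R[i]]_(a, b)) : open U ->
  (forall x, U x -> A x = B x) -> csmooth_mx U A -> csmooth_mx U B.
Proof.
move=> oU AB [h1 h2]; split; [apply: eq_smooth_mx h1|apply: eq_smooth_mx h2] => // x /AB ->//.
Qed.

Lemma csmooth_mx_cst a b U (A : 'M[R[i]]_(a, b)) : csmooth_mx U (fun=> A).
Proof. by split; exact: smooth_mx_cst. Qed.

Lemma csmooth_cmx a b U (A : 'rV[R]_m -> 'M[R]_(a, b)) :
  smooth_mx U A -> csmooth_mx U (fun x => cmx (A x)).
Proof.
move=> sA; split; first by under [X in smooth_mx _ X]funext do rewrite re_cmx.
by under [X in smooth_mx _ X]funext do rewrite im_cmx; exact: smooth_mx_cst.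
Qed.

Lemma csmooth_mxM a b c U (A : 'rV[R]_m -> 'M[R[i]]_(a, b)) (B : 'rV[R]_m -> 'M[R[i]]_(b, c)) :
  open U -> csmooth_mx U A -> csmooth_mx U B -> csmooth_mx U (fun x => A x *m B x).
Proof.
move=> oU [A1 A2] [B1 B2]; split.
  by under [X in smooth_mx _ X]funext do rewrite re_mxM; apply: smooth_mxB; try exact: smooth_mxM.
by under [X in smooth_mx _ X]funext do rewrite im_mxM; apply: smooth_mxD; try exact: smooth_mxM.
Qed.

Lemma csmooth_mxT a b U (A : 'rV[R]_m -> 'M[R[i]]_(a, b)) :
  csmooth_mx U A -> csmooth_mx U (fun x => (A x)^T).
Proof.
move=> [A1 A2]; split.
  by under [X in smooth_mx _ X]funext do rewrite /re_mx -map_trmx; exact: smooth_mxT.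
by under [X in smooth_mx _ X]funext do rewrite /im_mx -map_trmx; exact: smooth_mxT.
Qed.

Lemma csmooth_mxP a b U (A : 'rV[R]_m -> 'M[R[i]]_(a, b)) :
  csmooth_mx U A <-> (forall i j, csmooth_on U (fun x => A x i j)).
Proof.
have e1 i j : (fun x => re_mx (A x) i j) = (fun x => complex.Re (A x i j)).
  by apply/funext => x; rewrite mxE.
have e2 i j : (fun x => im_mx (A x) i j) = (fun x => complex.Im (A x i j)).
  by apply/funext => x; rewrite mxE.
split=> [[h1 h2] i j|h]; first by split; rewrite -?e1 -?e2.
by split=> i j; rewrite ?e1 ?e2; have [] := h i j.
Qed.

Lemma csmooth_mx_comp n a b (U : set 'rV[R]_n) V (g : 'rV[R]_n -> 'rV[R]_m)
    (A : 'rV[R]_m -> 'M[R[i]]_(a, b)) :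
  open U -> (forall x, U x -> V (g x)) ->
  smooth_map_on U g -> csmooth_mx V A -> csmooth_mx U (fun x => A (g x)).
Proof. by move=> oU UV sg [A1 A2]; split; [apply: smooth_mx_comp A1|apply: smooth_mx_comp A2]. Qed.

(* Invert Q(x) *m N, where N is a right inverse of Q(x0). *)
Lemma smooth_right_inverse a b U (Q : 'rV[R]_m -> 'M[R]_(a, b)) x0 :
  open U -> U x0 -> smooth_mx U Q -> row_free (Q x0) ->
  exists (N : 'M[R]_(b, a)) (V : set 'rV[R]_m),
    [/\ open V, V x0, V `<=` U, forall x, V x -> Q x *m N \in unitmx &
        smooth_mx V (fun x => N *m invmx (Q x *m N))].
Proof.
move=> oU Ux0 sQ /row_freeP[N QN].
pose f x := \det (Q x *m N).
have sf : smooth_on U f by apply: smooth_det => //; apply: smooth_mxM => //; exact: smooth_mx_cst.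
have fx0 : f x0 = 1 by rewrite /f QN det1.
have : \forall x \near x0, f x != 0.
  have /cvgrPdist_lt/(_ 1 ltr01) := smooth_on_continuous sf Ux0.
  apply: filterS => x; rewrite fx0; apply: contraTneq => ->.
  by rewrite subr0 normr1 ltxx.
move=> /(filterI (open_nbhs_nbhs (conj oU Ux0))).
rewrite nbhsE => -[V [oV Vx0] VU]; exists N, V.
have uV x : V x -> Q x *m N \in unitmx by move=> /VU[_]; rewrite unitmxE unitfE.
split=> //; first by move=> x /VU[].
apply: smooth_mxM => //; first exact: smooth_mx_cst.
apply: smooth_invmx => //; apply: smooth_mxM => //; last exact: smooth_mx_cst.
by apply: smooth_mx_sub sQ => x /VU[].
Qed.

End SmoothMatrices.

(** * Real parts, imaginary parts and conjugates of complex matrices *)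

Section ComplexMatrices.
Local Notation C := R[i].

Lemma cmxM a b c (A : 'M[R]_(a, b)) (B : 'M[R]_(b, c)) : cmx (A *m B) = cmx A *m cmx B.
Proof. exact: map_mxM. Qed.

Lemma cmxN a b (A : 'M[R]_(a, b)) : cmx (- A) = - cmx A.
Proof. exact: map_mxN. Qed.

Lemma cmxT a b (A : 'M[R]_(a, b)) : cmx A^T = (cmx A)^T.
Proof. by rewrite /cmx map_trmx. Qed.

Lemma cmx0 a b : cmx (0 : 'M[R]_(a, b)) = 0.
Proof. exact: map_mx0. Qed.

Lemma im_mx0 a b : im_mx (0 : 'M[C]_(a, b)) = 0.
Proof. by rewrite -(cmx0 a b) im_cmx. Qed.

Lemma cmx1 a : cmx (1%:M : 'M[R]_a) = 1%:M.
Proof. exact: map_mx1. Qed.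

Lemma cmx_col a1 a2 b (A : 'M[R]_(a1, b)) (B : 'M[R]_(a2, b)) :
  cmx (col_mx A B) = col_mx (cmx A) (cmx B).
Proof. exact: map_col_mx. Qed.

Lemma conj_mxM a b c (A : 'M[C]_(a, b)) (B : 'M[C]_(b, c)) :
  conj_mx (A *m B) = conj_mx A *m conj_mx B.
Proof. exact: map_mxM. Qed.

Lemma conj_i : conjc ('i%C : C) = - 'i%C.
Proof. by apply/eqP; rewrite eq_complex /= oppr0 !eqxx. Qed.

Lemma conj_half : conjc (2^-1 : C) = 2^-1.
Proof. by rewrite fmorphV rmorph_nat. Qed.

Lemma re_conj_mx a b (A : 'M[C]_(a, b)) : re_mx (conj_mx A) = re_mx A.
Proof. by apply/matrixP => i j; rewrite !mxE; case: (A i j). Qed.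

Lemma conj_mxK a b : involutive (@conj_mx R a b).
Proof. by move=> A; apply/matrixP => i j; rewrite !mxE conjcK. Qed.

Lemma conj_mxT a b (A : 'M[C]_(a, b)) : conj_mx A^T = (conj_mx A)^T.
Proof. by rewrite /conj_mx map_trmx. Qed.

Lemma conj_cmx a b (A : 'M[R]_(a, b)) : conj_mx (cmx A) = cmx A.
Proof. by apply/matrixP => i j; rewrite !mxE; exact: conjc_real. Qed.

Lemma conj_mx_real a b (A : 'M[C]_(a, b)) : im_mx A = 0 -> conj_mx A = A.
Proof. by move=> A0; rewrite [A]complex_mxE A0 cmx0 scaler0 addr0 conj_cmx. Qed.

Lemma conj_mx_im0 a b (A : 'M[C]_(a, b)) : conj_mx A = A -> im_mx A = 0.
Proof.
move=> AA; apply/matrixP => i j; have /matrixP/(_ i j) := AA; rewrite !mxE.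
by case: (A i j) => u v [] /eqP; rewrite eq_sym -subr_eq0 opprK -mulr2n mulrn_eq0 => /eqP.
Qed.

Lemma cmx_re a b (A : 'M[C]_(a, b)) : im_mx A = 0 -> cmx (re_mx A) = A.
Proof. by move=> A0; rewrite [RHS]complex_mxE A0 cmx0 scaler0 addr0. Qed.

Lemma cmx_2re a b (A : 'M[C]_(a, b)) : cmx (re_mx A *+ 2) = A + conj_mx A.
Proof.
apply/matrixP => i j; rewrite !mxE; case: (A i j) => u v; apply/eqP.
by rewrite eq_complex /= subrr !eqxx.
Qed.

Lemma re_complex_mx a b (A B : 'M[R]_(a, b)) : re_mx (cmx A + 'i%C *: cmx B) = A.
Proof.
by rewrite re_mxD re_mxZ !re_cmx !im_cmx /= scale0r scaler0 subr0 addr0.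
Qed.

Lemma im_complex_mx a b (A B : 'M[R]_(a, b)) : im_mx (cmx A + 'i%C *: cmx B) = B.
Proof.
by rewrite im_mxD im_mxZ !re_cmx !im_cmx /= scale1r scaler0 !add0r.
Qed.

Lemma re_mxT a b (A : 'M[C]_(a, b)) : re_mx A^T = (re_mx A)^T.
Proof. by rewrite /re_mx map_trmx. Qed.

Lemma im_mxN a b (A : 'M[C]_(a, b)) : im_mx (- A) = - im_mx A.
Proof. by apply/matrixP => i j; rewrite !mxE; case: (A i j). Qed.

Lemma re_mxN a b (A : 'M[C]_(a, b)) : re_mx (- A) = - re_mx A.
Proof. by apply/matrixP => i j; rewrite !mxE; case: (A i j). Qed.

(** Frees the row count from the dependent index [\rank A], so that frames can have a prescribed
    number of rows. *)
Lemma exists_eqmx_rank (K : fieldType) a b k (A : 'M[K]_(a, b)) : \rank A = k ->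
  exists B : 'M[K]_(k, b), (B :=: A)%MS.
Proof. by case: k /; exists (row_base A); exact: eq_row_base. Qed.

(** When the rows of A span E, the real row space of this matrix is D = Re (E + Ebar), as [mem_DL]
    shows. *)
Definition reim_mx a b (A : 'M[C]_(a, b)) := col_mx (re_mx A) (im_mx A).

Lemma reim_mxS a b c (A : 'M[C]_(a, b)) (B : 'M[C]_(c, a)) :
  (reim_mx (B *m A) <= reim_mx A)%MS.
Proof.
rewrite /reim_mx re_mxM im_mxM; apply/submxP.
exists (block_mx (re_mx B) (- im_mx B) (im_mx B) (re_mx B)).
by rewrite mul_block_col !mulNmx [im_mx B *m _ + _]addrC.
Qed.

End ComplexMatrices.

(** * Local normal form of a Dirac structure *)

Section AdaptedFrame.
Local Notation C := R[i].
Variables (kd n : nat).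

(** The inclusion of E in the complexification of D, in the frames (d, a + ib) of E and (d, a, b) of
    D. *)
Definition frame_incl : 'M[C]_(kd + n, kd + (n + n)) :=
  block_mx 1%:M 0 0 (row_mx 1%:M ('i%C)%:M).
(** The projection of the complexified D onto E along a - ib: it fixes d and sends a and b to 1/2
    and -i/2 times a + ib. *)
Definition frame_proj : 'M[C]_(kd + (n + n), kd + n) :=
  block_mx 1%:M 0 0 (col_mx (2^-1)%:M (- 'i%C / 2)%:M).
(** The projection of E onto the complexified Delta that kills a + ib. *)
Definition frame_real : 'M[C]_(kd + n) := block_mx 1%:M 0 0 0.

Lemma frame_inclK : frame_incl *m frame_proj = 1%:M.
Proof.
rewrite /frame_incl /frame_proj mulmx_block !mulmx0 !mul0mx !mulmx1 !addr0 add0r.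
rewrite mul_row_col mul1mx -scalar_mxM -raddfD /= [RHS]scalar_mx_block; congr block_mx.
congr (_%:M); rewrite mulrA mulrN -expr2 sqr_i opprK mul1r.
by rewrite -[X in X + X]mulr1 -mulrDr -[1 + 1]/(2%:R) mulVf // pnatr_eq0.
Qed.

(** The conjugate projection goes onto Ebar along a + ib, so on E only the component along d
    survives. *)
Lemma frame_incl_conj : frame_incl *m conj_mx frame_proj = frame_real.
Proof.
have ci2 : conjc (- 'i%C / 2 : C) = 'i%C / 2.
  by rewrite rmorphM rmorphN; rewrite [X in _ * X]conj_half [X in - X]conj_i opprK.
rewrite /frame_proj /conj_mx map_block_mx !map_mx0 map_col_mx !map_scalar_mx.
rewrite rmorph1 [X in col_mx X%:M _]conj_half [X in col_mx _ X%:M]ci2 /frame_incl mulmx_block !mulmx0 !mul0mx !addr0 add0r mul_row_col.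
rewrite !mul1mx -scalar_mxM -raddfD; congr block_mx.
by rewrite mulrA -expr2 sqr_i mulN1r subrr raddf0.
Qed.

End AdaptedFrame.

Section LocalNormalForm.
Local Notation C := R[i].
Variables (m k kd n : nat).

(* The rows of F and Xi are the vector and covector components of a frame of L; the two-form
   eps on E_L, eps(X, Y) = xi(Y) for X + xi in L, has matrix Xi *m F^T in that frame. *)
Record frame_conditions (F Xi : 'M[C]_(k, m)) : Prop := FrameConditions {
  frame_rankE : \rank F = (kd + n)%N;
  frame_rankD : \rank (reim_mx F) = (kd + (n + n))%N;
  frame_isotropic : Xi *m F^T = - (F *m Xi^T);
  frame_epsilon_real : forall p (D : 'M[R]_(p, m)) (c : 'M[C]_(p, k)),
    cmx D = c *m F -> im_mx (c *m Xi *m F^T *m c^T) = 0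
}.

Lemma submx_colu (K : fieldType) a1 a2 b (A : 'M[K]_(a1, b)) (B : 'M[K]_(a2, b)) :
  (A <= col_mx A B)%MS.
Proof. by rewrite -addsmxE addsmxSl. Qed.

Lemma submx_cold (K : fieldType) a1 a2 b (A : 'M[K]_(a1, b)) (B : 'M[K]_(a2, b)) :
  (B <= col_mx A B)%MS.
Proof. by rewrite -addsmxE addsmxSr. Qed.

(** T S acts as the identity on F but not on Xi. Isotropy trades Xi F^T for - F Xi^T, where T S
    cancels; hence the form on all of F may be checked on the smaller frame S F. *)
Lemma isotropic_transfer (K : fieldType) a b p (F Xi : 'M[K]_(a, b)) (B : 'M[K]_b)
    (S : 'M[K]_(p, a)) (T : 'M[K]_(a, p)) :
  F = T *m (S *m F) -> Xi *m F^T = - (F *m Xi^T) ->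
  (S *m F) *m B *m (S *m F)^T = S *m Xi *m (S *m F)^T ->
  F *m B *m F^T = Xi *m F^T.
Proof.
move=> FE iso; move: FE; set g := S *m F => FE h.
have -> : F *m B *m F^T = T *m (g *m B *m g^T) *m T^T.
  by rewrite FE trmx_mul !mulmxA.
rewrite h -!mulmxA -trmx_mul -FE iso !mulmxN; congr (- _).
by rewrite [S *m _]mulmxA mulmxA -FE.
Qed.

Lemma complement_frame (d0 : 'M[R]_(kd, m)) (F : 'M[C]_(k, m)) :
  row_free d0 -> (cmx d0 <= F)%MS -> \rank F = (kd + n)%N ->
  exists e0 : 'M[C]_(n, m), (col_mx (cmx d0) e0 :=: F)%MS.
Proof.
move=> fd0 d0F rF.
have rd : \rank (cmx d0) = kd by rewrite mxrank_map; exact/eqP.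
have capE : (F :&: cmx d0 :=: cmx d0)%MS by exact/capmx_idPr.
have rdiff : \rank (F :\: cmx d0)%MS = n.
  have := mxrank_cap_compl F (cmx d0); rewrite capE rd rF => /eqP.
  by rewrite eqn_add2l => /eqP.
have [e0 e0E] := exists_eqmx_rank rdiff.
exists e0; apply: eqmx_trans (addsmx_diff_cap_eq F (cmx d0)).
apply: eqmx_trans (eqmx_sym (addsmxE _ _)) _; rewrite addsmxC.
exact: adds_eqmx (eqmx_sym capE).
Qed.

(** The two constant ranks are what makes E \cap Ebar vary smoothly. A constant matrix S extracts
    from F a frame of E that starts with d0 at x0; nearby its first kd rows acquire imaginary parts,
    which lie in D and are removed by a smooth change of frame T. *)
Lemma local_normal_form (U : set 'rV[R]_m) (F Xi : 'rV[R]_m -> 'M[C]_(k, m)) x0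
    (d0 : 'M[R]_(kd, m)) :
  open U -> U x0 -> csmooth_mx U F -> csmooth_mx U Xi ->
  (forall x, U x -> frame_conditions (F x) (Xi x)) ->
  row_free d0 -> (cmx d0 <= F x0)%MS ->
  exists (V : set 'rV[R]_m) (d : 'rV[R]_m -> 'M[R]_(kd, m))
    (a b : 'rV[R]_m -> 'M[R]_(n, m)) (Q' : 'rV[R]_m -> 'M[R]_(m, kd + (n + n)))
    (B : 'rV[R]_m -> 'M[R]_m),
    [/\ open V, V x0 & V `<=` U] /\
    [/\ smooth_mx V d, smooth_mx V a, smooth_mx V b, smooth_mx V Q' & smooth_mx V B] /\
    forall x, V x ->
    [/\ col_mx (d x) (col_mx (a x) (b x)) *m Q' x = 1%:M,
        (col_mx (cmx (d x)) (cmx (a x) + 'i%C *: cmx (b x)) :=: F x)%MS,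
        (B x)^T = - B x &
        F x *m cmx (B x) *m (F x)^T = Xi x *m (F x)^T].
Proof.
move=> oU Ux0 sF sXi hF fd0 d0F.
have [e0 e0E] := complement_frame fd0 d0F (frame_rankE (hF x0 Ux0)).
have [S SE] : exists S, col_mx (cmx d0) e0 = S *m F x0.
  by apply/submxP; rewrite e0E.
pose G x := S *m F x.
have sG : csmooth_mx U G by apply: csmooth_mxM => //; exact: csmooth_mx_cst.
pose dl x := usubmx (G x); pose e x := dsubmx (G x).
have [sG1 sG2] := sG.
have s_dl1 : smooth_mx U (fun x => re_mx (dl x)).
  apply: eq_smooth_mx (smooth_mx_usub sG1) => // x _.
  by apply/matrixP => i j; rewrite !mxE.
have s_dl2 : smooth_mx U (fun x => im_mx (dl x)).
  apply: eq_smooth_mx (smooth_mx_usub sG2) => // x _.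
  by apply/matrixP => i j; rewrite !mxE.
have s_e1 : smooth_mx U (fun x => re_mx (e x)).
  apply: eq_smooth_mx (smooth_mx_dsub sG1) => // x _.
  by apply/matrixP => i j; rewrite !mxE.
have s_e2 : smooth_mx U (fun x => im_mx (e x)).
  apply: eq_smooth_mx (smooth_mx_dsub sG2) => // x _.
  by apply/matrixP => i j; rewrite !mxE.
(* Q is a real frame of D near x0: it is free at x0, where the first rows are real, and its size is
   the constant rank of D. *)
pose Q x := col_mx (re_mx (dl x)) (col_mx (re_mx (e x)) (im_mx (e x))).
have sQ : smooth_mx U Q by apply: smooth_mx_col => //; exact: smooth_mx_col.
have dl0 : dl x0 = cmx d0 by rewrite /dl /G -SE col_mxKu.
have ee0 : e x0 = e0 by rewrite /e /G -SE col_mxKd.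
have reG x : re_mx (G x) = col_mx (re_mx (dl x)) (re_mx (e x)).
  by rewrite -[G x]vsubmxK /re_mx map_col_mx.
have imG x : im_mx (G x) = col_mx (im_mx (dl x)) (im_mx (e x)).
  by rewrite -[G x]vsubmxK /im_mx map_col_mx.
have QleD x : (Q x <= reim_mx (F x))%MS.
  apply: submx_trans (reim_mxS (F x) S).
  rewrite -/(G x) /reim_mx reG imG /Q.
set A := re_mx (dl x); set B := re_mx (e x); set D := im_mx (e x).
rewrite !col_mx_sub; apply/and3P; split.
  - exact: submx_trans (submx_colu A B) (submx_colu _ _).
  - exact: submx_trans (submx_cold A B) (submx_colu _ _).
  - exact: submx_trans (submx_cold _ D) (submx_cold _ _).
have Q0 : row_free (Q x0).
  have [T TE] : exists T, F x0 = T *m G x0 by apply/submxP; rewrite /G -SE e0E.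
  rewrite -row_leq_rank; apply: (@leq_trans (\rank (reim_mx (F x0)))).
    by rewrite (frame_rankD (hF x0 Ux0)).
  apply: mxrankS.
  rewrite [in reim_mx _]TE; apply: submx_trans (reim_mxS _ _) _.
  rewrite /reim_mx reG imG dl0 im_cmx re_cmx /Q dl0 re_cmx !col_mx_sub sub0mx /=.
  set A := re_mx (e x0); set B := im_mx (e x0).
  rewrite submx_colu (submx_trans (submx_colu A B) (submx_cold _ _)) /=.
  exact: submx_trans (submx_cold A B) (submx_cold _ _).
have [N [V1 [oV1 V1x0 V1U uQ sQi]]] := smooth_right_inverse oU Ux0 sQ Q0.
pose Qi x := N *m invmx (Q x *m N).
have QQi x : V1 x -> Q x *m Qi x = 1%:M by move=> /uQ u; rewrite /Qi mulmxA mulmxV.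
have DleQ x : V1 x -> (reim_mx (F x) <= Q x)%MS.
  move=> Vx; have [_ <-] := mxrank_leqif_sup (QleD x).
  rewrite (frame_rankD (hF x (V1U x Vx))).
  by rewrite -/(row_free _); apply/row_freeP; exists (Qi x); exact: QQi.
(* The imaginary part of the first rows lies in D, so it has smooth coordinates w in the frame Q.
   They vanish at x0. *)
pose w x := im_mx (dl x) *m Qi x.
have wE x : V1 x -> im_mx (dl x) = w x *m Q x.
  move=> Vx; have /submxP[c cE] : (im_mx (dl x) <= Q x)%MS.
    apply: submx_trans (DleQ x Vx); apply: submx_trans (reim_mxS (F x) S).
    rewrite -/(G x) /reim_mx imG.
    exact: submx_trans (submx_colu _ (im_mx (e x))) (submx_cold _ _).
  by rewrite /w cE -[c *m _ *m Qi x]mulmxA QQi // mulmx1.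
pose al x := lsubmx (w x); pose be x := lsubmx (rsubmx (w x)); pose ga x := rsubmx (rsubmx (w x)).
(* Writing w = (al, be, ga), the first rows of T G have imaginary part Im dl - al Re dl - be Re e -
   ga Im e = Im dl - w Q = 0. *)
pose T x : 'M[C]_(kd + n) :=
  block_mx (cmx 1%:M + 'i%C *: cmx (- al x)) (- (cmx (ga x) + 'i%C *: cmx (be x))) 0 1%:M.
pose G' x := T x *m G x.
pose d x := re_mx (usubmx (G' x)).
have G'u x : usubmx (G' x) = (cmx 1%:M + 'i%C *: cmx (- al x)) *m dl x
     - (cmx (ga x) + 'i%C *: cmx (be x)) *m e x.
  by rewrite /G' -[G x]vsubmxK mul_block_col col_mxKu mulNmx.
have G'd x : dsubmx (G' x) = e x.
  by rewrite /G' -[G x]vsubmxK mul_block_col col_mxKd mul0mx mul1mx add0r.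
have G'_im x : V1 x -> im_mx (usubmx (G' x)) = 0.
  move=> Vx; rewrite G'u im_mxD im_mxN !im_mxM !re_complex_mx !im_complex_mx.
  rewrite mul1mx (wE x Vx) /Q -{1}[w x]hsubmxK -[rsubmx (w x)]hsubmxK !mul_row_col.
  rewrite -/(al x) -/(be x) -/(ga x) mulNmx; apply/matrixP => i j; rewrite !mxE; ring.
have cd x : V1 x -> cmx (d x) = usubmx (G' x) by move=> /G'_im/cmx_re.
have w0 : w x0 = 0 by rewrite /w dl0 im_cmx mul0mx.
have d_x0 : d x0 = d0.
  have z1 : al x0 = 0 by apply/matrixP => i j; rewrite /al w0 !mxE.
  have z2 : be x0 = 0 by apply/matrixP => i j; rewrite /be w0 !mxE.
  have z3 : ga x0 = 0 by apply/matrixP => i j; rewrite /ga w0 !mxE.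
  rewrite /d G'u z1 z2 z3 oppr0 !cmx0 !scaler0 !addr0 mul0mx subr0 cmx1 mul1mx.
  by rewrite dl0 re_cmx.
pose Q2 x := col_mx (d x) (col_mx (re_mx (e x)) (im_mx (e x))).
have sw : smooth_mx V1 w.
  by apply: smooth_mxM => //; exact: smooth_mx_sub s_dl2.
have sT : csmooth_mx V1 T.
  have [sal sbe sga] : [/\ smooth_mx V1 al, smooth_mx V1 be & smooth_mx V1 ga].
    split; first exact: smooth_mx_lsub.
      by apply: smooth_mx_lsub; exact: smooth_mx_rsub.
    by apply: smooth_mx_rsub; exact: smooth_mx_rsub.
  have sN a b (M : 'rV[R]_m -> 'M[R]_(a, b)) : smooth_mx V1 M -> smooth_mx V1 (fun x => - M x).
    exact: smooth_mxN.
  have sC a b (M : 'M[R]_(a, b)) : smooth_mx V1 (fun=> M) by exact: smooth_mx_cst.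
  split.
    apply: (@eq_smooth_mx _ _ _ _ (fun x => block_mx 1%:M (- ga x) 0 1%:M)) => //.
      move=> x _; rewrite /T /re_mx map_block_mx -!/(re_mx _) re_mxN !re_complex_mx.
      by rewrite -(cmx0 n kd) -(cmx1 n) !re_cmx.
    by apply: smooth_mx_col; apply: smooth_mx_row => //; exact: sN.
  apply: (@eq_smooth_mx _ _ _ _ (fun x => block_mx (- al x) (- be x) 0 0)) => //.
    move=> x _; rewrite /T /im_mx map_block_mx -!/(im_mx _) im_mxN !im_complex_mx.
    by rewrite -(cmx0 n kd) -(cmx1 n) !im_cmx.
  by apply: smooth_mx_col; apply: smooth_mx_row => //; exact: sN.
have sG' : csmooth_mx V1 G' by apply: csmooth_mxM => //; exact: csmooth_mx_sub sG.
have sd : smooth_mx V1 d.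
  apply: eq_smooth_mx (smooth_mx_usub sG'.1) => // x _.
  by apply/matrixP => i j; rewrite !mxE.
have sQ2 : smooth_mx V1 Q2.
  by apply: smooth_mx_col => //; apply: smooth_mx_sub V1U _; exact: smooth_mx_col.
have Q20 : row_free (Q2 x0) by move: Q0; rewrite /Q2 /Q d_x0 dl0 re_cmx.
(* The corrected real frame is free at x0, where d is d0, hence on a smaller V; its right inverse
   will be the [Q'] of the statement. *)
have [N2 [V [oV Vx0 VV1 uQ2 sQ2i]]] := smooth_right_inverse oV1 V1x0 sQ2 Q20.
pose Q2i x := N2 *m invmx (Q2 x *m N2).
have Q2Q2i x : V x -> Q2 x *m Q2i x = 1%:M by move=> /uQ2 u; rewrite /Q2i mulmxA mulmxV.
have VU : V `<=` U by move=> x /VV1/V1U.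
have G'E x : V x -> G' x = frame_incl kd n *m cmx (Q2 x).
  move=> /VV1 Vx; rewrite -[G' x]vsubmxK -(cd x Vx) G'd /frame_incl /Q2 !cmx_col.
  rewrite mul_block_col mul_row_col !mul1mx !mul0mx addr0 add0r; congr col_mx.
  by rewrite mul_scalar_mx -complex_mxE.
have G'inv x : V x -> G' x *m (cmx (Q2i x) *m frame_proj kd n) = 1%:M.
  move=> Vx; rewrite G'E // -mulmxA [cmx _ *m (_ *m _)]mulmxA -cmxM Q2Q2i //.
  by rewrite cmx1 mul1mx frame_inclK.
have G'F x : V x -> (G' x :=: F x)%MS.
  move=> Vx; have G'S : (G' x <= F x)%MS by rewrite /G' /G mulmxA submxMl.
  apply/eqmxP; rewrite G'S /=; have [_ <-] := mxrank_leqif_sup G'S.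
  rewrite (frame_rankE (hF x (VU x Vx))) -/(row_free _); apply/row_freeP.
  by exists (cmx (Q2i x) *m frame_proj kd n); exact: G'inv.
(* The covectors that accompany the vectors G' in L, so that A is the matrix of eps in the frame G'
   of E. *)
pose Th x := T x *m S *m Xi x.
have sTh : csmooth_mx V Th.
  apply: csmooth_mxM => //; last exact: csmooth_mx_sub sXi.
  apply: csmooth_mxM => //; last exact: csmooth_mx_cst.
  exact: csmooth_mx_sub sT.
pose A x := Th x *m (G' x)^T.
have sA : csmooth_mx V A.
  by apply: csmooth_mxM => //; apply: csmooth_mxT; exact: csmooth_mx_sub sG'.
have AT x : V x -> (A x)^T = - A x.
  move=> /VU/hF/frame_isotropic iso.
  rewrite /A /Th /G' /G !trmx_mul !trmxK !mulmxA -!(mulmxA (T x *m S)).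
  by rewrite iso !mulNmx mulmxN opprK !mulmxA.
pose Y := frame_proj kd n; pose P := frame_real kd n.
have PT : P^T = P by rewrite /P /frame_real tr_block_mx !trmx0 trmx1.
have cP : conj_mx P = P.
  by rewrite /conj_mx /P /frame_real map_block_mx !map_mx0 map_mx1.
(* P A P is the restriction of eps to Delta, extended by zero. *)
have PAP x : V x -> im_mx (P *m A x *m P) = 0.
  move=> Vx; pose c := usubmx (T x *m S).
  have cE : cmx (d x) = c *m F x.
    by rewrite (cd x (VV1 x Vx)) /G' /G mulmxA -[T x *m S]vsubmxK mul_col_mx col_mxKu.
  have AE : A x = block_mx (c *m Xi x *m (F x)^T *m c^T)
      (ursubmx (A x)) (dlsubmx (A x)) (drsubmx (A x)).
    rewrite -[LHS]submxK; congr block_mx.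
    rewrite /A /Th /G' /G mulmxA -[T x *m S]vsubmxK -/c !mul_col_mx tr_col_mx !mul_mx_row -/(block_mx _ _ _ _).
    by rewrite block_mxKul trmx_mul mulmxA.
  rewrite AE /P /frame_real !mulmx_block !mulmx0 !mul0mx !addr0 mulmx1 mul1mx.
  rewrite /im_mx map_block_mx -!/(im_mx _) (frame_epsilon_real (hF x (VU x Vx)) cE).
  by rewrite mul0mx !im_mx0 block_mx0.
have PP : P *m P = P.
  by rewrite /P /frame_real mulmx_block !mulmx0 !mul0mx !addr0 mulmx1.
have cPAP x : V x -> conj_mx (P *m A x *m P) = P *m A x *m P by move=> /PAP/conj_mx_real.
have cYP : conj_mx (Y *m P) = Y *m P.
  rewrite /Y /P /frame_proj /frame_real mulmx_block !mulmx0 !mul0mx !addr0 mulmx1.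
  by rewrite /conj_mx map_block_mx !map_mx0 map_mx1.
pose B0 x : 'M[R]_(kd + (n + n)) := re_mx (Y *m A x *m Y^T) *+ 2
   - re_mx (Y *m (P *m A x *m P) *m Y^T).
have cB0 x : V x -> cmx (B0 x) = Y *m A x *m Y^T + conj_mx (Y *m A x *m Y^T)
    - Y *m (P *m A x *m P) *m Y^T.
  move=> Vx; rewrite /B0 cmxD cmxN cmx_2re; congr (_ - _); apply: cmx_re.
  apply: conj_mx_im0.
  have -> : Y *m (P *m A x *m P) *m Y^T = (Y *m P) *m (P *m A x *m P) *m (Y *m P)^T.
    by rewrite trmx_mul PT !mulmxA -(mulmxA Y P P) PP -(mulmxA _ P P) PP.
  by rewrite conj_mxM conj_mxT cYP conj_mxM cYP cPAP.
(* Restricted to E, the pullback along Y gives A back and its conjugate leaves only the Delta block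
   P A P, which is real; the subtracted term is exactly that block. *)
have ZBZ x : V x -> frame_incl kd n *m cmx (B0 x) *m (frame_incl kd n)^T = A x.
  move=> Vx; rewrite cB0 // mulmxBr mulmxBl mulmxDr mulmxDl; set Z := frame_incl kd n.
  have ZY : Z *m Y = 1%:M by exact: frame_inclK.
  have ZcY : Z *m conj_mx Y = P by exact: frame_incl_conj.
  move: (A x) (cPAP x Vx) => Ax; rewrite !conj_mxM cP => cPAx.
  rewrite conj_mxT !mulmxA ZY ZcY !mul1mx -!(mulmxA _ _ Z^T) -!trmx_mul ZY ZcY.
  by rewrite trmx1 PT !mulmx1 cPAx addrK.
have B0T x : V x -> (B0 x)^T = - B0 x.
  move=> Vx; rewrite /B0; move: (A x) (AT x Vx) => Ax ATx.
  rewrite linearB linearMn /= -!re_mxT !trmx_mul !trmxK PT ATx.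
  by rewrite !(mulNmx, mulmxN) !re_mxN mulNrn -opprD !mulmxA.
(* B0 is a form on D in the frame Q2. Since Q2 Q2i = 1, conjugating by Q2i extends it to the whole
   space without changing it on D. *)
pose B x := Q2i x *m B0 x *m (Q2i x)^T.
exists V, d, (fun x => re_mx (e x)), (fun x => im_mx (e x)), Q2i, B.
split; first by split.
split; first split => //.
- exact: smooth_mx_sub sd.
- exact: smooth_mx_sub s_e1.
- exact: smooth_mx_sub s_e2.
- have sB0 : smooth_mx V B0.
    have sY (M : 'rV[R]_m -> 'M[C]_(kd + n)) : csmooth_mx V M -> csmooth_mx V (fun x => Y *m M x *m Y^T).
      move=> sM; apply: csmooth_mxM => //; last exact: csmooth_mx_cst.
      by apply: csmooth_mxM => //; exact: csmooth_mx_cst.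
    have [s1 _] := sY A sA.
    have [|s2 _] := sY (fun x => P *m A x *m P).
      apply: csmooth_mxM => //; last exact: csmooth_mx_cst.
      by apply: csmooth_mxM => //; exact: csmooth_mx_cst.
    apply: (@smooth_mxB _ _ _ _ (fun x => re_mx (Y *m A x *m Y^T) *+ 2)
      (fun x => re_mx (Y *m (P *m A x *m P) *m Y^T)) oV _ s2).
    under [X in smooth_mx _ X]funext do rewrite mulr2n.
    exact: (smooth_mxD oV s1 s1).
  apply: smooth_mxM => //; last exact: smooth_mxT.
  exact: smooth_mxM.
move=> x Vx; split.
- exact: Q2Q2i.
- apply: eqmx_trans (G'F x Vx); rewrite -complex_mxE (cd x (VV1 x Vx)) -(G'd x) vsubmxK.
  exact: eqmx_refl.
- rewrite /B; move: (Q2i x) (B0 x) (B0T x Vx) => q b0 bT.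
  by rewrite !trmx_mul trmxK bT mulNmx mulmxN mulmxA.
have [T2 T2E] : exists T2, F x = T2 *m G' x by apply/submxP; rewrite G'F.
have GBG : G' x *m cmx (B x) *m (G' x)^T = A x.
  rewrite G'E // -[RHS]ZBZ // /B; move: (Q2 x) (Q2i x) (B0 x) (Q2Q2i x Vx) => q2 qi b0 qq.
  rewrite trmx_mul !cmxM cmxT !mulmxA -(mulmxA _ (cmx q2) (cmx qi)) -cmxM qq cmx1 mulmx1.
  by rewrite -(mulmxA _ (cmx qi)^T) -trmx_mul -cmxM qq cmx1 trmx1 mulmx1.
apply: (@isotropic_transfer _ _ _ _ _ _ _ (T x *m S) T2).
- by rewrite -mulmxA.
- exact: frame_isotropic (hF x (VU x Vx)).
- by rewrite -(mulmxA (T x)) -/(G x) -/(G' x) GBG.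
Qed.

End LocalNormalForm.

(** * Ordinary differential equations and commuting frames *)

Section InitialValueProblem.

Lemma exists_primitive (f : R -> R) : continuous f ->
  exists F : R -> R, F 0 = 0 /\ forall t : R, 0 <= t <= 1 -> is_derive t (1 : R) F (f t).
Proof.
(* Integrating from -1, inside [-1, 2], leaves 0 and 1 in the interior, so that F has two-sided
   derivatives on all of [0, 1]. *)
move=> fc; pose F (x : R) := (\int[lebesgue_measure]_(t in [set` `[-1, x]]) f t)%R.
have dF (t : R) : 0 <= t <= 1 -> is_derive t (1 : R) F (f t).
  move=> /andP[t0 t1].
  have [||||d dE] := @continuous_FTC1_closed R f (-1) t 2.
  - by apply: le_lt_trans t1 _; rewrite ltr1n.
  - apply: continuous_compact_integrable; first exact: segment_compact.
    exact: continuous_subspaceT.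
  - by rewrite (lt_le_trans _ t0).
  - exact: fc.
  by split; [exact: d|rewrite -derive1E; exact: dE].
exists (fun t => F t - F 0); split; first by rewrite subrr.
move=> t t01; have d1 := dF t t01.
have := is_deriveB d1 (is_derive_cst (F 0 : R) t (1 : R)).
by rewrite subr0.
Qed.

Lemma mean_value_le (f df : R -> R) (K : R) : (forall t : R, 0 <= t <= 1 -> is_derive t (1 : R) f (df t)) ->
  (forall t : R, 0 <= t <= 1 -> `|df t| <= K) ->
  forall s t : R, 0 <= s <= 1 -> 0 <= t <= 1 -> `|f t - f s| <= K * `|t - s|.
Proof.
move=> fd dfK.
have main (s t : R) : 0 <= s <= 1 -> 0 <= t <= 1 -> s < t -> `|f t - f s| <= K * `|t - s|.
  move=> /andP[s0 s1] /andP[t0 t1] st.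
  have sub c : c \in `[s, t] -> 0 <= c <= 1.
    by rewrite in_itv /= => /andP[sc ct]; rewrite (le_trans s0 sc) (le_trans ct t1).
  have [||c cst ->] := @MVT R f df s t st.
  - by move=> c cst; apply: fd; apply: sub; exact: subset_itv_oo_cc cst.
  - apply: continuous_in_subspaceT => c; rewrite inE => /sub/fd[d _].
    by apply: differentiable_continuous; exact/derivable1_diffP.
  by rewrite normrM ler_wpM2r //; apply: dfK; apply: sub; exact: subset_itv_oo_cc cst.
move=> s t s01 t01; have [st|ts|->] := ltgtP s t; first exact: main.
  by rewrite distrC [`|t - s|]distrC; exact: main.
by rewrite !subrr normr0 mulr0.
Qed.

(** Composition with this retraction extends a curve on [0, 1] to the line, or a field on a cube to
    the whole space, without increasing Lipschitz constants. *)
Definition clamp (a b x : R) := Num.max a (Num.min b x).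

Lemma clamp_itv a b x : a <= b -> a <= clamp a b x <= b.
Proof.
by move=> ab; rewrite /clamp le_max lexx ge_max ab ge_min lexx.
Qed.

Lemma clamp_id a b x : a <= x <= b -> clamp a b x = x.
Proof. by move=> /andP[ax xb]; rewrite /clamp min_r // max_r. Qed.

Lemma clamp_lip a b x y : a <= b -> `|clamp a b x - clamp a b y| <= `|x - y|.
Proof.
move=> ab; wlog xy : x y / y <= x.
  by move=> h; have [/h //|/ltW/h] := leP y x; rewrite distrC [`|y - x|]distrC.
rewrite [leRHS]ger0_norm ?subr_ge0 // /clamp ler_norml.
by case: (leP b x) => ?; case: (leP b y) => ?; case: (leP a b) => ?;
  case: (leP a x) => ?; case: (leP a y) => ?; apply/andP; split; lra.
Qed.

Lemma half_pow_small (K e : R) : 0 < e -> exists n, K * (2^-1) ^+ n < e.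
Proof.
move=> e0; have [n nE] : exists n : nat, K / e < n%:R.
  by exists (Num.bound `|K / e|); apply: le_lt_trans (ler_norm _) _; exact: archi_boundP.
exists n; rewrite exprVn ltr_pdivrMr ?exprn_gt0 // -ltr_pdivrMl // mulrC.
by apply: lt_trans nE _; rewrite -natrX ltr_nat ltn_expl.
Qed.

Lemma le_half_pow (a b K : R) : (forall n, a <= b + K * (2^-1) ^+ n) -> a <= b.
Proof.
move=> h; rewrite leNgt; apply/negP => ba.
have [|n] := @half_pow_small K (a - b); first by rewrite subr_gt0.
by rewrite ltrBrDl ltNge h.
Qed.

(** With w n = 2 K 2^-n, the tail of the geometric series, the intervals of centre u n and radius w
    n are nested; the supremum of their left ends lies in all of them. *)
Lemma geometric_limit (u : nat -> R) (K : R) :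
  (forall n, `|u n.+1 - u n| <= K * (2^-1) ^+ n) ->
  exists l, forall n, `|u n - l| <= 2 * K * (2^-1) ^+ n.
Proof.
move=> uK; pose w n := 2 * K * (2^-1 : R) ^+ n.
have w0 n : 0 <= w n.
  by have := le_trans (normr_ge0 _) (uK n); rewrite /w -mulrA => h; rewrite mulr_ge0.
have wS n : w n.+1 = w n - K * (2^-1) ^+ n.
  by rewrite /w exprS; field.
have step n : u n - w n <= u n.+1 - w n.+1 /\ u n.+1 + w n.+1 <= u n + w n.
  have := uK n; rewrite ler_norml wS => /andP[]; move: (w n) (K * _) => a b.
  by move=> h1 h2; split; lra.
have mA n k : u n - w n <= u (n + k)%N - w (n + k)%N.
  by elim: k => [|k IH]; rewrite ?addn0 // addnS; apply: le_trans IH (step _).1.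
have mB n k : u (n + k)%N + w (n + k)%N <= u n + w n.
  by elim: k => [|k IH]; rewrite ?addn0 // addnS; apply: le_trans (step _).2 IH.
have AB n k : u n - w n <= u k + w k.
  apply: le_trans (mA n k) _; rewrite addnC; apply: le_trans _ (mB k n).
  by apply: le_trans (_ : _ <= u (k + n)%N) _; rewrite ?gerBl ?lerDl.
pose A := [set u n - w n | n in [set: nat]].
have supA : has_sup A.
  by split; [exists (u 0 - w 0), 0|exists (u 0 + w 0) => _ [n _ <-]].
exists (sup A) => n; rewrite distrC ler_distl; apply/andP; split.
  by apply: sup_upper_bound => //; exists n.
by apply: ge_sup; [exact: supA.1|move=> _ [k _ <-]].
Qed.

(** Picard iteration: with Lipschitz constant 1/2 and unit time, integration contracts the uniform
    distance on [0, 1] by 1/2. *)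
Lemma ode_global m (v : 'rV[R]_m -> 'rV[R]_m) (x0 : 'rV[R]_m) (B : R) : 0 <= B ->
  (forall y z, `|v y - v z| <= 2^-1 * `|y - z|) -> (forall y, `|v y| <= B) ->
  exists g : R -> 'rV[R]_m, g 0 = x0 /\ forall t : R, 0 <= t <= 1 -> forall j,
    is_derive t (1 : R) (fun s => g s 0 j) (v (g t) 0 j).
Proof.
move=> B0 vL vB.
(* Primitives are chosen for all functions at once, with a junk value on the discontinuous ones. *)
have /choice[prim primP] : forall f : R -> R, exists F : R -> R, continuous f ->
    F 0 = 0 /\ forall t : R, 0 <= t <= 1 -> is_derive t (1 : R) F (f t).
  move=> f; have [/exists_primitive[F FP]|nc] := pselect (continuous f); first by exists F.
  by exists f.
pose c := clamp 0 1.
have c01 s : 0 <= c s <= 1 by apply: clamp_itv.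
(* Clamping time makes the integrand continuous on the whole line although curves are only
   controlled on [0, 1]. *)
pose F (g : R -> 'rV[R]_m) j s := v (g (c s)) 0 j.
pose P (g : R -> 'rV[R]_m) t : 'rV[R]_m := x0 + \row_j prim (F g j) t.
pose Lip (g : R -> 'rV[R]_m) := forall s t : R, 0 <= s <= 1 -> 0 <= t <= 1 -> `|g t - g s| <= B * `|t - s|.
have Fc g j : Lip g -> continuous (F g j).
  move=> gL s; apply/cvgrPdist_le => e e0.
  have K0 : 0 < B + 1 by rewrite ltr_wpDl.
  near=> t; apply: (@le_trans _ _ ((B + 1) * `|s - t|)).
    have -> : F g j s - F g j t = (v (g (c s)) - v (g (c t))) 0 j by rewrite !mxE.
    apply: le_trans (rV_norm_coord _ _) _; apply: le_trans (vL _ _) _.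
    apply: (@le_trans _ _ (`|g (c s) - g (c t)|)).
      by rewrite ler_piMl // invf_le1 // ler1n.
    apply: le_trans (gL _ _ (c01 t) (c01 s)) _; apply: ler_pM => //; first by rewrite lerDl.
    exact: clamp_lip.
  rewrite -ler_pdivlMl // mulrC; near: t.
  apply/nbhs_ballP; exists (e / (B + 1)) => [|r sr]; first exact: divr_gt0.
  exact: ltW sr.
have P0 g : Lip g -> P g 0 = x0.
  move=> gL; apply/rowP => j; rewrite !mxE.
  by have [-> _] := primP _ (Fc g j gL); rewrite addr0.
have Pd g (t : R) j : Lip g -> 0 <= t <= 1 -> is_derive t (1 : R) (fun s => P g s 0 j) (v (g t) 0 j).
  move=> gL t01; have [_ /(_ t t01)] := primP _ (Fc g j gL).
  have <- : F g j t = v (g t) 0 j by rewrite /F /c clamp_id.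
  move=> d.
  have -> : (fun s => P g s 0 j) = cst (x0 0 j) + prim (F g j).
    by apply/funext => s; rewrite !mxE.
  by have := is_deriveD (is_derive_cst (x0 0 j : R) t (1 : R)) d; rewrite add0r.
have PL g : Lip g -> Lip (P g).
  move=> gL s t s01 t01; apply/rV_normP; first by rewrite mulr_ge0.
  move=> j; have -> : (P g t - P g s) 0 j = P g t 0 j - P g s 0 j by rewrite !mxE.
  apply: (mean_value_le (fun t => Pd g t j gL)) => // r r01.
  by apply: le_trans (vB (g r)); exact: rV_norm_coord.
have Pctr g h D : 0 <= D -> Lip g -> Lip h -> (forall t : R, 0 <= t <= 1 -> `|g t - h t| <= D) ->
    forall t : R, 0 <= t <= 1 -> `|P g t - P h t| <= 2^-1 * D.
  move=> D0 gL hL gh t t01; apply/rV_normP; first by rewrite mulr_ge0.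
  move=> j; have -> : (P g t - P h t) 0 j = P g t 0 j - P h t 0 j by rewrite !mxE.
  have dd (s : R) : 0 <= s <= 1 -> is_derive s (1 : R) (fun s => P g s 0 j - P h s 0 j)
      (v (g s) 0 j - v (h s) 0 j).
    by move=> s01; apply: is_deriveB; exact: Pd.
  have o01 : (0 : R) <= (0 : R) <= (1 : R) by rewrite lexx /=.
  have mv := mean_value_le (K := 2^-1 * D) dd _ o01 t01.
  rewrite !P0 // subrr !subr0 in mv.
  apply: le_trans (mv _) _ => [s s01|].
    have -> : v (g s) 0 j - v (h s) 0 j = (v (g s) - v (h s)) 0 j by rewrite !mxE.
    apply: le_trans (rV_norm_coord _ _) _; apply: le_trans (vL _ _) _.
    by rewrite ler_wpM2l // gh.
  by case/andP: t01 => t0 t1; rewrite ger0_norm // ler_piMr // mulr_ge0.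
pose g n := iter n P (fun=> x0).
have gL n : Lip (g n).
  elim: n => [|n IH]; last exact: PL.
  by move=> s t _ _; rewrite /g /= subrr normr0 mulr_ge0.
have gS n (t : R) : 0 <= t <= 1 -> `|g n.+1 t - g n t| <= B * (2^-1) ^+ n.
  elim: n t => [|n IH] t t01.
    rewrite expr0 mulr1; have -> : g 0%N t = P (g 0%N) 0 by rewrite P0 //; exact: gL 0%N.
    have o01 : (0 : R) <= (0 : R) <= (1 : R) by rewrite lexx /=.
    apply: le_trans (PL _ (gL 0%N) 0 t o01 t01) _.
    by case/andP: t01 => t0 t1; rewrite subr0 ger0_norm // ler_piMr.
  rewrite exprS mulrCA; apply: (Pctr _ _ _ _ (gL n.+1) (gL n)) => //.
  by rewrite mulr_ge0 // exprn_ge0.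
have /choice[l lP] : forall tj : R * 'I_m, exists l, forall n,
    `|g n (c tj.1) 0 tj.2 - l| <= 2 * B * (2^-1) ^+ n.
  move=> [t j] /=; apply: geometric_limit => n.
  by apply: le_trans _ (gS n _ (c01 t)); have := rV_norm_coord (g n.+1 (c t) - g n (c t)) j; rewrite !mxE.
pose gl t : 'rV[R]_m := \row_j l (t, j).
have glP n (t : R) : 0 <= t <= 1 -> `|g n t - gl t| <= 2 * B * (2^-1) ^+ n.
  move=> t01; apply/rV_normP; first by rewrite !mulr_ge0 // exprn_ge0.
  by move=> j; have := lP (t, j) n; rewrite !mxE /= /c clamp_id.
have glL : Lip gl.
  move=> s t s01 t01; apply: (@le_half_pow _ _ (4 * B)) => n.
  have -> : gl t - gl s = (g n t - g n s) - (g n t - gl t) + (g n s - gl s).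
    by apply/rowP => j; rewrite !mxE; ring.
  apply: le_trans (ler_normD _ _) _.
  apply: le_trans (lerD (ler_normB _ _) (lexx _)) _.
  have -> : 4 * B * (2^-1) ^+ n = 2 * B * (2^-1) ^+ n + 2 * B * (2^-1) ^+ n :> R by ring.
  by rewrite addrA; apply: lerD; [apply: lerD; [exact: gL|exact: glP]|exact: glP].
have PglE (t : R) : 0 <= t <= 1 -> P gl t = gl t.
  move=> t01; apply/eqP; rewrite -subr_eq0 -normr_le0.
  apply: (@le_half_pow _ _ (2 * B)) => n; rewrite add0r.
  have -> : P gl t - gl t = (g n.+1 t - gl t) - (g n.+1 t - P gl t).
    by apply/rowP => j; rewrite !mxE; ring.
  apply: le_trans (ler_normB _ _) _.
  have -> : 2 * B * (2^-1) ^+ n = 2 * B * (2^-1) ^+ n.+1 + 2^-1 * (2 * B * (2^-1) ^+ n).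
    by rewrite exprS; field.
  apply: lerD; first exact: glP.
  apply: Pctr => //; last exact: glP.
  by rewrite !mulr_ge0 // exprn_ge0.
(* On [0, 1] this is gl, but gl is constant outside, whereas [P gl] has two-sided derivatives at the
   endpoints. *)
exists (P gl); split; first exact: P0.
by move=> t t01 j; rewrite PglE //; exact: Pd.
Unshelve. all: by end_near. Qed.

End InitialValueProblem.

(** * Integral manifolds of commuting fields from time-one maps *)

Section CommutingFields.

(** A substitute for Gronwall's inequality: the maximum S of |h| on [0, 1] satisfies S <= S / 2 +
    eta by the mean value inequality from time 0. *)
Lemma sup_estimate m (h dh : R -> 'rV[R]_m) (eta : R) : 0 <= eta -> h 0 = 0 ->
  (forall t : R, 0 <= t <= 1 -> forall j, is_derive t (1 : R) (fun s => h s 0 j) (dh t 0 j)) ->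
  (forall t : R, 0 <= t <= 1 -> `|dh t| <= 2^-1 * `|h t| + eta) ->
  forall t : R, 0 <= t <= 1 -> `|h t| <= 2 * eta.
Proof.
move=> eta0 h0 hd dhle.
have hc : {within `[(0 : R), 1], continuous (fun t => `|h t|)}.
  apply: continuous_in_subspaceT => t; rewrite inE /= in_itv /= => t01.
  apply: continuous_comp; last exact: norm_continuous.
  apply: (@coord_cvg_rV R^o _ (nbhs t)) => j.
  by have [d _] := hd t t01 j; apply: differentiable_continuous; exact/derivable1_diffP.
have [c c01 cmax] := EVT_max (ler01 : (0 : R) <= 1) hc.
rewrite in_itv /= in c01; set S := `|h c| in cmax.
have S0 : 0 <= S by exact: normr_ge0.
have Sle : S <= 2^-1 * S + eta.
  apply/rV_normP; first by rewrite addr_ge0 // mulr_ge0.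
  move=> j; have o01 : (0 : R) <= (0 : R) <= (1 : R) by rewrite lexx /=.
  have hdj (t : R) : 0 <= t <= 1 -> is_derive t (1 : R) (fun s => h s 0 j) (dh t 0 j).
    by move=> t01; exact: hd.
  have := mean_value_le (K := 2^-1 * S + eta) hdj _ o01 c01.
  rewrite h0 mxE !subr0 => mv; apply: le_trans (mv _) _ => [t t01|].
    apply: le_trans (rV_norm_coord _ _) _; apply: le_trans (dhle t t01) _.
    by rewrite lerD2r ler_wpM2l // cmax // in_itv.
  case/andP: c01 => c0 c1; rewrite (ger0_norm c0) ler_piMr //.
  by rewrite addr_ge0 // mulr_ge0.
move=> t t01; apply: (@le_trans _ _ S); first by apply: cmax; rewrite in_itv.
clear -Sle; lra.
Qed.

Definition clamp_rV m (x0 : 'rV[R]_m) (e : R) (y : 'rV[R]_m) : 'rV[R]_m :=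
  \row_j clamp (x0 0 j - e) (x0 0 j + e) (y 0 j).

(** The field is extended from the cube by clamping. Its speed is at most e, so in unit time the
    solution does not leave the cube and never notices the extension. *)
Lemma ode_local m (v : 'rV[R]_m -> 'rV[R]_m) (x0 : 'rV[R]_m) (e : R) : 0 <= e ->
  (forall y z, `|y - x0| <= e -> `|z - x0| <= e -> `|v y - v z| <= 2^-1 * `|y - z|) ->
  (forall y, `|y - x0| <= e -> `|v y| <= e) ->
  exists g : R -> 'rV[R]_m, g 0 = x0 /\ forall t : R, 0 <= t <= 1 -> `|g t - x0| <= e /\
    forall j, is_derive t (1 : R) (fun s => g s 0 j) (v (g t) 0 j).
Proof.
move=> e0 vL vB; pose w y := v (clamp_rV x0 e y).
have ab j : x0 0 j - e <= x0 0 j + e by rewrite lerBlDr -addrA lerDl addr_ge0.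
have cin y : `|clamp_rV x0 e y - x0| <= e.
  apply/rV_normP => // j; rewrite !mxE ler_distl.
  exact: clamp_itv.
have wL y z : `|w y - w z| <= 2^-1 * `|y - z|.
  apply: le_trans (vL _ _ (cin _) (cin _)) _; rewrite ler_wpM2l //.
  apply/rV_normP => // j; rewrite !mxE; apply: le_trans (clamp_lip _ _ (ab j)) _.
  by have := rV_norm_coord (y - z) j; rewrite !mxE.
have wB y : `|w y| <= e by apply: vB; exact: cin.
have [g [g0 gd]] := ode_global x0 e0 wL wB.
exists g; split=> // t t01.
have gin : `|g t - x0| <= e.
  apply/rV_normP => // j.
  have o01 : (0 : R) <= (0 : R) <= (1 : R) by rewrite lexx /=.
  have gdj (s : R) : 0 <= s <= 1 -> is_derive s (1 : R) (fun s => g s 0 j) (w (g s) 0 j).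
    by move=> ?; exact: gd.
  have := mean_value_le (K := e) gdj _ o01 t01; rewrite g0 => mv.
  have -> : (g t - x0) 0 j = g t 0 j - x0 0 j by rewrite !mxE.
  apply: le_trans (mv _) _ => [s s01|].
    by apply: le_trans (rV_norm_coord _ _) (wB _).
  by case/andP: t01 => t0 t1; rewrite subr0 ger0_norm // ler_piMr.
split=> // j; have := gd t t01 j; rewrite /w.
suff -> : clamp_rV x0 e (g t) = g t by [].
apply/rowP => l; rewrite mxE clamp_id // -ler_distl.
by have := (rV_normP _ e0).1 gin l; rewrite !mxE.
Qed.

Lemma is_derive_sum_fun n (F : 'I_n -> R -> R) (dF : 'I_n -> R) (t : R) :
  (forall i, is_derive t (1 : R) (F i) (dF i)) ->
  is_derive t (1 : R) (fun s => \sum_i F i s) (\sum_i dF i).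
Proof.
move=> Fd; have := @is_derive_sum _ _ _ n F t 1 dF Fd.
by rewrite (_ : \sum_(i < n) F i = (fun s => \sum_i F i s)) //; apply/funext => s; rewrite fct_sumE.
Qed.

Lemma is_derive_comp_curve m (f : 'rV[R]_m -> R) (g : R -> 'rV[R]_m) (dg : 'rV[R]_m) (t : R) :
  (forall j, is_derive t (1 : R) (fun s => g s 0 j) (dg 0 j)) -> differentiable f (g t) ->
  is_derive t (1 : R) (fun s => f (g s)) (\sum_l dg 0 l * 'D_(delta_mx 0 l) f (g t)).
Proof.
move=> gd df.
have dgt : differentiable g t.
  by apply: differentiable_rV => j; have [d _] := gd j; exact/derivable1_diffP.
split; first by apply: diff_derivable; exact: differentiable_comp.
rewrite [LHS](derive_comp_partial (1 : R) dgt df); apply: eq_bigr => l _.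
by have [_ ->] := gd l.
Qed.

Definition tame_on m (U : set 'rV[R]_m) (x0 : 'rV[R]_m) (f : 'rV[R]_m -> R) (e C : R) : Prop :=
  [/\ forall y, `|y - x0| < e -> U y,
      forall y, `|y - x0| < e -> `|f y| <= C,
      forall x y, `|x - x0| < e -> `|y - x0| < e -> `|f y - f x| <= C * `|y - x|,
      forall x y, `|x - x0| < e -> `|y - x0| < e ->
        `|f y - f x - \sum_l (y - x) 0 l * 'D_(delta_mx 0 l) f x| <= C * `|y - x| ^+ 2 &
      forall l y, `|y - x0| < e -> `|'D_(delta_mx 0 l) f y| <= C].

Lemma tame_on_mono m U (x0 : 'rV[R]_m) f e C e' C' :
  tame_on U x0 f e C -> 0 < e' -> e' <= e -> C <= C' -> tame_on U x0 f e' C'.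
Proof.
move=> [h1 h2 h3 h4 h5] e'0 ee CC; have lt y : `|y - x0| < e' -> `|y - x0| < e.
  by move=> ye; exact: lt_le_trans ee.
split=> [y /lt/h1 //|y /lt/h2 h|x y /lt xe /lt ye|x y /lt xe /lt ye|l y /lt ye].
- exact: le_trans CC.
- by apply: le_trans (h3 _ _ xe ye) _; rewrite ler_wpM2r.
- by apply: le_trans (h4 _ _ xe ye) _; rewrite ler_wpM2r // exprn_ge0.
- exact: le_trans (h5 l y ye) CC.
Qed.

Lemma smooth_on_tame m (U : set 'rV[R]_m) x0 f : open U -> U x0 -> smooth_on U f ->
  exists e C, [/\ 0 < e, 0 < C & tame_on U x0 f e C].
Proof.
move=> oU Ux0 sf.
have bound g : smooth_on U g -> exists e C, [/\ 0 < e, 0 < C & forall y, `|y - x0| < e -> `|g y| <= C].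
  move=> sg; have [e [C [e0 C0 _ lip]]] := Ck_on_locally_lipschitz oU Ux0 (sg 1%N).
  exists e, (`|g x0| + C * e); split=> //; first by rewrite ltr_wpDl // mulr_gt0.
  move=> y ye; rewrite -lerBlDl; apply: le_trans (lerB_dist _ _) _.
  have e00 : `|x0 - x0| < e by rewrite subrr normr0.
  by apply: le_trans (lip _ _ e00 ye) _; rewrite ler_wpM2l ?ltW.
have [e1 [C1 [e10 C10 U1 lip]]] := Ck_on_locally_lipschitz oU Ux0 (sf 1%N).
have [e2 [C2 [e20 C20 _ tay]]] := Ck_on_taylor oU Ux0 (sf 2%N).
have [e3 [C3 [e30 C30 bd]]] := bound f sf.
have [||e4 [C4 [e40 C40 pd]]] := @common_radius 'I_m (fun l e C => forall y, `|y - x0| < e ->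
    `|'D_(delta_mx 0 l) f y| <= C).
- move=> l e C e' C' h e'0 ee CC y ye; apply: le_trans CC; apply: h; exact: lt_le_trans ee.
- by move=> l; apply: bound; exact: smooth_on_partial.
pose e := Num.min (Num.min e1 e2) (Num.min e3 e4).
pose C := Num.max (Num.max C1 C2) (Num.max C3 C4).
have lt y : `|y - x0| < e -> [/\ `|y - x0| < e1, `|y - x0| < e2, `|y - x0| < e3 & `|y - x0| < e4].
  by rewrite !lt_min => /andP[/andP[-> ->] /andP[-> ->]].
have [c1 c2 c3 c4] : [/\ C1 <= C, C2 <= C, C3 <= C & C4 <= C].
  by rewrite !le_max !lexx !orbT.
exists e, C; split; first by rewrite !lt_min e10 e20 e30.
  by rewrite !lt_max C10.
split=> [y /lt[h _ _ _]|y /lt[_ _ h _]|x y /lt[h _ _ _] /lt[h' _ _ _]|x y /lt[_ h _ _] /lt[_ h' _ _]|l y /lt[_ _ _ h]].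
- exact: U1.
- by apply: le_trans c3; exact: bd.
- by apply: le_trans (lip _ _ h h') _; rewrite ler_wpM2r.
- by apply: le_trans (tay _ _ h h') _; rewrite ler_wpM2r // exprn_ge0.
- by apply: le_trans c4; exact: pd.
Qed.

Lemma norm_sum_le n (F : 'I_n -> R) (K : R) : (forall i, `|F i| <= K) -> `|\sum_i F i| <= n%:R * K.
Proof.
move=> FK; apply: le_trans (ler_norm_sum _ _ _) _; rewrite mulr_natl.
rewrite -[X in K *+ X]card_ord -sumr_const; apply: ler_sum => i _; exact: FK.
Qed.

Section CommutingFrame.
Variables (k m : nat) (U : set 'rV[R]_m) (D : 'rV[R]_m -> 'M[R]_(k, m)) (x0 : 'rV[R]_m).
Hypotheses (oU : open U) (Ux0 : U x0) (sD : smooth_mx U D).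
Hypothesis comm : forall x, U x -> forall i j l,
  \sum_q D x i q * 'D_(delta_mx 0 q) (fun y => D y j l) x =
  \sum_q D x j q * 'D_(delta_mx 0 q) (fun y => D y i l) x.
Variables (e C rho : R).
Hypotheses (e0 : 0 < e) (C0 : 0 < C) (rho0 : 0 < rho).
Hypothesis tame : forall i l, tame_on U x0 (fun y => D y i l) e C.
(** For |u| < rho, [rho1] bounds the field u D by e / 2, which keeps curves in the ball up to time
    1; [rho3] and [rho2] bound by 1/2 the Lipschitz constant of u D and the norm of its
    linearisation, as [ode_local] and [sup_estimate] require. *)
Hypotheses (rho1 : k%:R * (rho * C) <= e / 2)
  (rho2 : k%:R * (rho * (m%:R * C)) <= 2^-1) (rho3 : k%:R * (rho * C) <= 2^-1).

Lemma frame_flow (u : 'rV[R]_k) : `|u| < rho -> exists g : R -> 'rV[R]_m, g 0 = x0 /\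
  forall t : R, 0 <= t <= 1 -> `|g t - x0| < e /\
    forall j, is_derive t (1 : R) (fun s => g s 0 j) ((u *m D (g t)) 0 j).
Proof.
move=> urho; have he : e / 2 < e by rewrite ltr_pdivrMr // ltr_pMr // ltr1n.
have ball2 y : `|y - x0| <= e / 2 -> `|y - x0| < e by move=> h; exact: le_lt_trans he.
have uc i : `|u 0 i| <= rho by apply: le_trans (rV_norm_coord _ _) (ltW urho).
have [|y z /ball2 ye /ball2 ze|y /ball2 ye|g [g0 gd]] := @ode_local m (fun y => u *m D y) x0 (e / 2).
- by rewrite divr_ge0 // ltW.
- apply/rV_normP => [|l]; first by rewrite mulr_ge0.
  have -> : (u *m D y - u *m D z) 0 l = \sum_i u 0 i * (D y i l - D z i l).
    by rewrite !mxE -sumrB; apply: eq_bigr => i _; rewrite mulrBr.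
  apply: le_trans (norm_sum_le (K := rho * (C * `|y - z|)) _) _ => [i|].
    rewrite normrM; apply: ler_pM => //.
    by have [_ _ h _ _] := tame i l; exact: h.
  by rewrite !mulrA ler_wpM2r // -mulrA.
- apply/rV_normP => [|l]; first by rewrite divr_ge0 // ltW.
  rewrite mxE; apply: le_trans rho1; apply: norm_sum_le => i.
  by rewrite normrM; apply: ler_pM => //; have [_ h _ _ _] := tame i l; exact: h.
- by exists g; split=> // t /gd[h1 h2]; split=> //; exact: ball2.
Qed.

Variable g : 'rV[R]_k -> R -> 'rV[R]_m.
Hypothesis gP : forall u, `|u| < rho -> g u 0 = x0 /\
  forall t : R, 0 <= t <= 1 -> `|g u t - x0| < e /\
    forall j, is_derive t (1 : R) (fun s => g u s 0 j) ((u *m D (g u t)) 0 j).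

Lemma flow_lipschitz u v : `|u| < rho -> `|u + v| < rho -> forall t : R, 0 <= t <= 1 ->
  `|g (u + v) t - g u t| <= 2 * (k%:R * (`|v| * C)).
Proof.
move=> ur uvr; have [gu0 gud] := gP ur; have [guv0 guvd] := gP uvr.
apply: (@sup_estimate m (fun t => g (u + v) t - g u t)
  (fun t => (u + v) *m D (g (u + v) t) - u *m D (g u t))).
- by rewrite !mulr_ge0 // ltW.
- by rewrite gu0 guv0 subrr.
- move=> t t01 j; have [_ d1] := gud t t01; have [_ d2] := guvd t t01.
  have := is_deriveB (d2 j) (d1 j).
  have -> : ((u + v) *m D (g (u + v) t) - u *m D (g u t)) 0 j =
    ((u + v) *m D (g (u + v) t)) 0 j - (u *m D (g u t)) 0 j by rewrite !mxE.
  suff -> : (fun s => (g (u + v) s - g u s) 0 j) = (fun s => g (u + v) s 0 j) \- (fun s => g u s 0 j) by [].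
  by apply/funext => s; rewrite !mxE.
move=> t t01; have [b1 _] := gud t t01; have [b2 _] := guvd t t01.
set y := g (u + v) t in b2 *; set z := g u t in b1 *.
have -> : (u + v) *m D y - u *m D z = u *m (D y - D z) + v *m D y.
  by rewrite mulmxDl mulmxBr; apply/rowP => j; rewrite !mxE; ring.
apply: le_trans (ler_normD _ _) _; apply: lerD.
  apply/rV_normP => [|l]; first by rewrite mulr_ge0.
  rewrite mxE; apply: le_trans (norm_sum_le (K := rho * (C * `|y - z|)) _) _ => [i|].
    rewrite normrM !mxE; apply: ler_pM => //; first by apply: le_trans (rV_norm_coord _ _) (ltW ur).
    by have [_ _ h _ _] := tame i l; exact: h.
  by rewrite !mulrA ler_wpM2r // -mulrA.
apply/rV_normP => [|l]; first by rewrite !mulr_ge0 // ltW.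
rewrite mxE; apply: norm_sum_le => i; rewrite normrM; apply: ler_pM => //.
  exact: rV_norm_coord.
by have [_ h _ _ _] := tame i l; exact: h.
Qed.

(** The coefficient of |v|^2 in h': the first summand bounds the Taylor remainder of u D, the second
    bounds v (D(g_{u+v}) - D(g_u)), both by means of [flow_lipschitz]. *)
Definition flow_error_bound : R := k%:R * (rho * (C * (2 * (k%:R * C)) ^+ 2)) +
  k%:R * (C * (2 * (k%:R * C))).

(* Commutation is what makes the error h(t) = g_{u+v}(t) - g_u(t) - t v D(g_u(t)) satisfy
   h' = u (dD)h + O(|v|^2), so that it stays quadratically small. *)
Lemma flow_differential u v : `|u| < rho -> `|u + v| < rho ->
  `|g (u + v) 1 - g u 1 - v *m D (g u 1)| <= 2 * (flow_error_bound * `|v| ^+ 2).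
Proof.
move=> ur uvr; have [gu0 gud] := gP ur; have [guv0 guvd] := gP uvr.
pose P (i : 'I_k) (l q : 'I_m) t := 'D_(delta_mx 0 q) (fun y => D y i l) (g u t).
pose h t := g (u + v) t - g u t - t *: (v *m D (g u t)).
pose dh t : 'rV[R]_m := \row_l (((u + v) *m D (g (u + v) t)) 0 l - (u *m D (g u t)) 0 l -
   ((v *m D (g u t)) 0 l + t * \sum_i v 0 i * \sum_q (u *m D (g u t)) 0 q * P i l q t)).
have E0 : 0 <= flow_error_bound.
  by rewrite addr_ge0 // !mulr_ge0 // ?ltW // exprn_ge0.
have n1 : (0 : R) <= (1 : R) <= (1 : R) by rewrite lexx ler01.
suff main : forall t : R, 0 <= t <= 1 -> `|h t| <= 2 * (flow_error_bound * `|v| ^+ 2).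
  by have := main 1 n1; rewrite /h scale1r.
apply: (@sup_estimate m h dh).
- by rewrite mulr_ge0 // exprn_ge0.
- by rewrite /h gu0 guv0 subrr scale0r subr0.
- move=> t t01 j; have [b1 d1] := gud t t01; have [b2 d2] := guvd t t01.
  have hE : (fun s => h s 0 j) = (fun s => g (u + v) s 0 j - g u s 0 j - s * \sum_i v 0 i * D (g u s) i j).
    by apply/funext => s; rewrite !mxE.
  have dDi i : is_derive t (1 : R) (fun s => v 0 i * D (g u s) i j)
      (v 0 i * \sum_q (u *m D (g u t)) 0 q * P i j q t).
    have Ug : U (g u t) by have [h1 _ _ _ _] := tame i j; exact: h1.
    have := is_derive_comp_curve d1 (smooth_on_differentiable (sD i j) Ug).
    by move=> dd; apply: (is_derive_eq (is_deriveZ (v 0 i) dd)).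
  have dS := is_derive_sum_fun dDi.
  have dM := is_deriveM (is_derive_id t (1 : R)) dS.
  rewrite hE mxE; apply: (is_derive_eq (is_deriveB (is_deriveB (d2 j) (d1 j)) dM)).
  rewrite mxE; congr (_ - _); rewrite addrC; congr (_ + _).
  by rewrite [(v *m _) 0 j]mxE; exact: mulr1.
move=> t t01; have [b1 _] := gud t t01; have [b2 _] := guvd t t01.
have Ug (i : 'I_k) (l : 'I_m) : U (g u t) by have [h1 _ _ _ _] := tame i l; exact: h1.
have lip := flow_lipschitz ur uvr t01.
have dhE l : dh t 0 l =
   (\sum_i u 0 i * (D (g (u + v) t) i l - D (g u t) i l - \sum_q (g (u + v) t - g u t) 0 q * P i l q t)
    + \sum_i v 0 i * (D (g (u + v) t) i l - D (g u t) i l))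
   + \sum_i u 0 i * \sum_q h t 0 q * P i l q t.
  (* This is [u D, v D] = 0: the derivative of v D along u D equals the derivative of u D along v
     D. *)
  have key : \sum_i v 0 i * \sum_q (u *m D (g u t)) 0 q * P i l q t =
             \sum_i u 0 i * \sum_q (v *m D (g u t)) 0 q * P i l q t.
    have exch (a b : 'rV[R]_k) : \sum_i a 0 i * \sum_q (b *m D (g u t)) 0 q * P i l q t =
        \sum_i \sum_j a 0 i * b 0 j * \sum_q D (g u t) j q * P i l q t.
      apply: eq_bigr => i _; under [RHS]eq_bigr do rewrite -mulrA.
      rewrite -mulr_sumr; congr (_ * _).
      under [RHS]eq_bigr do rewrite mulr_sumr.
      rewrite exchange_big /=; apply: eq_bigr => q _; rewrite mxE mulr_suml.
      by apply: eq_bigr => j _; rewrite mulrA.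
    rewrite !exch exchange_big /=; apply: eq_bigr => i _; apply: eq_bigr => j _.
    by rewrite [v 0 j * _]mulrC; congr (_ * _); apply: comm; exact: Ug j l.
  have mE (a : 'rV[R]_k) y : (a *m D y) 0 l = \sum_i a 0 i * D y i l by rewrite mxE.
  have hP i : \sum_q h t 0 q * P i l q t = \sum_q (g (u + v) t - g u t) 0 q * P i l q t
      - t * \sum_q (v *m D (g u t)) 0 q * P i l q t.
    rewrite mulr_sumr -sumrB; apply: eq_bigr => q _.
    have sub3 (a b : 'rV[R]_m) : (a - t *: b) 0 q = a 0 q - t * b 0 q by rewrite !mxE.
    by rewrite /h sub3 mulrBl mulrA.
  under [X in _ = _ + X]eq_bigr do rewrite hP.
  rewrite [LHS]mxE key !mE mulr_sumr -sumrB -[X in _ - X]big_split -sumrB /= -!big_split /=.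
  apply: eq_bigr => i _; have -> : (u + v) 0 i = u 0 i + v 0 i by rewrite mxE.
  by move: (\sum_q _ * _) (\sum_q _ * _) => X Y; ring.
apply/rV_normP => [|l]; first by rewrite addr_ge0 // mulr_ge0 // exprn_ge0.
rewrite dhE addrC; apply: le_trans (ler_normD _ _) _; apply: lerD.
  apply: le_trans (norm_sum_le (K := rho * (m%:R * (`|h t| * C))) _) _ => [i|].
    rewrite normrM; apply: ler_pM => //; first by apply: le_trans (rV_norm_coord _ _) (ltW ur).
    apply: norm_sum_le => q; rewrite normrM; apply: ler_pM => //; first exact: rV_norm_coord.
    by have [_ _ _ _ h5] := tame i l; exact: h5.
  have -> : k%:R * (rho * (m%:R * (`|h t| * C))) = k%:R * (rho * (m%:R * C)) * `|h t| :> R by ring.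
  by rewrite ler_wpM2r.
apply: le_trans (ler_normD _ _) _; rewrite /flow_error_bound mulrDl; apply: lerD.
  apply: le_trans (norm_sum_le (K := rho * (C * (2 * (k%:R * (`|v| * C))) ^+ 2)) _) _ => [i|].
    rewrite normrM; apply: ler_pM => //; first by apply: le_trans (rV_norm_coord _ _) (ltW ur).
    have [_ _ _ h4 _] := tame i l; apply: le_trans (h4 _ _ b1 b2) _.
    apply: ler_wpM2l; first exact: ltW.
    by rewrite ler_pXn2r // ?nnegrE // !mulr_ge0 // ltW.
  by rewrite le_eqVlt; apply/orP; left; apply/eqP; ring.
apply: le_trans (norm_sum_le (K := `|v| * (C * (2 * (k%:R * (`|v| * C))))) _) _ => [i|].
  rewrite normrM; apply: ler_pM => //; first exact: rV_norm_coord.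
  have [_ _ h3 _ _] := tame i l; apply: le_trans (h3 _ _ b1 b2) _.
  by apply: ler_wpM2l => //; exact: ltW.
by rewrite le_eqVlt; apply/orP; left; apply/eqP; ring.
Qed.

Lemma flow_differentiable u : `|u| < rho ->
  differentiable (fun w => g w 1) u /\ forall v, 'd (fun w => g w 1) u v = v *m D (g u 1).
Proof.
move=> ur; pose L (v : 'rV[R]_k) : 'rV[R]_m := v *m D (g u 1).
have Llin : linear L by move=> a v w; rewrite /L mulmxDl -scalemxAl.
pose LL : {linear 'rV[R]_k -> 'rV[R]_m} := HB.pack L (GRing.isLinear.Build _ _ _ _ L Llin).
have E0 : 0 <= flow_error_bound.
  by rewrite addr_ge0 // !mulr_ge0 // ?ltW // exprn_ge0.
have [|eps eps0|d dE] := @differentiable_crit _ _ (fun w => g w 1) u LL.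
- move=> v; apply: (@coord_cvg_rV _ _ (nbhs v)) => l.
  rewrite [X in _ --> X]mxE (_ : (fun w => LL w 0 l) = (fun w => \sum_i w 0 i * D (g u 1) i l)); last first.
    by apply/funext => w; rewrite mxE.
  have : Ck_on 0 [set: 'rV[R]_k] (fun w => \sum_i w 0 i * D (g u 1) i l).
    apply: Ck_on_sum => [|i]; first exact: openT.
    apply: Ck_onM; [exact: openT|exact: Ck_on_coord|exact: Ck_on_cst].
  by move=> /(_ v I).
- have K0 : 0 < 2 * flow_error_bound + 1 by rewrite ltr_wpDl // mulr_ge0.
  (* The first radius keeps u + v in the domain, the second turns the quadratic error into eps
     |v|. *)
  apply/nbhs_rVP; exists (Num.min (rho - `|u|) (eps / (2 * flow_error_bound + 1))).
    by rewrite lt_min subr_gt0 ur divr_gt0.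
  move=> v; rewrite subr0 lt_min => /andP[v1 v2].
  rewrite [v + u]addrC; apply: le_trans (flow_differential ur _) _.
    by apply: le_lt_trans (ler_normD _ _) _; rewrite addrC -ltrBrDr.
  rewrite mulrA expr2 mulrA ler_wpM2r //; move: v2; rewrite ltr_pdivlMr // => v2.
  apply: le_trans (ltW v2); rewrite mulrC ler_wpM2l //.
  by rewrite lerDl.
- by split=> // v; rewrite dE.
Qed.

(** Bootstrap: the partials of u |-> g u 1 are the rows of D at g u 1, so if the map is C^K its
    partials are C^K as well, by composition with the smooth D. *)
Lemma flow_smooth : smooth_map_on [set u | `|u| < rho] (fun u => g u 1).
Proof.
have Wo : open [set u : 'rV[R]_k | `|u| < rho].
  have -> : [set u : 'rV[R]_k | `|u| < rho] = ball 0 rho.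
    by apply/seteqP; split=> u; rewrite -ball_normE /ball_ /= sub0r normrN.
  exact: ball_open.
have n1 : (0 : R) <= (1 : R) <= (1 : R) by rewrite lexx ler01.
have gU (i : 'I_k) u : `|u| < rho -> forall l : 'I_m, U (g u 1).
  by move=> ur l; have [h _ _ _ _] := tame i l; apply: h; have [_ /(_ 1 n1)[]] := gP ur.
move=> j K; elim: K j => [|K IH] j.
  move=> u /= ur; apply: differentiable_continuous; apply: differentiable_rV_coord.
  by have [] := flow_differentiable ur.
split=> [u /= ur|i].
  by apply: differentiable_rV_coord; have [] := flow_differentiable ur.
apply: (@eq_Ck_on _ _ _ (fun u => D (g u 1) i j)) => // [u /= ur|].
  have [d dE] := flow_differentiable ur.
  by rewrite -(derive_rV_coord _ _ d) deriveE // dE -rowE mxE.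
apply: (@Ck_on_comp K _ _ _ U (fun u => g u 1) (fun y => D y i j)) => //.
- by move=> u ur; exact: gU i u ur j.
- exact: sD.
Qed.

End CommutingFrame.

Lemma commuting_frame_integral k m (U : set 'rV[R]_m) (D : 'rV[R]_m -> 'M[R]_(k, m))
    (N : 'M[R]_(m, k)) (x0 : 'rV[R]_m) :
  open U -> U x0 -> smooth_mx U D -> (forall x, U x -> D x *m N = 1%:M) ->
  (forall x, U x -> forall i j l,
    \sum_q D x i q * 'D_(delta_mx 0 q) (fun y => D y j l) x =
    \sum_q D x j q * 'D_(delta_mx 0 q) (fun y => D y i l) x) ->
  exists (W : set 'rV[R]_k) (sigma : 'rV[R]_k -> 'rV[R]_m),
    [/\ open W, W 0 & sigma 0 = x0] /\
    [/\ forall w, W w -> U (sigma w), forall w w', W w -> W w' -> sigma w = sigma w' -> w = w',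
        smooth_map_on W sigma & forall w, W w -> 'J sigma w = D (sigma w)].
Proof.
move=> oU Ux0 sD DN comm.
have [e1 e10 eU] := (nbhs_rVP _ _).1 (open_nbhs_nbhs (conj oU Ux0)).
have [||e2 [C [e20 C0 tame2]]] := @common_radius ('I_k * 'I_m)%type
    (fun il e C => tame_on U x0 (fun y => D y il.1 il.2) e C).
- by move=> il e C e' C' h e'0 ee CC; exact: tame_on_mono h e'0 ee CC.
- by move=> il; exact: smooth_on_tame.
pose e := Num.min e1 e2.
have e0 : 0 < e by rewrite lt_min e10.
have tame i l : tame_on U x0 (fun y => D y i l) e C.
  by apply: tame_on_mono (tame2 (i, l)) e0 _ (lexx _); rewrite ge_min lexx orbT.
(* K dominates the factors of rho in all three smallness conditions; the + 1 makes it invertible. *)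
pose K : R := k%:R * C + k%:R * (m%:R * C) + 1.
have K0 : 0 < K by rewrite ltr_wpDl // addr_ge0 // !mulr_ge0 // ltW.
pose rho := Num.min (e / 2) 2^-1 / K.
have rho0 : 0 < rho by rewrite divr_gt0 // lt_min divr_gt0 //= invr_gt0.
have rhoK : rho * K <= e / 2 /\ rho * K <= 2^-1.
  by rewrite divfK ?gt_eqF // !ge_min !lexx orbT.
have kC0 : 0 <= k%:R * C by rewrite mulr_ge0 // ltW.
have kmC0 : 0 <= k%:R * (m%:R * C) by rewrite !mulr_ge0 // ltW.
have kC : k%:R * (rho * C) <= rho * K.
  by rewrite mulrCA ler_wpM2l ?(ltW rho0) // /K -addrA lerDl addr_ge0.
have kmC : k%:R * (rho * (m%:R * C)) <= rho * K.
  by rewrite mulrCA ler_wpM2l ?(ltW rho0) // /K addrAC lerDr addr_ge0.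
have rho1 := le_trans kC rhoK.1; have rho3 := le_trans kC rhoK.2; have rho2 := le_trans kmC rhoK.2.
have ex (u : 'rV[R]_k) : exists g : R -> 'rV[R]_m, `|u| < rho -> g 0 = x0 /\
  forall t : R, 0 <= t <= 1 -> `|g t - x0| < e /\
    forall j, is_derive t (1 : R) (fun s => g s 0 j) ((u *m D (g t)) 0 j).
  have [/(frame_flow e0 tame rho1 rho3)[g gP]|nu] := pselect (`|u| < rho); first by exists g.
  by exists (fun=> x0).
have /choice[g gP] := ex.
have n1 : (0 : R) <= (1 : R) <= (1 : R) by rewrite lexx ler01.
have gU u : `|u| < rho -> U (g u 1).
  move=> /gP[_ /(_ 1 n1)[h _]]; apply: eU; apply: lt_le_trans h _.
  by rewrite ge_min lexx.
have z0 (t : R) : 0 <= t <= 1 -> `|0 : R| <= 0 by rewrite normr0.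
(* Along the flow (g N)' = u D N = u, so N reads off the parameter u from the endpoint. This is the
   source of injectivity. *)
have gN u : `|u| < rho -> g u 1 *m N = x0 *m N + u.
  move=> ur; have [g0 gd] := gP u ur; apply/rowP => j.
  pose f (t : R) := \sum_l g u t 0 l * N l j - t * u 0 j.
  have fd (t : R) : 0 <= t <= 1 -> is_derive t (1 : R) f 0.
    move=> t01; have [tb td] := gd t t01.
    have Ut : U (g u t) by apply: eU; apply: lt_le_trans tb _; rewrite ge_min lexx.
    have d1 l : is_derive t (1 : R) (fun s => g u s 0 l * N l j) ((u *m D (g u t)) 0 l * N l j).
      have := is_deriveZ (N l j) (td l).
      rewrite [(u *m _) 0 l * _]mulrC.
      by have -> : (fun s => g u s 0 l * N l j) = N l j \*: (fun s => g u s 0 l)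
        by apply/funext => s; rewrite mulrC.
    have d2 := is_derive_sum_fun d1.
    have d3 := is_deriveZ (u 0 j) (is_derive_id t (1 : R)).
    have := is_deriveB d2 d3.
    have -> : (fun s => \sum_i g u s 0 i * N i j) - u 0 j \*: id = f.
      by apply/funext => s; rewrite /f /= [s * _]mulrC.
    suff -> : \sum_i (u *m D (g u t)) 0 i * N i j - u 0 j *: (1 : R) = 0 by [].
    have := DN _ Ut => /(congr1 (mulmx u)); rewrite mulmxA mulmx1 => /rowP/(_ j).
    rewrite mxE => ->; rewrite /GRing.scale /= mulr1 subrr //.
  have o01 : (0 : R) <= (0 : R) <= (1 : R) by rewrite lexx /=.
  have := mean_value_le (K := 0) fd z0 o01 n1; rewrite mul0r normr_le0 subr_eq0 /f.
  by rewrite mul1r mul0r subr0 g0 subr_eq => /eqP H; rewrite !mxE H.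
have W0 : `|0 : 'rV[R]_k| < rho by rewrite normr0.
exists [set u | `|u| < rho], (fun u => g u 1); split; split.
- have -> : [set u : 'rV[R]_k | `|u| < rho] = ball 0 rho.
    by apply/seteqP; split=> u; rewrite -ball_normE /ball_ /= sub0r normrN.
  exact: ball_open.
- exact: W0.
- have [g0 gd] := gP 0 W0; apply/rowP => j; rewrite -[in RHS]g0.
  have o01 : (0 : R) <= (0 : R) <= (1 : R) by rewrite lexx /=.
  have gdj (t : R) : 0 <= t <= 1 -> is_derive t (1 : R) (fun s => g 0 s 0 j) 0.
    by move=> t01; have [_ /(_ j)] := gd t t01; rewrite mul0mx mxE.
  by have := mean_value_le (K := 0) gdj z0 o01 n1; rewrite mul0r normr_le0 subr_eq0 => /eqP.
- exact: gU.
- by move=> w w' /= Ww Ww' /(congr1 (mulmx^~ N)); rewrite !gN // => /addrI.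
- exact: (flow_smooth sD comm C0 rho0 tame rho2 rho3 gP).
- move=> w /= Ww; have [d dE] := flow_differentiable sD comm C0 rho0 tame rho2 rho3 gP Ww.
  by apply/row_matrixP => i; rewrite !rowE -deriveEjacobian // deriveE // dE.
Qed.

End CommutingFields.

(** * Bump functions *)

Section BumpFunctions.

(* flat 0 is the classical exp(-1/t); the powers of 1/t make the family stable under
   differentiation. *)
Definition flat (a : nat) (t : R) : R := if 0 < t then t^-1 ^+ a * expR (- t^-1) else 0.

Lemma flat_ge0 a t : 0 <= flat a t.
Proof. by rewrite /flat; case: ifP => // t0; rewrite mulr_ge0 ?expR_ge0 // exprn_ge0 // invr_ge0 ltW. Qed.

Lemma flat_gt0 a t : 0 < t -> 0 < flat a t.
Proof. by move=> t0; rewrite /flat t0 mulr_gt0 ?expR_gt0 // exprn_gt0 // invr_gt0. Qed.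

Lemma flat_le0 a t : t <= 0 -> flat a t = 0.
Proof. by move=> t0; rewrite /flat ltNge t0. Qed.

(** The exponential at 1/t dominates its term of degree a + 2. The two spare powers of t give
    [flat a] the derivative 0 at the origin. *)
Lemma flat_bound a t : flat a t <= (a.+2)`!%:R * t ^+ 2.
Proof.
rewrite /flat; case: ifP => [t0|_]; last by rewrite mulr_ge0 // sqr_ge0.
have x0 : 0 <= t^-1 by rewrite invr_ge0 ltW.
have := expR_ge1Dxn a.+1 x0; move=> h.
have {}h : t^-1 ^+ a.+2 <= (a.+2)`!%:R * expR t^-1.
  rewrite -ler_pdivrMl ?ltr0n ?fact_gt0 // mulrC; apply: le_trans h.
  by rewrite lerDr.
rewrite expRN ler_pdivrMr ?expR_gt0 // mulrAC.
have -> : t^-1 ^+ a = t^-1 ^+ a.+2 * t ^+ 2.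
  by rewrite -addn2 exprD -mulrA -exprMn mulVf ?expr1n ?mulr1 // gt_eqF.
by rewrite ler_wpM2r // sqr_ge0.
Qed.

Lemma is_derive_flat a t : is_derive t (1 : R) (flat a) (flat a.+2 t - a%:R * flat a.+1 t).
Proof.
have [t0|t0|->] := ltgtP t 0.
- rewrite !flat_le0 ?(ltW t0) // mulr0 subr0.
  apply: (@near_eq_is_derive R R R (cst 0) (flat a)).
  by near=> s; rewrite flat_le0 //; near: s; exact: lt_le_nbhsl.
- apply: (@near_eq_is_derive R R R (fun s => s^-1 ^+ a * expR (- s^-1)) (flat a)).
    near=> s; rewrite /flat ifT //; near: s; exact: lt_nbhsr.
  have t0' : t != 0 by rewrite gt_eqF.
  have dV : is_derive t (1 : R) (fun s : R => s^-1) (- t ^- 2).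
    by apply: (is_derive_eq (is_deriveV (f := id) t0' (is_derive_id t (1 : R)))); rewrite scaler1.
  have dX : is_derive t (1 : R) (fun s : R => s^-1 ^+ a) (a%:R * t^-1 ^+ a.-1 * - t ^- 2).
    have := is_deriveX (f := fun s : R => s^-1) a dV.
    have -> // : ((fun s : R => s^-1) ^+ a : R -> R) = (fun s => s^-1 ^+ a).
    by elim: a => [|a IH]; apply/funext => s; rewrite ?expr0 // !exprS IH.
  have dE : is_derive t (1 : R) (fun s : R => expR (- s^-1)) (t ^- 2 * expR (- t^-1)).
    have dN : is_derive t (1 : R) (fun s : R => - s^-1) (t ^- 2) by have := is_deriveN dV; rewrite opprK.
    have := @is_derive1_comp R expR (fun s : R => - s^-1) t _ _ (is_derive_expR _) dN.
    by rewrite mulrC.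
  apply: (is_derive_eq (is_deriveM dX dE)).
  rewrite /flat t0 /GRing.scale /=.
  by rewrite -exprVn; case: a {dX} => [|a] /=; rewrite ?mul0r ?exprS ?expr0; ring.
- have [|e e0|d dE] := @differentiable_crit R^o R^o (flat a) 0 (\0 : {linear R^o -> R^o}).
  + by move=> x; exact: cst_continuous.
  + have K0 : 0 < (a.+2)`!%:R :> R by rewrite ltr0n fact_gt0.
    apply/nbhs_ballP; exists (e / (a.+2)`!%:R) => [|h]; first exact: divr_gt0.
    rewrite /ball /= sub0r normrN ltr_pdivlMr // => he.
    rewrite addr0 [flat a 0]flat_le0 // !subr0 ger0_norm ?flat_ge0 //.
    apply: le_trans (flat_bound a h) _; rewrite -real_normK ?num_real // expr2 mulrA.
    by rewrite ler_wpM2r // mulrC ltW.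
  + split; first by apply: diff_derivable.
    by rewrite deriveE // dE !flat_le0 // mulr0 subr0.
Unshelve. all: by end_near. Qed.

(** Induction on k for all a together, since differentiating [flat a] brings in [flat a.+1] and
    [flat a.+2]. *)
Lemma Ck_on_flat m k (U : set 'rV[R]_m) (f : 'rV[R]_m -> R) a : open U -> smooth_on U f ->
  Ck_on k U (fun x => flat a (f x)).
Proof.
move=> oU sf; have df b x : U x -> differentiable (fun x => flat b (f x)) x.
  move=> Ux; apply: (@differentiable_comp R 'rV[R]_m R^o R^o f (flat b)).
    exact: smooth_on_differentiable sf Ux.
  by have [d _] := is_derive_flat b (f x); exact/derivable1_diffP.
elim: k a => [|k IH] a; first by move=> x Ux; apply: differentiable_continuous; exact: df.
split=> [x Ux|j]; first exact: df.
have sj := smooth_on_partial j sf.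
have := Ck_onM oU (Ck_onD oU (IH a.+2) (Ck_onM oU (Ck_on_cst k U (- a%:R)) (IH a.+1))) (sj k).
apply: eq_Ck_on => // x Ux; have dfx := smooth_on_differentiable sf Ux.
have [dd dE] := is_derive_flat a (f x); have dfl : differentiable (flat a : R^o -> R^o) (f x) by exact/derivable1_diffP.
rewrite [RHS]deriveE; last exact: df.
rewrite (@diff_comp R 'rV[R]_m R^o R^o f (flat a)) //= deriv1E // -deriveE //.
by rewrite /GRing.scale /= derive1E dE /cst mulNr mulrC.
Qed.

Lemma smooth_on_flat m (U : set 'rV[R]_m) (f : 'rV[R]_m -> R) a : open U -> smooth_on U f ->
  smooth_on U (fun x => flat a (f x)).
Proof. by move=> oU sf k; exact: Ck_on_flat. Qed.

Definition smooth_step (t : R) := flat 0 t / (flat 0 t + flat 0 (1 - t)).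

Lemma smooth_step_den t : flat 0 t + flat 0 (1 - t) != 0.
Proof.
rewrite gt_eqF //; have [t0|t0] := ltP 0 t.
  by apply: ltr_pwDl; [exact: flat_gt0|exact: flat_ge0].
by apply: ltr_wpDl; [exact: flat_ge0|apply: flat_gt0; rewrite subr_gt0 (le_lt_trans t0)].
Qed.

Lemma smooth_step1 t : 1 <= t -> smooth_step t = 1.
Proof.
move=> t1; have := smooth_step_den t; rewrite /smooth_step.
by rewrite (@flat_le0 _ (1 - t)) ?subr_le0 // addr0 => h; rewrite divff.
Qed.

Lemma smooth_step0 t : t <= 0 -> smooth_step t = 0.
Proof. by move=> t0; rewrite /smooth_step flat_le0 // mul0r. Qed.

Lemma smooth_on_step m (U : set 'rV[R]_m) (f : 'rV[R]_m -> R) : open U -> smooth_on U f ->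
  smooth_on U (fun x => smooth_step (f x)).
Proof.
move=> oU sf; have s1 := smooth_on_flat 0 oU sf.
have s2 : smooth_on U (fun x => flat 0 (1 - f x)).
  apply: smooth_on_flat => //; apply: smooth_onD => //; first exact: smooth_on_cst.
  have := smooth_onM oU (smooth_on_cst U (-1)) sf.
  by apply: eq_smooth_on => // x _; rewrite mulN1r.
apply: smooth_onM => //; apply: smooth_onV => //; last exact: smooth_onD.
by move=> x _; exact: smooth_step_den.
Qed.

Lemma exists_bump m (x0 : 'rV[R]_m) (e : R) : 0 < e -> exists rho : 'rV[R]_m -> R,
  [/\ smooth_on [set: 'rV[R]_m] rho, forall y, `|y - x0| <= e -> rho y = 1 &
      forall y, 2 * e < `|y - x0| -> rho y = 0].
Proof.
move=> e0; pose t (y : 'rV[R]_m) j := e^-1 * (y 0 j - x0 0 j).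
(* A product over coordinates, since balls of the sup norm are cubes. The factor at j is 1 when |t y
   j| <= 1 and 0 when |t y j| >= 2. *)
pose rho y := \prod_j (smooth_step (2 - t y j) * smooth_step (2 + t y j)).
have tE (y : 'rV[R]_m) j : `|t y j| = e^-1 * `|(y - x0) 0 j|.
  by rewrite normrM gtr0_norm ?invr_gt0 // !mxE.
exists rho; split.
- have oT : open [set: 'rV[R]_m] by exact: openT.
  have st (c : R) j : smooth_on [set: 'rV[R]_m] (fun y => 2 + c * t y j).
    apply: smooth_onD => //; first exact: smooth_on_cst.
    apply: smooth_onM => //; first exact: smooth_on_cst.
    apply: smooth_onM => //; first exact: smooth_on_cst.
    apply: smooth_onD => //; last exact: smooth_on_cst.
    by move=> k; exact: Ck_on_coord.
  apply: smooth_on_prod => // j _; apply: smooth_onM => //; apply: smooth_on_step => //.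
    by apply: eq_smooth_on (st (-1) j) => // x _; rewrite mulN1r.
  by apply: eq_smooth_on (st 1 j) => // x _; rewrite mul1r.
- move=> y ye; apply: big1 => j _.
  have : `|t y j| <= 1.
    by rewrite tE ler_pdivrMl // mulr1; apply: le_trans (rV_norm_coord _ _) ye.
  by rewrite ler_norml => /andP[h1 h2]; rewrite !smooth_step1 ?mulr1 //; lra.
move=> y ye.
have [j yj] : exists j, 2 < `|t y j|.
  apply/existsP; apply: contraTT ye => /existsPn h; rewrite -leNgt.
  apply/rV_normP => [|j]; first by rewrite mulr_ge0 // ltW.
  by have := h j; rewrite -leNgt tE ler_pdivrMl // mulrC.
rewrite /rho (bigD1 j) //= [X in X * _](_ : _ = 0) ?mul0r //.
have [t0|t0] := ltP 0 (t y j).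
  by rewrite smooth_step0 ?mul0r //; rewrite gtr0_norm // in yj; lra.
by rewrite [X in _ * X]smooth_step0 ?mulr0 //; rewrite ler0_norm // in yj; lra.
Qed.

End BumpFunctions.

End Calculus.

(** * Linear algebra of a lagrangian fibre *)

Section SpacesAndMatrices.
Variable K : fieldType.

Lemma mem_span_enum (V : vectType K) k (X : 'I_k -> V) (v : V) :
  (v \in <<[seq X l | l <- enum 'I_k]>>%VS) <-> exists c : 'rV[K]_k, v = \sum_l c 0 l *: X l.
Proof.
have -> : (<<[seq X l | l <- enum 'I_k]>> = \sum_(l < k) <[X l]>)%VS.
  by rewrite span_def big_map big_enum.
split=> [/memv_sumP[vs vsX ->]|[c ->]].
  have /choice[c cE] : forall l : 'I_k, exists a, vs l = a *: X l.
    by move=> l; have /vlineP[a ->] := vsX l isT; exists a.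
  by exists (\row_l c l); apply: eq_bigr => l _; rewrite mxE cE.
by apply: memv_sumr => l _; rewrite memvZ // memv_line.
Qed.

Lemma sum_rows k m (c : 'rV[K]_k) (A : 'M[K]_(k, m)) : \sum_l c 0 l *: row l A = c *m A.
Proof. by rewrite mulmx_sum_row. Qed.

Lemma exists_basis_matrix m (V : {vspace 'rV[K]_m}) : exists A : 'M[K]_(\dim V, m),
  row_free A /\ forall v, (v \in V) = (v <= A)%MS.
Proof.
pose A := \matrix_l (vbasis V)`_l : 'M[K]_(\dim V, m).
have rA l : row l A = (vbasis V)`_l by rewrite rowK.
exists A; split.
  apply: inj_row_free => c; rewrite -sum_rows => cA.
  have /freeP/(_ (fun l => c 0 l)) := basis_free (vbasisP V).
  move=> h; apply/rowP => l; rewrite mxE; apply: h.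
  by rewrite -[RHS]cA; apply: eq_bigr => i _; rewrite rA.
move=> v; apply/idP/idP => [/coord_vbasis ->|/submxP[c ->]].
  apply: summx_sub => l _; rewrite scalemx_sub // -rA row_sub //.
rewrite -sum_rows memv_suml // => l _; rewrite memvZ // rA vbasis_mem //.
by rewrite mem_nth // size_tuple.
Qed.

Lemma dim_rank m k (V : {vspace 'rV[K]_m}) (A : 'M[K]_(k, m)) :
  (forall v, (v \in V) = (v <= A)%MS) -> \dim V = \rank A.
Proof.
move=> VA; have [B [/eqP fB VB]] := exists_basis_matrix V; rewrite -fB.
have : (A == B)%MS.
  by apply/andP; split; apply/rV_subP => v; rewrite -?VA -?VB.
by move/eqmxP => ->.
Qed.

Lemma basis_of_rows m k (V : {vspace 'rV[K]_m}) (A : 'M[K]_(k, m)) : row_free A ->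
  (forall v, (v \in V) = (v <= A)%MS) -> basis_of V [seq row l A | l <- enum 'I_k].
Proof.
move=> /eqP fA VA; rewrite basisEdim size_map size_enum_ord (dim_rank VA) fA leqnn andbT.
apply/subvP => v; rewrite VA => /submxP[c ->].
by apply/mem_span_enum; exists c; rewrite sum_rows.
Qed.

Lemma dim_cap_ker (V W1 W2 : vectType K) (f1 : 'Hom(V, W1)) (f2 : 'Hom(V, W2)) (U : {vspace V}) :
  (forall u, u \in U -> f1 u = 0 -> f2 u = 0 -> u = 0) ->
  \dim (f2 @: (U :&: lker f1)) = \dim (U :&: lker f1).
Proof.
move=> inj; apply: limg_dim_eq; apply/eqP; rewrite -subv0; apply/subvP => u.
rewrite !memv_cap !memv_ker memv0 => /andP[/andP[uU /eqP u1] /eqP u2].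
by rewrite (inj u).
Qed.

Lemma mem_img_cap_ker (V W1 W2 : vectType K) (f1 : 'Hom(V, W1)) (f2 : 'Hom(V, W2))
    (U : {vspace V}) w :
  w \in (f2 @: (U :&: lker f1))%VS -> exists u, [/\ u \in U, f1 u = 0 & w = f2 u].
Proof.
move=> /memv_imgP[u]; rewrite memv_cap memv_ker => /andP[uU /eqP u1] ->.
by exists u.
Qed.

End SpacesAndMatrices.

(** dK and dP are the dimensions of the kernel and the image of the projection of L \cap Lbar, and
    dI that of E \cap Ebar. Adding the bounds gives r <= m - (dD - dDelta), while m = 2n + r; even
    an odd difference dD - dDelta would contradict this. *)
Lemma type_count (m n r dD dDelta dK dP dI : nat) : m = (2 * n + r)%N -> (dD <= m)%N ->
  (dK + dP = r)%N -> (dK <= m - dD)%N -> (dP <= dI)%N -> dDelta = dI -> (dDelta <= dD)%N ->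
  (dD - dDelta)./2 = n -> dD = (dDelta + (n + n))%N /\ (dI <= dP)%N.
Proof. by move=> *; lia. Qed.

Lemma half_count (a b c n : nat) : (a + b = c.*2)%N -> a = (b + (n + n))%N -> c = (b + n)%N.
Proof. by move=> *; lia. Qed.

Section PointwiseDirac.
Variables (R : realType) (m : nat).
Local Notation C := R[i].
Local Notation rvec := 'rV[R]_m.
Local Notation cvec := 'rV[C]_m.

Definition cbar (W : {vspace cvec}) := conj_space (@conj_mx R 1 m) W.

Lemma conj_mxD a b (A B : 'M[C]_(a, b)) : conj_mx (A + B) = conj_mx A + conj_mx B.
Proof. exact: map_mxD. Qed.

Lemma conj_mxZ a b (c : C) (A : 'M[C]_(a, b)) : conj_mx (c *: A) = conjc c *: conj_mx A.
Proof. exact: map_mxZ. Qed.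

Lemma conj_mxN a b (A : 'M[C]_(a, b)) : conj_mx (- A) = - conj_mx A.
Proof. exact: map_mxN. Qed.

Lemma mem_cbar (W : {vspace cvec}) v : (v \in cbar W) = (conj_mx v \in W).
Proof.
by apply: mem_conj_space; [exact: conj_mxD|exact: conj_mxZ|exact: conj_mxK].
Qed.

Lemma conj_gtanD : {morph @conj_gtan R m : x y / x + y}.
Proof. by move=> x y; rewrite /conj_gtan !conj_mxD. Qed.

Lemma mem_conj_gtan (W : {vspace gtan R m}) v :
  (v \in conj_space (@conj_gtan R m) W) = (conj_gtan v \in W).
Proof.
apply: mem_conj_space; first exact: conj_gtanD.
- by move=> a x; exact: (congr2 pair (conj_mxZ a x.1) (conj_mxZ a x.2)).
- by move=> [x y]; rewrite /conj_gtan !conj_mxK.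
Qed.

Lemma half_sum_cmx a b (v : 'M[C]_(a, b)) : cmx (re_mx v) = 2^-1 *: (v + conj_mx v).
Proof.
rewrite -cmx_2re; have -> : re_mx v *+ 2 = (2 : R) *: re_mx v by rewrite scaler_nat.
rewrite cmxZ scalerA; have -> : (2 : R)%:C%C = 2 :> C by rewrite rmorph_nat.
by rewrite mulVf ?scale1r // pnatr_eq0.
Qed.

Lemma half_diff_cmx a b (v : 'M[C]_(a, b)) : cmx (im_mx v) = 2^-1 *: (- 'i%C *: v + conj_mx (- 'i%C *: v)).
Proof.
rewrite -half_sum_cmx; congr cmx; apply/matrixP => i j; rewrite !mxE.
by case: (v i j) => x y /=; ring.
Qed.

Lemma memv_reim (W : {vspace cvec}) v : (forall u, u \in W -> conj_mx u \in W) ->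
  v \in W -> cmx (re_mx v) \in W /\ cmx (im_mx v) \in W.
Proof.
move=> Wc vW; rewrite half_sum_cmx half_diff_cmx; split; apply: memvZ; apply: memvD => //.
- exact: Wc.
- exact: memvZ.
- by apply: Wc; exact: memvZ.
Qed.

(** A conjugation-invariant W is spanned over C by its real vectors, so a real basis of its real
    part is a complex basis of W. *)
Lemma dim_real_part (W : {vspace cvec}) : (forall u, u \in W -> conj_mx u \in W) ->
  \dim (real_part W) = \dim W.
Proof.
move=> Wc; have [A [/eqP fA VA]] := exists_basis_matrix (real_part W).
rewrite (@dim_rank _ _ _ W (cmx A)) ?mxrank_map ?fA // => v.
apply/idP/idP => [/(memv_reim Wc)[h1 h2]|/submxP[c ->]].
  rewrite [v]complex_mxE addmx_sub // ?scalemx_sub //.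
    by rewrite map_submx -VA mem_real_part.
  by rewrite map_submx -VA mem_real_part.
rewrite -sum_rows memv_suml // => l _; rewrite memvZ //.
have -> : row l (cmx A) = cmx (row l A) by rewrite /cmx map_row.
by rewrite -mem_real_part VA row_sub.
Qed.

Lemma dim_real_partS (W W' : {vspace cvec}) : (W <= W')%VS ->
  (\dim (real_part W) <= \dim (real_part W'))%N.
Proof.
move=> /subvP h.
have sub : (real_part W <= real_part W')%VS.
  apply/subvP => v vW.
  apply: (etrans (mem_real_part W' v)); apply: h.
  exact: (etrans (esym (mem_real_part W v)) vW).
exact: (dimvS sub).
Qed.

Variables (L : {vspace gtan R m}).
Hypothesis lag : lagrangian L.
Let E := tangent_part L.
Let Eb := cbar E.
Let D := real_part (E + Eb)%VS.
Let Delta := real_part (E :&: Eb)%VS.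
Let LL := (L :&: conj_space (@conj_gtan R m) L)%VS.

Lemma lagrangian_pair X xi Y eta : (X, xi) \in L -> (Y, eta) \in L ->
  (eta *m X^T) 0 0 + (xi *m Y^T) 0 0 = 0.
Proof.
move=> h1 h2; have /(_ (Y, eta) h2)/eqP := (lag (X, xi)).1 h1.
by rewrite /pairing mulf_eq0 invr_eq0 pnatr_eq0 /= => /eqP.
Qed.

Lemma lagrangian_mem X xi : (forall Y eta, (Y, eta) \in L ->
  (eta *m X^T) 0 0 + (xi *m Y^T) 0 0 = 0) -> (X, xi) \in L.
Proof.
by move=> h; apply/lag => -[Y eta] /h; rewrite /pairing /= => ->; rewrite mulr0.
Qed.

Lemma lagrangian_ann xi Y : (0, xi) \in L -> Y \in E -> (xi *m Y^T) 0 0 = 0.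
Proof.
move=> h /mem_tangent_part[eta Yeta]; have := lagrangian_pair h Yeta.
by rewrite trmx0 mulmx0 mxE add0r.
Qed.

Lemma E_Eb_conj : (forall u, u \in (E + Eb)%VS -> conj_mx u \in (E + Eb)%VS) /\
  (forall u, u \in (E :&: Eb)%VS -> conj_mx u \in (E :&: Eb)%VS).
Proof.
split=> u; last by rewrite !memv_cap !mem_cbar conj_mxK andbC.
move=> /memv_addP[x xE [y yE ->]]; rewrite conj_mxD addrC memv_add //.
  by rewrite -mem_cbar.
by rewrite mem_cbar conj_mxK.
Qed.

Lemma dim_Ebar : \dim Eb = \dim E.
Proof.
have [A [/eqP fA VA]] := exists_basis_matrix E.
rewrite (@dim_rank _ _ _ Eb (conj_mx A)) ?mxrank_map ?fA // => v.
by rewrite mem_cbar VA -(map_submx (conjc : {rmorphism C -> C})) -!/(conj_mx _) conj_mxK.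
Qed.

(** Modular dimension formula for E and Ebar. It makes dim D - dim Delta even and, with the type,
    determines dim E. *)
Lemma dim_E2 : (\dim D + \dim Delta = (\dim E).*2)%N.
Proof.
have [h1 h2] := E_Eb_conj.
have e1 := dim_real_part h1.
have e2 := dim_real_part h2.
have e3 := dimv_sum_cap E Eb.
apply: (etrans (congr2 addn e1 e2)); apply: (etrans e3).
by rewrite -addnn; congr addn; exact: dim_Ebar.
Qed.

Let pr1 : 'Hom(gtan R m, cvec) := linfun (fun u : gtan R m => u.1).
Let pr2 : 'Hom(gtan R m, cvec) := linfun (fun u : gtan R m => u.2).

Lemma pr1E u : pr1 u = u.1. Proof. by rewrite /pr1 linfunE. Qed.
Lemma pr2E u : pr2 u = u.2. Proof. by rewrite /pr2 linfunE. Qed.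

Lemma memLLP u : u \in LL -> u \in L /\ conj_gtan u \in L.
Proof. by move=> h; apply/andP; rewrite -mem_conj_gtan -memv_cap. Qed.

(** If (0, xi) and its conjugate lie in L, then xi annihilates both E and Ebar; so the kernel embeds
    in the annihilator of E + Ebar. *)
Lemma dim_ker_LL : (\dim (LL :&: lker pr1) <= m - \dim D)%N.
Proof.
have [A [/eqP fA VA]] := exists_basis_matrix (E + Eb)%VS.
have [h1 _] := E_Eb_conj.
have dDA : \dim D = \rank A := etrans (dim_real_part h1) (esym fA).
have e2 : \dim (pr2 @: (LL :&: lker pr1)) = \dim (LL :&: lker pr1).
  apply: dim_cap_ker => -[X xi] _; rewrite pr1E pr2E /= => -> -> //.
apply: (leq_trans (eq_leq (esym e2))); rewrite dDA.
have [B [/eqP fB VB]] := exists_basis_matrix (pr2 @: (LL :&: lker pr1))%VS.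
have mk : \rank (kermx A^T) = (m - \rank A)%N by rewrite mxrank_ker mxrank_tr.
apply: (leq_trans (eq_leq (esym fB))); apply: (leq_trans _ (eq_leq mk)).
apply: mxrankS; apply/row_subP => l.
have /mem_img_cap_ker[[X xi] []] : row l B \in (pr2 @: (LL :&: lker pr1))%VS by rewrite VB row_sub.
rewrite pr1E pr2E /= => /memLLP[h3 h4] X0 ->; rewrite X0 in h3 h4; apply/sub_kermxP.
rewrite /conj_gtan /= in h4.
have {}h4 : (0, conj_mx xi) \in L by rewrite -(_ : conj_mx 0 = 0) //; exact: map_mx0.
have xiE Y : Y \in (E + Eb)%VS -> (xi *m Y^T) 0 0 = 0.
  move=> /memv_addP[x xE [y yE ->]]; rewrite raddfD mulmxDr mxE.
  rewrite (lagrangian_ann h3 xE) add0r; rewrite mem_cbar in yE.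
  have : (conj_mx (conj_mx xi *m (conj_mx y)^T)) 0 0 = 0.
    by rewrite mxE (lagrangian_ann h4 yE) conjc0.
  by rewrite conj_mxM conj_mxK conj_mxT conj_mxK.
apply/rowP => j; rewrite [RHS]mxE -(xiE (row j A)); last by rewrite VA row_sub.
by rewrite !mxE; apply: eq_bigr => i _; rewrite !mxE.
Qed.

Lemma pr1_LL : (pr1 @: LL <= E :&: Eb)%VS.
Proof.
apply/subvP => _ /memv_imgP[[X xi] /memLLP[h1 h2] ->]; rewrite pr1E memv_cap mem_cbar.
apply/andP; split; apply/mem_tangent_part; first by exists xi.
by exists (conj_mx xi).
Qed.

Variables (n r : nat).
Hypotheses (hm : m = (2 * n + r)%N) (hr : \dim LL = r)
  (hn : (\dim D - \dim Delta)./2 = n).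

Lemma DeltaSD : (\dim Delta <= \dim D)%N.
Proof.
exact: (dim_real_partS (subv_trans (capvSl E Eb) (addvSl E Eb))).
Qed.

(* The count dim L∩Lbar = r forces pr(L∩Lbar) = E∩Ebar once the type is maximal. *)
Lemma maximal_type : \dim D = (\dim Delta + (n + n))%N /\ (pr1 @: LL = E :&: Eb)%VS.
Proof.
have dD : (\dim D <= m)%N by have := dimvS (subvf D); rewrite dimvf /dim /= mul1n.
have dr : (\dim (LL :&: lker pr1) + \dim (pr1 @: LL) = r)%N := etrans (limg_ker_dim pr1 LL) hr.
have k1 := dim_ker_LL; have k2 := dimvS pr1_LL.
have [_ h2] := E_Eb_conj; have k3 : \dim Delta = \dim (E :&: Eb) := dim_real_part h2.
have [c1 c2] := type_count hm dD dr k1 k2 k3 DeltaSD hn.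
by split=> //; apply/eqP; rewrite eqEdim pr1_LL; exact: c2.
Qed.

(** Two conjugate covectors over the same real vector of E. They must take the same values on E, and
    this is why eps is real on Delta. *)
Lemma real_lift u : cmx u \in (E :&: Eb)%VS ->
  exists xi, (cmx u, xi) \in L /\ (cmx u, conj_mx xi) \in L.
Proof.
have [_ e] := maximal_type; move=> h.
have /memv_imgP[[X xi] /memLLP[h1 h2] uE] : cmx u \in (pr1 @: LL)%VS by rewrite e.
rewrite pr1E /= in uE; exists xi; rewrite uE; split=> //.
by move: h2; rewrite /conj_gtan /= -uE conj_cmx.
Qed.

Variables (k : nat) (F Xi : 'M[C]_(k, m)).
Hypothesis LF : forall X xi, (X, xi) \in L <-> exists2 c : 'rV[C]_k, X = c *m F & xi = c *m Xi.

Lemma mem_E v : v \in E <-> (v <= F)%MS.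
Proof.
split=> [/mem_tangent_part[xi /LF[c -> _]]|/submxP[c ->]]; first exact: submxMl.
by apply/mem_tangent_part; exists (c *m Xi); apply/LF; exists c.
Qed.

Lemma mem_DL v : v \in D <-> (v <= reim_mx F)%MS.
Proof.
split=> [h|/submxP[w wE]].
  have /memv_addP[x xE [y yE e]] : cmx v \in (E + Eb)%VS := etrans (esym (mem_real_part _ v)) h.
  have {}yE : conj_mx y \in E := etrans (esym (mem_cbar _ y)) yE.
  have -> : v = re_mx x + re_mx (conj_mx y).
    have -> : re_mx (conj_mx y) = re_mx y by exact: re_conj_mx.
    by rewrite -re_mxD -e re_cmx.
  have key z : z \in E -> (re_mx z <= reim_mx F)%MS.
    by move=> /mem_E/submxP[c ->]; apply: submx_trans (submx_colu _ _) (reim_mxS F c).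
  by rewrite addmx_sub // key.
apply: (etrans (mem_real_part _ v)).
(* For w = (w1, w2), the real part of (w1 - i w2) F is w1 Re F + w2 Im F = v. *)
pose f := (cmx (lsubmx w) + 'i%C *: cmx (- rsubmx w)) *m F.
have fE : f \in E by apply/mem_E; exact: submxMl.
have -> : v = re_mx f.
  by rewrite /f re_mxM re_complex_mx im_complex_mx mulNmx opprK wE -{1}[w]hsubmxK mul_row_col.
rewrite half_sum_cmx; apply: memvZ; apply: memv_add => //.
by apply: (etrans (mem_cbar _ _)); rewrite conj_mxK.
Qed.

Lemma mem_DeltaL v : v \in Delta <-> (cmx v <= F)%MS.
Proof.
split=> [h|h].
  have : cmx v \in (E :&: Eb)%VS := etrans (esym (mem_real_part _ v)) h.
  by rewrite memv_cap => /andP[/mem_E].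
apply: (etrans (mem_real_part _ v)); rewrite memv_cap; apply/andP; split; first exact/mem_E.
by apply: (etrans (mem_cbar _ _)); rewrite conj_cmx; apply/mem_E.
Qed.

Lemma dirac_frame_conditions : frame_conditions (\dim Delta) n F Xi.
Proof.
have dE : \dim E = \rank F by apply: dim_rank => v; apply/idP/idP => /mem_E.
have dD : \dim D = \rank (reim_mx F) by apply: dim_rank => v; apply/idP/idP => /mem_DL.
have [dDD _] := maximal_type.
have rowL i : (row i F, row i Xi) \in L.
  by apply/LF; exists (delta_mx 0 i); rewrite -rowE.
split.
- exact: etrans (esym dE) (half_count dim_E2 dDD).
- exact: etrans (esym dD) dDD.
- apply/matrixP => i j; have := lagrangian_pair (rowL i) (rowL j) => /eqP.
  rewrite addrC addr_eq0 => /eqP h.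
  have e1 : (Xi *m F^T) i j = (row i Xi *m (row j F)^T) 0 0.
    by rewrite !mxE; apply: eq_bigr => l _; rewrite !mxE.
  have e2 : (F *m Xi^T) i j = (row j Xi *m (row i F)^T) 0 0.
    by rewrite !mxE; apply: eq_bigr => l _; rewrite !mxE mulrC.
  by rewrite e1 [RHS]mxE e2.
move=> p Dr c cE; apply/matrixP => a b; rewrite [RHS]mxE.
have rowc i : (cmx (row i Dr), row i c *m Xi) \in L.
  apply/LF; exists (row i c) => //.
  by rewrite -row_mul -cE /cmx map_row.
have rowE i : cmx (row i Dr) \in E by apply/mem_tangent_part; exists (row i c *m Xi).
have e1 : (c *m Xi *m F^T *m c^T) a b = ((row a c *m Xi) *m (cmx (row b Dr))^T) 0 0.
  rewrite (_ : cmx (row b Dr) = row b c *m F); last by rewrite -row_mul -cE /cmx map_row.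
  rewrite trmx_mul !mulmxA -!row_mul [RHS]mxE [LHS]mxE [RHS]mxE.
  by apply: eq_bigr => l _; congr (_ * _); rewrite !mxE.
have [|xi [x1 x2]] := @real_lift (row a Dr).
  rewrite memv_cap; apply/andP; split; first exact: rowE.
  by apply: (etrans (mem_cbar _ _)); rewrite conj_cmx; exact: rowE.
(* Covectors of L over the same vector differ by some (0, zeta) in L, and zeta annihilates E.
   Applied to c Xi, xi and conj xi, this makes the entry equal to its own conjugate. *)
have uniq eta1 eta2 : (cmx (row a Dr), eta1) \in L -> (cmx (row a Dr), eta2) \in L ->
    (eta1 *m (cmx (row b Dr))^T) 0 0 = (eta2 *m (cmx (row b Dr))^T) 0 0.
  move=> h1 h2; have h3 : (0, eta1 - eta2) \in L.
    have -> : ((0, eta1 - eta2) : gtan R m) = (cmx (row a Dr), eta1) - (cmx (row a Dr), eta2).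
      by congr pair; rewrite /= subrr.
    exact: memvB.
  have := lagrangian_ann h3 (rowE b).
  have sub2 (x y : 'M[C]_1) : (x - y) 0 0 = x 0 0 - y 0 0 by rewrite !mxE.
  by rewrite mulmxBl sub2 => /eqP; rewrite subr_eq0 => /eqP.
rewrite [LHS]mxE e1 (uniq _ _ (rowc a) x1).
have := uniq _ _ x1 x2.
have -> : (conj_mx xi *m (cmx (row b Dr))^T) 0 0 = conjc ((xi *m (cmx (row b Dr))^T) 0 0).
  by rewrite -{1}[cmx (row b Dr)]conj_cmx -conj_mxT -conj_mxM mxE.
case: ((xi *m _) 0 0) => x y [] /eqP.
by rewrite -subr_eq0 opprK -mulr2n mulrn_eq0 => /eqP.
Qed.

End PointwiseDirac.

Section FrameTransport.
Variables (R : realType) (m k : nat).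
Local Notation C := R[i].

Lemma frame_conditions_transport kd n (F Xi : 'M[C]_(k, m)) (K K' : 'M[R]_m) :
  K *m K' = 1%:M -> frame_conditions kd n F Xi ->
  frame_conditions kd n (F *m cmx K) (Xi *m (cmx K')^T).
Proof.
move=> KK' [h1 h2 h3 h4].
have fK : row_free K by apply/row_freeP; exists K'.
have fcK : row_free (cmx K) by rewrite /row_free mxrank_map.
have reimE : reim_mx (F *m cmx K) = reim_mx F *m K.
  by rewrite /reim_mx re_mxM im_mxM re_cmx im_cmx !mulmx0 subr0 add0r mul_col_mx.
have cKK : (cmx K')^T *m (cmx K)^T = 1%:M by rewrite -trmx_mul -cmxM KK' cmx1 trmx1.
split.
- by rewrite mxrankMfree.
- by rewrite reimE mxrankMfree.
- by rewrite !trmx_mul trmxK !mulmxA -(mulmxA Xi) cKK mulmx1 h3 -(mulmxA F) -cmxM KK' cmx1 mulmx1.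
- move=> p D c cE; have := h4 p (D *m K') c.
  rewrite cmxM cE -!mulmxA -cmxM KK' cmx1 mulmx1 => /(_ erefl).
  by rewrite trmx_mul !mulmxA -(mulmxA _ (cmx K')^T) cKK mulmx1.
Qed.

End FrameTransport.

(** * The complex structure that E induces on D / Delta *)

Section TransverseStructure.
Variables (R : realType) (m : nat).
Local Notation C := R[i].
Local Notation cvec := 'rV[C]_m.
Variable E : {vspace cvec}.
Let D := real_part (E + cbar E)%VS.
Let Delta := real_part (E :&: cbar E)%VS.

Lemma mem_cDelta v : v \in complexify Delta <-> v \in E /\ conj_mx v \in E.
Proof.
have capP u : u \in Delta <-> cmx u \in E.
  split=> [h|h].
    have : cmx u \in (E :&: cbar E)%VS := etrans (esym (mem_real_part _ u)) h.
    by rewrite memv_cap => /andP[].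
  apply: (etrans (mem_real_part _ u)); rewrite memv_cap; apply/andP; split=> //.
  by apply: (etrans (mem_cbar _ _)); rewrite conj_cmx.
split=> [h|[h1 h2]].
  have /andP[/capP h1 /capP h2] := etrans (esym (mem_complexify Delta v)) h.
  rewrite [v]complex_mxE conj_mxD conj_mxZ !conj_cmx; split; apply: memvD => //; exact: memvZ.
apply: (etrans (mem_complexify Delta v)); apply/andP; split; apply/capP.
  by rewrite half_sum_cmx; apply: memvZ; exact: memvD.
by rewrite half_diff_cmx conj_mxZ; apply: memvZ; apply: memvD; exact: memvZ.
Qed.

Lemma mem_realD v : v \in D <-> exists e f, [/\ e \in E, f \in E & cmx v = e + conj_mx f].
Proof.
split=> [h|[e [f [eE fE vE]]]].
  have /memv_addP[x xE [y yE ->]] : cmx v \in (E + cbar E)%VS := etrans (esym (mem_real_part _ v)) h.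
  exists x, (conj_mx y); rewrite conj_mxK; split=> //.
  exact: (etrans (esym (mem_cbar _ y)) yE).
apply: (etrans (mem_real_part _ v)); rewrite vE; apply: memv_add => //.
by apply: (etrans (mem_cbar _ _)); rewrite conj_mxK.
Qed.

Lemma mem_cD v : v \in complexify D <-> exists e f, [/\ e \in E, f \in E & v = e + conj_mx f].
Proof.
split=> [h|[e [f [eE fE vE]]]].
  have /andP[/mem_realD[e [f [eE fE h1]]] /mem_realD[e' [f' [eE' fE' h2]]]] :=
    etrans (esym (mem_complexify D v)) h.
  exists (e + 'i%C *: e'), (f - 'i%C *: f'); split; first by apply: memvD => //; exact: memvZ.
    by apply: memvB => //; exact: memvZ.
  rewrite conj_mxD conj_mxN conj_mxZ conj_i scaleNr opprK [v]complex_mxE h1 h2 scalerDr addrACA.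
  by [].
apply: (etrans (mem_complexify D v)); apply/andP; split; apply/mem_realD.
  exists (2^-1 *: (e + f)), (2^-1 *: (e + f)); split; try by apply: memvZ; exact: memvD.
  rewrite half_sum_cmx vE conj_mxD conj_mxZ conj_half !conj_mxD conj_mxK -scalerDr; congr (_ *: _).
  by rewrite addrACA [conj_mx f + f]addrC addrACA.
exists (2^-1 *: (- 'i%C *: (e - f))), (2^-1 *: (- 'i%C *: (e - f))).
split; try by apply: memvZ; apply: memvZ; exact: memvB.
have c2 := conj_half R; have ci : conjc (- 'i%C : C) = 'i%C by rewrite rmorphN [X in - X]conj_i opprK.
rewrite half_diff_cmx vE; move: (2^-1 : C) ('i%C : C) c2 ci => h j c2 ci.
rewrite !conj_mxZ c2 -scalerDr ci !conj_mxD conj_mxN conj_mxK; congr (_ *: _).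
by apply/rowP => l; rewrite !mxE; ring.
Qed.

(** J induces multiplication by i on E modulo the complexified Delta. Being real it induces
    multiplication by -i on Ebar, so its class on D / Delta is determined. *)
Definition CR_compatible (J : 'M[R]_m) := forall v, v \in E ->
  v *m cmx J - 'i%C *: v \in complexify Delta.

Variable J : 'M[R]_m.
Hypothesis JC : CR_compatible J.

Lemma CR_compatible_E e : e \in E -> e *m cmx J \in E.
Proof.
move=> eE; have /mem_cDelta[h _] := JC eE.
by rewrite -[_ *m _](subrK ('i%C *: e)); apply: memvD => //; exact: memvZ.
Qed.

Lemma CR_compatible_D v : v \in D -> v *m J \in D.
Proof.
move=> /mem_realD[e [f [eE fE vE]]]; apply/mem_realD.
exists (e *m cmx J), (f *m cmx J); split; try exact: CR_compatible_E.
by rewrite cmxM vE mulmxDl conj_mxM conj_cmx.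
Qed.

Lemma mem_realDelta v : v \in Delta <-> cmx v \in E.
Proof.
split=> [h|h].
  have : cmx v \in (E :&: cbar E)%VS := etrans (esym (mem_real_part _ v)) h.
  by rewrite memv_cap => /andP[].
apply: (etrans (mem_real_part _ v)); rewrite memv_cap; apply/andP; split=> //.
by apply: (etrans (mem_cbar _ _)); rewrite conj_cmx.
Qed.

Lemma CR_compatible_Delta v : v \in Delta -> v *m J \in Delta.
Proof. by move=> /mem_realDelta h; apply/mem_realDelta; rewrite cmxM; exact: CR_compatible_E. Qed.

Lemma CR_compatible_square v : v \in D -> v *m J *m J + v \in Delta.
Proof.
move=> /mem_realD[e [f [eE fE vE]]]; apply/mem_realDelta.
have key g : g \in E -> g *m cmx J *m cmx J + g \in E /\ conj_mx (g *m cmx J *m cmx J + g) \in E.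
  move=> gE; have /mem_cDelta[h1 h2] := JC gE; set d := _ - _ in h1 h2.
  (* J^2 + 1 factors as (J - i)(J + i), and d = g (J - i) already lies in the complexified Delta,
     which J + i preserves. *)
  have -> : g *m cmx J *m cmx J + g = d *m cmx J + 'i%C *: d.
    rewrite /d mulmxBl -scalemxAl scalerBr scalerA -expr2 sqr_i scaleN1r opprK.
    by rewrite addrA subrK.
  rewrite conj_mxD conj_mxZ conj_mxM conj_cmx; split; apply: memvD; try exact: memvZ.
    exact: CR_compatible_E.
  exact: CR_compatible_E.
rewrite cmxD !cmxM vE !mulmxDl addrACA.
have [k1 _] := key e eE; have [_ k2] := key f fE; apply: memvD => //.
by move: k2; rewrite conj_mxD !conj_mxM conj_cmx.
Qed.

(** Write v = e + fbar with e and f in E. Modulo the complexified Delta, J - i kills e and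
    multiplies fbar by -2i; so if it kills v, then fbar lies in E. *)
Lemma CR_compatible_fibre v : v \in cr_fibre D Delta J <-> v \in E.
Proof.
split=> [h|vE].
  have /andP[/mem_cD[e [f [eE fE vE]]] h2] := etrans (esym (mem_cr_fibre D Delta J v)) h.
  have {h2}/mem_cDelta[h1 h2] := h2.
  have /mem_cDelta[d1 d2] := JC eE; have /mem_cDelta[d3 d4] := JC fE.
  have fcE : conj_mx f \in E.
    have dec : (- 'i%C * 2) *: conj_mx f = (v *m cmx J - 'i%C *: v) - (e *m cmx J - 'i%C *: e)
        - conj_mx (f *m cmx J - 'i%C *: f).
      rewrite vE conj_mxD conj_mxN conj_mxZ conj_i conj_mxM conj_cmx mulmxDl.
      by apply/rowP => j; rewrite !mxE; ring.
    have n0 : - 'i%C * 2 != 0 :> C.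
      rewrite mulf_neq0 ?oppr_eq0 ?pnatr_eq0 //.
      by apply/eqP => /(congr1 (@complex.Im R)) /= /eqP; rewrite oner_eq0.
    rewrite -[conj_mx f]scale1r -(mulVf n0) -scalerA dec; apply: memvZ.
    by apply: memvB => //; exact: memvB.
  by rewrite vE; exact: memvD.
apply: (etrans (mem_cr_fibre D Delta J v)); apply/andP; split; last exact: JC.
by apply/mem_cD; exists v, 0; rewrite mem0v; split=> //; rewrite /conj_mx map_mx0 addr0.
Qed.

(** Allows a J chosen without any regularity to be replaced near a point by a smooth one, without
    changing its class modulo Delta. *)
Lemma CR_compatible_unique J' v : CR_compatible J' -> v \in D -> v *m J' - v *m J \in Delta.
Proof.
move=> JC' /mem_realD[e [f [eE fE vE]]]; apply/mem_realDelta.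
have key g : g \in E -> g *m cmx J' - g *m cmx J \in E /\ conj_mx (g *m cmx J' - g *m cmx J) \in E.
  move=> gE; have /mem_cDelta[h1 h2] := JC gE; have /mem_cDelta[h3 h4] := JC' _ gE.
  have -> : g *m cmx J' - g *m cmx J = (g *m cmx J' - 'i%C *: g) - (g *m cmx J - 'i%C *: g).
    by rewrite opprB addrA subrK.
  move: (_ - 'i%C *: g) (_ - 'i%C *: g) h1 h2 h3 h4 => a b h1 h2 h3 h4.
  have -> : conj_mx (a - b) = conj_mx a - conj_mx b by rewrite conj_mxD conj_mxN.
  by split; apply: memvB.
rewrite cmxD cmxN !cmxM vE !mulmxDl opprD addrACA.
have [k1 _] := key e eE; have [_ k2] := key f fE.
rewrite conj_mxD conj_mxN !conj_mxM !conj_cmx in k2.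
exact: memvD k1 k2.
Qed.

End TransverseStructure.

(** * Charts *)

Section Jacobians.
Variable R : realType.

Lemma jacobian_comp a b c (f : 'rV[R]_a -> 'rV[R]_b) (g : 'rV[R]_b -> 'rV[R]_c) x :
  differentiable f x -> differentiable g (f x) ->
  'J (g \o f) x = ('J f x : 'M[R]_(a, b)) *m ('J g (f x) : 'M[R]_(b, c)).
Proof.
move=> df dg; apply/row_matrixP => i; rewrite row_mul !rowE.
have dgf := differentiable_comp df dg.
set e := delta_mx 0 i.
rewrite -(deriveEjacobian e dgf) -(deriveEjacobian e df) -(deriveEjacobian _ dg).
by rewrite (deriveE e dgf) (deriveE _ dg) (deriveE e df) (diff_comp df dg).
Qed.

Lemma row_jacobian a b (f : 'rV[R]_a -> 'rV[R]_b) x i : differentiable f x ->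
  row i ('J f x) = 'D_(delta_mx 0 i) f x.
Proof. by move=> df; rewrite (deriveEjacobian _ df) rowE. Qed.

Lemma near_eq_jacobian a b (f g : 'rV[R]_a -> 'rV[R]_b) x : differentiable f x ->
  {near x, f =1 g} -> 'J f x = 'J g x.
Proof.
move=> df fg; have dg := near_eq_differentiable fg df.
apply/row_matrixP => i; apply: (etrans (row_jacobian i df)).
apply: (etrans _ (esym (row_jacobian i dg))); exact: near_eq_derive.
Qed.

Lemma jacobianE a b (f : 'rV[R]_a -> 'rV[R]_b) x i j : differentiable f x ->
  'J f x i j = 'D_(delta_mx 0 i) (fun y => f y 0 j) x.
Proof.
move=> df; have /rowP/(_ j) := row_jacobian i df.
by rewrite derive_rV_coord // [LHS]mxE.
Qed.

Lemma jacobian_id a (x : 'rV[R]_a) : 'J (id : 'rV[R]_a -> 'rV[R]_a) x = 1%:M.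
Proof.
have d : differentiable (id : 'rV[R]_a -> 'rV[R]_a) x.
  by apply: differentiable_rV => j; exact: differentiable_coord.
apply/row_matrixP => i; apply: (etrans (row_jacobian i d)).
by rewrite derive_id rowE mulmx1.
Qed.

Lemma smooth_jacobian a b (U : set 'rV[R]_a) (f : 'rV[R]_a -> 'rV[R]_b) : open U ->
  smooth_map_on U f -> smooth_mx U (fun x => 'J f x).
Proof.
move=> oU sf i j.
apply: (@eq_smooth_on _ _ _ ('D_(delta_mx 0 i) (fun y => f y 0 j))) => //.
  by move=> x Ux; rewrite jacobianE //; exact: smooth_map_differentiable sf Ux.
exact: smooth_on_partial (sf j).
Qed.

End Jacobians.

Section Charts.
Variables (R : realType) (m : nat) (M : manifold R m).
Local Notation C := R[i].
Local Notation cc := (@coord_change R m M).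

Definition transition (i j : chart_index M) : 'rV[R]_m -> 'rV[R]_m := @chart R m M j \o chart_inv i.

Lemma chart_at_dom (p : M) : chart_dom (chart_at p) p.
Proof. exact: projT2 (cid (chart_cover p)). Qed.

Lemma chart_image_openI (i : chart_index M) (U : set M) : open U ->
  open (chart i @` (chart_dom i `&` U)).
Proof.
move=> oU; rewrite openE => _ [p [pi pU] <-].
have px : chart_inv i (chart i p) = p by exact: chartK.
have im : (chart i @` chart_dom i) (chart i p) by exists p.
have c := chart_inv_continuous im.
have : nbhs (chart_inv i (chart i p)) (chart_dom i `&` U).
  rewrite px; apply: open_nbhs_nbhs; split=> //; apply: openI => //; exact: chart_dom_open.
move=> /c h1'; have h1 : nbhs (chart i p) (chart_inv i @^-1` (chart_dom i `&` U)) := h1'.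
have h2 := open_nbhs_nbhs (conj (@chart_image_open R m M i) im).
apply: (@filterS _ (nbhs (chart i p)) _ _ _ _ (filterI h1 h2)) => x [hx [q qi xq]].
exists q => //; split=> //; move: hx => /= [_]; rewrite -xq chartK //.
Qed.

Lemma chart_preimage_open (i : chart_index M) (O : set 'rV[R]_m) : open O ->
  open (chart_dom i `&` chart i @^-1` O).
Proof.
move=> oO; rewrite openE => p [pi pO].
have h1 := open_nbhs_nbhs (conj (@chart_dom_open R m M i) pi).
have h2 := chart_continuous pi (open_nbhs_nbhs (conj oO pO)).
exact: filterI h1 h2.
Qed.

Lemma transition_smoothI i j (U : set M) : U `<=` chart_dom j ->
  smooth_map_on (chart i @` (chart_dom i `&` U)) (transition i j).
Proof.
move=> Uj k; apply: smooth_on_sub (@transition_smooth R m M i j k).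
by move=> _ [p [pi pU] <-]; exists p => //; split=> //; exact: Uj.
Qed.

Lemma transition_differentiable i j (p : M) : chart_dom i p -> chart_dom j p ->
  differentiable (transition i j) (chart i p).
Proof.
move=> pi pj; apply: (smooth_map_differentiable (@transition_smooth R m M i j)).
by exists p.
Qed.

Lemma transitionE i j (p : M) : chart_dom i p -> transition i j (chart i p) = chart j p.
Proof. by move=> pi; rewrite /transition /= chartK. Qed.

Lemma near_transition_comp i j k (p : M) : chart_dom i p -> chart_dom j p ->
  {near chart i p, transition j k \o transition i j =1 transition i k}.
Proof.
move=> pi pj; have o := @chart_image_openI i _ (@chart_dom_open R m M j).
have im : (chart i @` (chart_dom i `&` chart_dom j)) (chart i p) by exists p.
apply: filterS (open_nbhs_nbhs (conj o im)) => _ [q [qi qj] <-].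
by rewrite /transition /= !chartK.
Qed.

Lemma coord_changeM i j k (p : M) : chart_dom i p -> chart_dom j p -> chart_dom k p ->
  cc i j p *m cc j k p = cc i k p.
Proof.
move=> pi pj pk; have d1 := transition_differentiable pi pj.
have d2 := transition_differentiable pj pk.
have d2' : differentiable (transition j k) (transition i j (chart i p)) by rewrite transitionE.
rewrite /coord_change -!/(transition _ _).
have e := near_eq_jacobian (differentiable_comp d1 d2') (near_transition_comp k pi pj).
have e1 := jacobian_comp d1 d2'.
by rewrite -(transitionE j pi) -e1; exact: e.
Qed.

Lemma coord_change_id i (p : M) : chart_dom i p -> cc i i p = 1%:M.
Proof.
move=> pi; rewrite /coord_change -/(transition i i).
have o := @chart_image_open R m M i.
have im : (chart i @` chart_dom i) (chart i p) by exists p.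
have d : differentiable (id : 'rV[R]_m -> 'rV[R]_m) (chart i p).
  by apply: differentiable_rV => j; exact: differentiable_coord.
apply: (etrans _ (jacobian_id (chart i p))); apply/esym; apply: (near_eq_jacobian d).
by apply: filterS (open_nbhs_nbhs (conj o im)) => _ [q qi <-]; rewrite /transition /= chartK.
Qed.

Lemma coord_changeK i j (p : M) : chart_dom i p -> chart_dom j p ->
  cc i j p *m cc j i p = 1%:M.
Proof. by move=> pi pj; rewrite coord_changeM // coord_change_id. Qed.

Lemma smooth_coord_change i j (U : set M) : open U -> U `<=` chart_dom i ->
  smooth_mx (chart j @` (chart_dom j `&` U))
    (fun x => 'J (transition i j) (transition j i x)).
Proof.
move=> oU Ui; have oS := @chart_image_openI j _ oU.
have oT := @chart_image_openI i _ (@chart_dom_open R m M j).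
have sJ : smooth_mx (chart i @` (chart_dom i `&` chart_dom j)) (fun y => 'J (transition i j) y).
  by apply: smooth_jacobian => //; exact: transition_smoothI.
have h x : (chart j @` (chart_dom j `&` U)) x -> (chart i @` (chart_dom i `&` chart_dom j)) (transition j i x).
  by move=> [p [pj pU] <-]; rewrite transitionE //; exists p => //; split=> //; exact: Ui.
exact: (smooth_mx_comp oS h (transition_smoothI _ Ui) sJ).
Qed.

Section LocalFields.
Variables (i0 : chart_index M) (U : set M) (O : set 'rV[R]_m).
Hypotheses (oU : open U) (Ui : U `<=` chart_dom i0) (UO : forall q, U q -> O (chart i0 q)).

(** Rows given in the coordinates of [i0] become components in the preferred charts, in which fields
    on M are stored. Preferred charts jump from point to point, so smoothness only shows in the
    local expressions. *)
Definition chart_field k (H : 'rV[R]_m -> 'M[R]_(k, m)) (q : M) : 'M[R]_(k, m) :=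
  H (chart i0 q) *m cc i0 (chart_at q) q.
Definition chart_cfield k (H : 'rV[R]_m -> 'M[C]_(k, m)) (q : M) : 'M[C]_(k, m) :=
  H (chart i0 q) *m cmx (cc i0 (chart_at q) q).
Definition chart_form (B : 'rV[R]_m -> 'M[R]_m) (q : M) : 'M[R]_m :=
  let K := cc (chart_at q) i0 q in K *m B (chart i0 q) *m K^T.

(** In the local expression the preferred chart drops out by the cocycle rule, which leaves H times
    a transition Jacobian. *)
Lemma smooth_chart_field k (H : 'rV[R]_m -> 'M[R]_(k, m)) l : smooth_mx O H ->
  smooth_vec U (fun q => row l (chart_field H q)).
Proof.
move=> sH i j; have oS := @chart_image_openI i _ oU.
apply: (@eq_smooth_on _ _ _ (fun x => (H (transition i i0 x) *m 'J (transition i0 i) (transition i i0 x)) l j)) => //.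
  move=> _ [q [qi qU] <-]; rewrite transitionE // /local_vec chartK // /chart_field.
  rewrite -row_mul -mulmxA coord_changeM //; [|exact: Ui|exact: chart_at_dom].
  by rewrite [RHS]mxE.
apply: smooth_mxM => //; last exact: smooth_coord_change.
apply: (smooth_mx_comp oS _ (transition_smoothI _ Ui) sH).
by move=> _ [q [qi qU] <-]; rewrite transitionE //; exact: UO.
Qed.

Lemma smooth_chart_cfield k (H : 'rV[R]_m -> 'M[C]_(k, m)) l : csmooth_mx O H ->
  smooth_cvec U (fun q => row l (chart_cfield H q)).
Proof.
move=> sH i j; have oS := @chart_image_openI i _ oU.
suff s : csmooth_mx (chart i @` (chart_dom i `&` U))
    (fun x => local_cvec i (fun q => row l (chart_cfield H q)) x).
  by have /csmooth_mxP/(_ 0 j) := s.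
apply: (@eq_csmooth_mx _ _ _ _ _ (fun x => row l (H (transition i i0 x) *m
    cmx ('J (transition i0 i) (transition i i0 x))))) => //.
  move=> _ [q [qi qU] <-]; rewrite transitionE // /local_cvec chartK // /chart_cfield.
  rewrite -row_mul -mulmxA -cmxM coord_changeM //; [exact: Ui|exact: chart_at_dom].
have s : csmooth_mx (chart i @` (chart_dom i `&` U)) (fun x => H (transition i i0 x) *m
    cmx ('J (transition i0 i) (transition i i0 x))).
  apply: csmooth_mxM => //; last by apply: csmooth_cmx; exact: smooth_coord_change.
  apply: (csmooth_mx_comp oS _ (transition_smoothI _ Ui) sH).
  by move=> _ [q [qi qU] <-]; rewrite transitionE //; exact: UO.
have [s1 s2] := s; split=> a b.
  by apply: eq_smooth_on (s1 l b) => // x _; rewrite !mxE.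
by apply: eq_smooth_on (s2 l b) => // x _; rewrite !mxE.
Qed.

Lemma smooth_chart_form (B : 'rV[R]_m -> 'M[R]_m) i : smooth_mx O B ->
  smooth_mx (chart i @` (chart_dom i `&` U)) (local_form i (chart_form B)).
Proof.
move=> sB; have oS := @chart_image_openI i _ oU.
have sJ : smooth_mx (chart i @` (chart_dom i `&` U)) (fun x => 'J (transition i i0) x).
  exact: smooth_jacobian oS (transition_smoothI _ Ui).
have h x : (chart i @` (chart_dom i `&` U)) x -> O (transition i i0 x).
  by move=> [q [qi qU] <-]; rewrite transitionE //; exact: UO.
have sBt : smooth_mx (chart i @` (chart_dom i `&` U)) (fun x => B (transition i i0 x)).
  exact: (smooth_mx_comp oS h (transition_smoothI _ Ui) sB).
pose G (x : 'rV[R]_m) : 'M[R]_m :=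
  ('J (transition i i0) x : 'M[R]_m) *m B (transition i i0 x) *m ('J (transition i i0) x : 'M[R]_m)^T.
have sG : smooth_mx (chart i @` (chart_dom i `&` U)) G.
  exact: (smooth_mxM oS (smooth_mxM oS sJ sBt) (smooth_mxT sJ)).
apply: (eq_smooth_mx oS _ sG) => _ [q [qi qU] <-].
have at_q := chart_at_dom q; have q0 := Ui qU.
have e := coord_changeM qi at_q q0.
have e1 : G (chart i q) = cc i i0 q *m B (chart i0 q) *m (cc i i0 q)^T.
  by rewrite /G (transitionE i0 qi).
have e2 : local_form i (chart_form B) (chart i q) =
    cc i (chart_at q) q *m chart_form B q *m (cc i (chart_at q) q)^T.
  rewrite /local_form (chartK qi); exact: erefl.
rewrite e1 e2 /chart_form -e; move: (cc i (chart_at q) q) (cc (chart_at q) i0 q) => K1 K2.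
by rewrite trmx_mul !mulmxA.
Qed.

End LocalFields.

End Charts.

(** * Linear algebra of a frame (d, a, b) adapted to E *)

Section AdaptedBasis.
Variables (R : realType) (m kd n : nat).
Local Notation C := R[i].
Variables (E : {vspace 'rV[C]_m}) (d : 'M[R]_(kd, m)) (a b : 'M[R]_(n, m))
  (Q' : 'M[R]_(m, kd + (n + n))).
Let Q := col_mx d (col_mx a b).
Let G := col_mx (cmx d) (cmx a + 'i%C *: cmx b).
Hypotheses (QQ' : Q *m Q' = 1%:M) (EG : forall v, v \in E <-> (v <= G)%MS).

Lemma adapted_row_free : row_free Q.
Proof. by apply/row_freeP; exists Q'. Qed.

Lemma adapted_row_free_d : row_free d.
Proof.
apply/row_freeP; exists (lsubmx Q').
have := congr1 (@ulsubmx R kd (n + n) kd (n + n)) QQ'.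
rewrite /Q scalar_mx_block block_mxKul -{1}[Q']hsubmxK mul_col_row block_mxKul.
exact.
Qed.

Lemma adapted_G : G = frame_incl R kd n *m cmx Q.
Proof.
rewrite /G /Q !cmx_col /frame_incl mul_block_col mul_row_col !mul1mx !mul0mx addr0 add0r.
by rewrite mul_scalar_mx.
Qed.

Lemma adapted_row_free_G : row_free G.
Proof.
apply/row_freeP; exists (cmx Q' *m frame_proj R kd n).
by rewrite adapted_G -mulmxA [cmx _ *m (_ *m _)]mulmxA -cmxM QQ' cmx1 mul1mx frame_inclK.
Qed.

Lemma adapted_coords v : v \in E -> exists (c : 'rV[C]_kd) (e : 'rV[C]_n),
  v = c *m cmx d + e *m (cmx a + 'i%C *: cmx b).
Proof.
move=> /EG/submxP[w ->]; exists (lsubmx w), (rsubmx w).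
by rewrite -{1}[w]hsubmxK mul_row_col.
Qed.

Lemma adapted_mem_d v : (v <= cmx d)%MS -> v \in E.
Proof. by move=> h; apply/EG; apply: submx_trans h (submx_colu _ _). Qed.

(** If c d + e (a + ib) is real, then Im c d + Im e a + Re e b = 0, and freeness of (d, a, b) forces
    e = 0. *)
Lemma adapted_mem_Delta v : v \in real_part (E :&: cbar E)%VS <-> (v <= d)%MS.
Proof.
split=> [/mem_realDelta/adapted_coords[c [e ve]]|h]; last first.
  by apply/mem_realDelta; apply: adapted_mem_d; rewrite map_submx.
have vre : v = re_mx c *m d + (re_mx e *m a - im_mx e *m b).
  rewrite -[LHS]re_cmx ve re_mxD !re_mxM re_complex_mx im_complex_mx re_cmx im_cmx.
  by rewrite mulmx0 subr0.
have vim : 0 = im_mx c *m d + (re_mx e *m b + im_mx e *m a).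
  rewrite -[LHS](im_cmx v) ve im_mxD !im_mxM re_complex_mx im_complex_mx re_cmx im_cmx.
  by rewrite mulmx0 add0r.
have w0 : row_mx (im_mx c) (row_mx (im_mx e) (re_mx e)) = 0.
  apply: (row_free_inj adapted_row_free); rewrite /= mul0mx /Q !mul_row_col.
  by rewrite [RHS]vim [im_mx e *m a + _]addrC.
have [_ w1] := eq_row_mx (etrans w0 (esym (row_mx0 _ _ _ _))).
have [e1 e2] := eq_row_mx (etrans w1 (esym (row_mx0 _ _ _ _))).
by rewrite vre e1 e2 !mul0mx subr0 addr0 submxMl.
Qed.

Lemma adapted_mem_D v : v \in real_part (E + cbar E)%VS <-> (v <= Q)%MS.
Proof.
split=> [/mem_realD[e [f [eE fE vE]]]|/submxP[w ->]].
  have key g : g \in E -> (re_mx g <= Q)%MS /\ (re_mx (conj_mx g) <= Q)%MS.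
    have -> : re_mx (conj_mx g) = re_mx g by exact: re_conj_mx.
    move=> /adapted_coords[c [h ->]].
    suff -> : re_mx (c *m cmx d + h *m (cmx a + 'i%C *: cmx b)) =
        row_mx (re_mx c) (row_mx (re_mx h) (- im_mx h)) *m Q by split; exact: submxMl.
    rewrite re_mxD !re_mxM re_complex_mx im_complex_mx re_cmx im_cmx mulmx0 subr0.
    by rewrite /Q !mul_row_col mulNmx.
  rewrite -[v]re_cmx vE re_mxD; apply: addmx_sub; first exact: (key e eE).1.
  exact: (key f fE).2.
apply/mem_realD.
pose w1 := lsubmx w; pose w2 := lsubmx (rsubmx w); pose w3 := rsubmx (rsubmx w).
have wE : w *m Q = w1 *m d + (w2 *m a + w3 *m b).
  by rewrite -{1}[w]hsubmxK -{1}[rsubmx w]hsubmxK /Q !mul_row_col.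
pose g := cmx w1 *m cmx d + (cmx w2 + 'i%C *: cmx (- w3)) *m (cmx a + 'i%C *: cmx b).
have gE : g \in E.
  by apply/EG; rewrite /G /g -mul_row_col submxMl.
exists (2^-1 *: g), (2^-1 *: g); split; try exact: memvZ.
have -> : cmx (w *m Q) = cmx (re_mx g).
  congr cmx; rewrite wE /g re_mxD !re_mxM !re_complex_mx !im_complex_mx !re_cmx !im_cmx.
  by rewrite mul0mx subr0 mulNmx opprK.
by rewrite half_sum_cmx conj_mxZ conj_half scalerDr.
Qed.

(** In the frame (d, a, b) it sends d to 0, a to -b and b to a; hence a + ib goes to -b + ia = i (a
    + ib). *)
Definition adapted_J0 : 'M[R]_(kd + (n + n)) :=
  block_mx 0 0 0 (block_mx 0 (- 1%:M) 1%:M 0).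

Lemma adapted_CR : CR_compatible E (Q' *m adapted_J0 *m Q).
Proof.
move=> v /adapted_coords[c [e ->]]; set J := _ *m Q.
have JQ : Q *m J = col_mx 0 (col_mx (- b) a).
  rewrite /J !mulmxA QQ' mul1mx /adapted_J0 /Q mul_block_col !mul0mx !addr0 !add0r.
  by rewrite mul_block_col !mul0mx mulNmx !mul1mx addr0 add0r.
have dJ : d *m J = 0 by have := JQ; rewrite /Q !mul_col_mx => /eq_col_mx[].
have [aJ bJ] : a *m J = - b /\ b *m J = a.
  by have := JQ; rewrite /Q !mul_col_mx => /eq_col_mx[_ /eq_col_mx].
have -> : (c *m cmx d + e *m (cmx a + 'i%C *: cmx b)) *m cmx J -
    'i%C *: (c *m cmx d + e *m (cmx a + 'i%C *: cmx b)) = (- 'i%C *: c) *m cmx d.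
  rewrite mulmxDl -!mulmxA mulmxDl -scalemxAl -!cmxM dJ aJ bJ cmx0 mulmx0 add0r cmxN.
  rewrite scalerDr opprD addrCA.
  have -> : e *m (- cmx b + 'i%C *: cmx a) - 'i%C *: (e *m (cmx a + 'i%C *: cmx b)) = 0.
    rewrite scalemxAr -mulmxBr scalerDr scalerA -expr2 sqr_i scaleN1r.
    by rewrite [- cmx b + _]addrC subrr mulmx0.
  by rewrite addr0 -scalemxAl scaleNr.
apply/mem_cDelta; split; first by apply: adapted_mem_d; exact: submxMl.
by rewrite conj_mxM conj_cmx; apply: adapted_mem_d; exact: submxMl.
Qed.

End AdaptedBasis.

(** * The normal form of L around a point of M *)

Section LocalStructure.
Variables (R : realType) (n r s : nat).
Local Notation m := (2 * n + r)%N.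
Local Notation C := R[i].
Variables (M : manifold R m) (L : M -> {vspace gtan R m}).
Hypotheses (hL : complex_dirac L)
  (hr : forall p : M, real_index L p = r)
  (hs : forall p : M, dirac_order L p = s)
  (hn : forall p : M, dirac_type L p = n).
Local Notation kd := (r - s)%N.
Local Notation cc := (@coord_change R m M).

(** The condition that B restricts to eps on E, stated without introducing eps. *)
Definition compatible_form (W : {vspace gtan R m}) (B : 'M[R]_m) : Prop :=
  forall X xi Y eta, (X, xi) \in W -> (Y, eta) \in W ->
  (X *m cmx B *m Y^T) 0 0 = (xi *m Y^T) 0 0.

Lemma delta_count (dD dDelta : nat) : (dD <= m)%N -> (m - dD)%N = s ->
  dD = (dDelta + (n + n))%N -> dDelta = kd.
Proof. by move=> *; lia. Qed.

(** From dim D = m - s = dim Delta + 2n and m = 2n + r. This constant lets the size of the frames of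
    Delta appear in their types. *)
Lemma dim_Delta_L p : \dim (Delta_L L p) = kd.
Proof.
have [e _] := maximal_type (dirac_lagrangian hL p) (erefl m) (hr p) (hn p).
apply: delta_count (hs p) e.
by have := dimvS (subvf (D_L L p)); rewrite dimvf /dim /= mul1n.
Qed.

Lemma frame_mem (W : {vspace gtan R m}) k (X : 'I_k -> gtan R m) :
  basis_of W [seq X l | l <- enum 'I_k] -> forall Y xi, (Y, xi) \in W <->
  exists2 c : 'rV[C]_k, Y = c *m (\matrix_l (X l).1) & xi = c *m (\matrix_l (X l).2).
Proof.
move=> /andP[/eqP <- _] Y xi.
have sumE (c : 'rV[C]_k) : \sum_l c 0 l *: X l =
    (c *m (\matrix_l (X l).1), c *m (\matrix_l (X l).2)).
  apply: injective_projections; rewrite /= -sum_rows.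
    rewrite (raddf_sum (@fst 'rV[C]_m 'rV[C]_m)); apply: eq_bigr => l _; by rewrite rowK.
  rewrite (raddf_sum (@snd 'rV[C]_m 'rV[C]_m)); apply: eq_bigr => l _; by rewrite rowK.
split=> [/mem_span_enum[c]|[c -> ->]]; first by rewrite sumE => -[-> ->]; exists c.
by apply/mem_span_enum; exists c; rewrite sumE.
Qed.

(** The matrices live on the coordinate set V of the fixed chart [i0], where smoothness is stated,
    whereas [ls_E] and [ls_compatible] translate them to the preferred chart at each q. *)
Record local_structure (i0 : chart_index M) (U : set M) (V : set 'rV[R]_m)
    (d : 'rV[R]_m -> 'M[R]_(kd, m)) (a b : 'rV[R]_m -> 'M[R]_(n, m))
    (Q' : 'rV[R]_m -> 'M[R]_(m, kd + (n + n))) (B : 'rV[R]_m -> 'M[R]_m) : Prop :=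
  LocalStructure {
  ls_open : open U;
  ls_dom : U `<=` chart_dom i0;
  ls_openV : open V;
  ls_image : forall q, U q -> V (chart i0 q);
  ls_d : smooth_mx V d;
  ls_a : smooth_mx V a;
  ls_b : smooth_mx V b;
  ls_Q' : smooth_mx V Q';
  ls_B : smooth_mx V B;
  ls_inverse : forall x, V x -> col_mx (d x) (col_mx (a x) (b x)) *m Q' x = 1%:M;
  ls_E : forall q, U q -> forall v, v \in E_L L q <->
    (v <= col_mx (cmx (d (chart i0 q))) (cmx (a (chart i0 q)) + 'i%C *: cmx (b (chart i0 q)))
          *m cmx (cc i0 (chart_at q) q))%MS;
  ls_skew : forall x, V x -> (B x)^T = - B x;
  ls_compatible : forall q, U q -> compatible_form (L q) (chart_form i0 B q)
}.

Lemma exists_local_structure (p : M) : exists U V d a b Q' B,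
  U p /\ local_structure (chart_at p) U V d a b Q' B.
Proof.
have [k /(_ p)[U0 [X [oU0 U0p sX bX]]]] := dirac_subbundle hL.
pose i0 := chart_at p; have pi0 := chart_at_dom p; rewrite -/i0 in pi0.
pose Fq q := \matrix_l (X l q).1 : 'M[C]_(k, m).
pose Xq q := \matrix_l (X l q).2 : 'M[C]_(k, m).
have LF q : U0 q -> forall Y xi, (Y, xi) \in L q <->
    exists2 c : 'rV[C]_k, Y = c *m Fq q & xi = c *m Xq q.
  by move=> /bX bq; exact: frame_mem bq.
have fcq q : U0 q -> frame_conditions kd n (Fq q) (Xq q).
  move=> Uq; rewrite -(dim_Delta_L q).
  exact: (dirac_frame_conditions (dirac_lagrangian hL q) (erefl m) (hr q) (hn q) (LF q Uq)).
(* [F] and [Xi] are the frame in the fixed chart [i0]; [Fq] and [Xq] are its components in the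
   varying preferred charts. They agree at p, where [i0] is the preferred chart. *)
pose F x := \matrix_l local_cvec i0 (fun q => (X l q).1) x : 'M[C]_(k, m).
pose Xi x := \matrix_l local_ccovec i0 (fun q => (X l q).2) x : 'M[C]_(k, m).
have FE q : chart_dom i0 q -> F (chart i0 q) = Fq q *m cmx (cc (chart_at q) i0 q).
  move=> qi; apply/row_matrixP => l; rewrite row_mul !rowK /local_cvec (chartK qi).
  exact: erefl.
have XE q : chart_dom i0 q -> Xi (chart i0 q) = Xq q *m (cmx (cc i0 (chart_at q) q))^T.
  move=> qi; apply/row_matrixP => l; rewrite row_mul !rowK /local_ccovec (chartK qi).
  exact: erefl.
pose S := chart i0 @` (chart_dom i0 `&` U0).
have oS : open S by exact: chart_image_openI.
have sF : csmooth_mx S F.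
  apply/csmooth_mxP => l j; have [s1 _] := sX l; have [f1 f2] := s1 i0 j.
  have e x : local_cvec i0 (fun q => (X l q).1) x 0 j = F x l j by rewrite [RHS]mxE.
  by split; [apply: (eq_smooth_on oS _ f1)|apply: (eq_smooth_on oS _ f2)] => x _; rewrite e.
have sXi : csmooth_mx S Xi.
  apply/csmooth_mxP => l j; have [_ s1] := sX l; have [f1 f2] := s1 i0 j.
  have e x : local_ccovec i0 (fun q => (X l q).2) x 0 j = Xi x l j by rewrite [RHS]mxE.
  by split; [apply: (eq_smooth_on oS _ f1)|apply: (eq_smooth_on oS _ f2)] => x _; rewrite e.
have fcx x : S x -> frame_conditions kd n (F x) (Xi x).
  move=> [q [qi qU] <-]; rewrite FE // XE //.
  by apply: frame_conditions_transport (fcq q qU); apply: coord_changeK => //; exact: chart_at_dom.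
have Sp : S (chart i0 p) by exists p.
have Fp : F (chart i0 p) = Fq p by rewrite FE // coord_change_id // cmx1 mulmx1.
have [A [/eqP fA VA]] := exists_basis_matrix (Delta_L L p).
have [d0 d0E] := exists_eqmx_rank (etrans fA (dim_Delta_L p)).
have fd0 : row_free d0 by rewrite /row_free d0E fA dim_Delta_L.
have d0F : (cmx d0 <= F (chart i0 p))%MS.
  rewrite Fp; apply/row_subP => l; have -> : row l (cmx d0) = cmx (row l d0) by rewrite /cmx map_row.
  apply/(mem_DeltaL (LF p U0p)); have h : (row l d0 <= A)%MS by rewrite -d0E row_sub.
  exact: etrans (VA _) h.
have [V [d [a [b [Q' [B [[oV Vp VS] [[sd sa sb sQ' sB] main]]]]]]]] :=
  local_normal_form oS Sp sF sXi fcx fd0 d0F.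
pose U := U0 `&` (chart_dom i0 `&` chart i0 @^-1` V).
have UU0 q : U q -> U0 q by case.
have Ui q : U q -> chart_dom i0 q by case=> _ [].
have UV q : U q -> V (chart i0 q) by case=> _ [].
exists U, V, d, a, b, Q', B; split; first by split.
split=> //.
- by apply: openI => //; exact: chart_preimage_open.
- by move=> x /main[].
- move=> q Uq v; have [_ GF _ _] := main _ (UV q Uq).
  apply: (iff_trans (mem_E (LF q (UU0 q Uq)) v)).
  have e : F (chart i0 q) *m cmx (cc i0 (chart_at q) q) = Fq q.
    have h := coord_changeK (chart_at_dom q) (Ui q Uq).
    by rewrite (FE q (Ui q Uq)) -mulmxA -cmxM h cmx1 mulmx1.
  by rewrite (eqmxMr (cmx (cc i0 (chart_at q) q)) GF) e.
- by move=> x /main[].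
move=> q Uq X1 xi1 X2 xi2 /(LF q (UU0 q Uq))[c -> ->] /(LF q (UU0 q Uq))[c' -> _].
have [_ _ _ FB] := main _ (UV q Uq).
have qi := Ui q Uq; have qa := chart_at_dom q.
have K1 := coord_changeK qi qa.
rewrite (FE q qi) (XE q qi) in FB.
have FB' : Fq q *m cmx (chart_form i0 B q) *m (Fq q)^T = Xq q *m (Fq q)^T.
  move: FB; rewrite /chart_form trmx_mul.
  have KK : (cmx (cc i0 (chart_at q) q))^T *m (cmx (cc (chart_at q) i0 q))^T = 1%:M.
    by rewrite -trmx_mul -cmxM coord_changeK // cmx1 trmx1.
  move: (cc i0 (chart_at q) q) (cc (chart_at q) i0 q) KK => K K' KK.
  by rewrite !mulmxA -(mulmxA (Xq q)) KK mulmx1 !cmxM cmxT !mulmxA.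
by rewrite trmx_mul !mulmxA -(mulmxA c) -(mulmxA c) FB' !mulmxA.
Qed.

End LocalStructure.

(** * Gluing local two-forms *)

Section Gluing.
Variables (R : realType) (m : nat) (M : manifold R m).

Lemma countable_subcover (T : topologicalType) (V : T -> set T) (p0 : T) :
  @second_countable T -> (forall p, open (V p) /\ V p p) ->
  exists s : nat -> T, forall q, exists k, V (s k) q.
Proof.
move=> [B /countable_injP[f finj] [_ Bb]] oV.
have /choice[s sP] : forall k : nat, exists p : T,
    forall b p', B b -> f b = k -> b `<=` V p' -> b `<=` V p.
  move=> k; have [[b [p [Bb' fb bV]]]|no] := pselect (exists b p, [/\ B b, f b = k & b `<=` V p]).
    exists p => b' p' Bb'' fb' _.
    by rewrite (finj b' b) ?inE // fb fb'.
  by exists p0 => b p Bb' fb bV; exfalso; apply: no; exists b, p.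
exists s => q; have [oVq Vq] := oV q.
have [b [Bb' bq] bV] := Bb q _ (open_nbhs_nbhs (conj oVq Vq)).
by exists (f b); exact: sP bV _ bq.
Qed.

Definition smooth_fun (f : M -> R) : Prop :=
  forall i, smooth_on (chart i @` chart_dom i) (fun x => f (chart_inv i x)).

(** A is the image of a compact cube, closed because M is Hausdorff. Its complement is therefore
    open, and extending the bump by 0 there keeps it smooth. *)
Lemma exists_cutoff (i0 : chart_index M) (U : set M) (p : M) : open U -> U `<=` chart_dom i0 -> U p ->
  exists (rho : M -> R) (V A : set M), [/\ open V, V p & forall q, V q -> rho q = 1] /\
    [/\ closed A, A `<=` U, forall q, ~ A q -> rho q = 0 & smooth_fun rho].
Proof.
move=> oU Ui Up; pose x0 := chart i0 p; have pi := Ui p Up.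
have oS := @chart_image_openI R m M i0 _ oU.
have Sx0 : (chart i0 @` (chart_dom i0 `&` U)) x0 by exists p.
have [e e0 eS] := (nbhs_rVP _ _).1 (open_nbhs_nbhs (conj oS Sx0)).
(* The bump vanishes beyond 2 e', within the ball of radius e that lies in the chart image of U. *)
pose e' := e / 3; have e'0 : 0 < e' by rewrite divr_gt0.
have e2 : 2 * e' < e by rewrite /e'; move: e0; clear; lra.
have [bump [sb b1 b0]] := exists_bump x0 e'0.
pose K := [set y : 'rV[R]_m | `|y - x0| <= 2 * e'].
have KS y : K y -> (chart i0 @` (chart_dom i0 `&` U)) y by move=> Ky; apply: eS; exact: le_lt_trans e2.
have cK : compact K.
  have -> : K = [set v | forall i, `[x0 0 i - 2 * e', x0 0 i + 2 * e']%classic (v ord0 i)].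
    apply/seteqP; split=> y /=.
      by move=> /rV_normP h j; rewrite /= in_itv /= -ler_distl; have := h (ltW (mulr_gt0 (ltr0Sn _ 1) e'0)) j; rewrite !mxE.
    move=> h; apply/rV_normP => [|j]; first by rewrite mulr_ge0 // ltW.
    by have := h j; rewrite /= in_itv /= -ler_distl !mxE.
  apply: (@rV_compact _ _ (fun i => `[x0 0 i - 2 * e', x0 0 i + 2 * e']%classic)).
  by move=> i; exact: segment_compact.
pose A := chart_inv i0 @` K.
have cA : closed A.
  apply: compact_closed; first exact: manifold_hausdorff.
  apply: continuous_compact cK; apply: continuous_in_subspaceT => y; rewrite inE => /KS[q [qi _] <-].
  by apply: chart_inv_continuous; exists q.
have AU : A `<=` U by move=> _ [y /KS[q [qi qU] <-] <-]; rewrite chartK.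
pose rho (q : M) := if `[< chart_dom i0 q >] then bump (chart i0 q) else 0.
have rho0 q : ~ A q -> rho q = 0.
  move=> nA; rewrite /rho; case: asboolP => // qi; apply: b0; rewrite ltNge; apply/negP => h.
  by apply: nA; exists (chart i0 q) => //; rewrite chartK.
have rhoU q : chart_dom i0 q -> rho q = bump (chart i0 q).
  by move=> qi; rewrite /rho; case: asboolP.
exists rho, (chart_dom i0 `&` chart i0 @^-1` [set y | `|y - x0| < e']), A; split; split=> //.
- apply: chart_preimage_open.
  have -> : [set y : 'rV[R]_m | `|y - x0| < e'] = ball x0 e'.
    by apply/seteqP; split=> u; rewrite -ball_normE /ball_ /= distrC.
  exact: ball_open.
- by split=> //; rewrite /= /x0 subrr normr0.
- by move=> q [qi /= qe]; rewrite rhoU // b1 // ltW.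
move=> i; apply: smooth_on_local => x [q qi <-].
have [qA|qA] := pselect (A q).
  exists (chart i @` (chart_dom i `&` U)); first by exists q => //; split=> //; exact: AU.
  have oSi := @chart_image_openI R m M i _ oU.
  apply: (@eq_smooth_on _ _ _ (fun y => bump (transition i i0 y))) => //.
    move=> _ [q' [q'i q'U] <-]; rewrite (transitionE i0 q'i) (chartK q'i) rhoU //.
    exact: Ui.
  exact: (smooth_on_comp oSi (fun _ _ => I) (transition_smoothI _ Ui) sb).
have oA : open (~` A) by exact: closed_openC.
exists (chart i @` (chart_dom i `&` ~` A)); first by exists q.
apply: (@eq_smooth_on _ _ _ (cst 0)); last exact: smooth_on_cst.
  exact: chart_image_openI.
by move=> _ [q' [q'i q'A] <-]; rewrite (chartK q'i) rho0.
Qed.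

Lemma local_formE i (B : M -> 'M[R]_m) q : chart_dom i q -> local_form i B (chart i q) =
  coord_change i (chart_at q) q *m B q *m (coord_change i (chart_at q) q)^T.
Proof. by move=> qi; rewrite /local_form (chartK qi); exact: erefl. Qed.

Definition smooth_form (B : M -> 'M[R]_m) : Prop :=
  forall i, smooth_mx (chart i @` chart_dom i) (local_form i B).

Lemma smooth_form0 : smooth_form (fun=> 0).
Proof.
move=> i; apply: (eq_smooth_mx _ _ (smooth_mx_cst _ (0 : 'M[R]_m))); first exact: chart_image_open.
by move=> _ [q qi <-]; rewrite local_formE // mulmx0 mul0mx.
Qed.

Lemma smooth_formD B B' : smooth_form B -> smooth_form B' -> smooth_form (fun q => B q + B' q).
Proof.
move=> sB sB' i; have o := @chart_image_open R m M i.
apply: (eq_smooth_mx o _ (smooth_mxD o (sB i) (sB' i))) => _ [q qi <-].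
rewrite !local_formE //; move: (coord_change _ _ _) (B q) (B' q) => K b b'.
by rewrite mulmxDr mulmxDl.
Qed.

Lemma smooth_formZ f B : smooth_fun f -> smooth_form B -> smooth_form (fun q => f q *: B q).
Proof.
move=> sf sB i; have o := @chart_image_open R m M i.
apply: (eq_smooth_mx o _ (smooth_mxZ o (sf i) (sB i))) => _ [q qi <-].
rewrite !local_formE // (chartK qi); move: (coord_change _ _ _) (B q) (f q) => K b t.
by rewrite -scalemxAr -scalemxAl.
Qed.

Lemma smooth_funM f g : smooth_fun f -> smooth_fun g -> smooth_fun (fun q => f q * g q).
Proof. by move=> sf sg i; apply: smooth_onM => //; exact: chart_image_open. Qed.

Lemma smooth_fun_compl f : smooth_fun f -> smooth_fun (fun q => 1 - f q).
Proof.
move=> sf i; have o := @chart_image_open R m M i; apply: smooth_onD => //; first exact: smooth_on_cst.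
have := smooth_onM o (smooth_on_cst _ (-1)) (sf i).
by apply: eq_smooth_on => // x _; rewrite mulN1r.
Qed.

Lemma smooth_fun1 : smooth_fun (cst 1).
Proof. by move=> i; exact: smooth_on_cst. Qed.

Lemma smooth_cutoff_form i0 (U A : set M) W rho (B : 'rV[R]_m -> 'M[R]_m) :
  open U -> U `<=` chart_dom i0 -> (forall q, U q -> W (chart i0 q)) -> smooth_mx W B ->
  closed A -> A `<=` U -> (forall q, ~ A q -> rho q = 0) -> smooth_fun rho ->
  smooth_form (fun q => rho q *: chart_form i0 B q).
Proof.
move=> oU Ui UO sB cA AU rho0 srho i k l; apply: smooth_on_local => x [q qi <-].
have [qA|qA] := pselect (A q).
  exists (chart i @` (chart_dom i `&` U)); first by exists q => //; split=> //; exact: AU.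
  have oSi := @chart_image_openI R m M i _ oU.
  have srho' : smooth_on (chart i @` (chart_dom i `&` U)) (fun x => rho (chart_inv i x)).
    by apply: smooth_on_sub (srho i) => _ [q' [q'i _] <-]; exists q'.
  have sBi := smooth_chart_form oU Ui UO i sB.
  move: k l; apply: (eq_smooth_mx oSi _ (smooth_mxZ oSi srho' sBi)) => _ [q' [q'i _] <-].
  rewrite !local_formE // (chartK q'i); move: (coord_change _ _ _) (chart_form _ _ _) (rho q') => K b t.
  by rewrite -scalemxAr -scalemxAl.
have oA : open (~` A) by exact: closed_openC.
have oSi := @chart_image_openI R m M i _ oA.
exists (chart i @` (chart_dom i `&` ~` A)); first by exists q.
move: k l; apply: (eq_smooth_mx oSi _ (smooth_mx_cst _ (0 : 'M[R]_m))).
move=> _ [q' [q'i q'A] <-].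
by rewrite local_formE // rho0 // scale0r mulmx0 mul0mx.
Qed.

(* Cutoffs equal to 1 on a countable cover, used with priorities: on the k-th set of the
   cover only the first k+1 local forms contribute, so no local finiteness is needed. *)
Lemma glue_forms (P : M -> 'M[R]_m -> Prop) :
  (forall q t B B', P q B -> P q B' -> P q (t *: B + (1 - t) *: B')) ->
  (forall p, exists i0 U W B, [/\ open U, U p, U `<=` chart_dom i0,
     forall q, U q -> W (chart i0 q) & smooth_mx W B /\ forall q, U q -> P q (chart_form i0 B q)]) ->
  exists B, (forall q, P q (B q)) /\ smooth_form B.
Proof.
move=> affine loc.
have [[p0 _]|empty] := pselect (exists p : M, True); last first.
  by exists (fun=> 0); split=> [q|]; [exfalso; apply: empty; exists q|exact: smooth_form0].
have /choice[dat datP] : forall p : M, exists T : (M -> R) * set M * (M -> 'M[R]_m),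
    [/\ open T.1.2, T.1.2 p, forall q, T.1.2 q -> T.1.1 q = 1,
        forall q, T.1.1 q != 0 -> P q (T.2 q) &
        smooth_fun T.1.1 /\ smooth_form (fun q => T.1.1 q *: T.2 q)].
  move=> p; have [i0 [U [W [B [oU Up Ui UO [sB PB]]]]]] := loc p.
  have [rho [V [A [[oV Vp V1] [cA AU rho0 srho]]]]] := exists_cutoff oU Ui Up.
  exists (rho, V, chart_form i0 B); split=> //=; last first.
    by split=> //; exact: smooth_cutoff_form oU Ui UO sB cA AU rho0 srho.
  move=> q rq; apply: PB; apply: AU; apply: contrapT => /rho0 h.
  by move: rq; rewrite h eqxx.
have [sq sqP] := @countable_subcover M (fun p => (dat p).1.2) p0 (@manifold_countable R m M)
  (fun p => let: And5 o Vp _ _ _ := datP p in conj o Vp).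
pose rho k := (dat (sq k)).1.1; pose Bk k := (dat (sq k)).2; pose V k := (dat (sq k)).1.2.
pose w N q := \prod_(k < N) (1 - rho k q).
pose S N q := \sum_(k < N) w k q *: (rho k q *: Bk k q).
have wS N q : w N.+1 q = w N q * (1 - rho N q) by rewrite /w big_ord_recr.
have SS N q : S N.+1 q = S N q + w N q *: (rho N q *: Bk N q) by rewrite /S big_ord_recr.
have sw N : smooth_fun (w N).
  elim: N => [|N IH].
    have -> : w 0%N = cst 1 by apply/funext => q; rewrite /w big_ord0.
    exact: smooth_fun1.
  have -> : w N.+1 = (fun q => w N q * (1 - rho N q)) by apply/funext => q; rewrite wS.
  apply: smooth_funM => //; apply: smooth_fun_compl.
  by have [_ _ _ _ []] := datP (sq N).
have sS N : smooth_form (S N).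
  elim: N => [|N IH].
    have -> : S 0%N = (fun=> 0) by apply/funext => q; rewrite /S big_ord0.
    exact: smooth_form0.
  have -> : S N.+1 = (fun q => S N q + w N q *: (rho N q *: Bk N q)) by apply/funext => q; rewrite SS.
  apply: smooth_formD => //; apply: smooth_formZ => //.
  by have [_ _ _ _ []] := datP (sq N).
(* w N is the weight not yet spent on the first N forms. Giving it to any solution B completes the
   partial sum to an iterated affine combination of solutions. *)
have PS N q B : P q B -> P q (S N q + w N q *: B).
  elim: N B => [|N IH] B PB; first by rewrite /S /w !big_ord0 add0r scale1r.
  rewrite SS wS -addrA -scalerA -scalerDr; apply: IH.
  have [_ _ _ h _] := datP (sq N).
  have [r0|rn] := eqVneq (rho N q) 0; last by apply: affine => //; exact: h.
  by rewrite r0 scale0r add0r subr0 scale1r.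
have stable N q k : w N q = 0 -> S (N + k)%N q = S N q.
  move=> w0; have wk j : w (N + j)%N q = 0.
    by elim: j => [|j IH]; rewrite ?addn0 // addnS wS IH mul0r.
  by elim: k => [|k IH]; rewrite ?addn0 // addnS SS wk scale0r addr0.
have wV k q : V k q -> w k.+1 q = 0.
  by move=> Vq; have [_ _ h _ _] := datP (sq k); rewrite wS /rho h // subrr mulr0.
(* At each q the leftover weight is eventually 0, after which the partial sums are constant; near q
   one fixed stage j + 1 serves, which gives smoothness. *)
have /choice[N NP] : forall q, exists N, w N q = 0.
  by move=> q; have [k Vq] := sqP q; exists k.+1; exact: wV.
have BE N' q : w N' q = 0 -> S (N q) q = S N' q.
  move=> w0; have [le|le] := leqP (N q) N'.
    by rewrite -(subnKC le) stable.
  by rewrite -(subnKC (ltnW le)) stable.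
exists (fun q => S (N q) q); split=> [q|i].
  have [i0 [U [W [B [_ Up _ _ [_ PB]]]]]] := loc q.
  by have := PS (N q) q _ (PB q Up); rewrite NP scale0r addr0.
move=> k l; apply: smooth_on_local => x [q qi <-].
have [j Vj] := sqP q; have [oV _ _ _ _] := datP (sq j).
have oSi := @chart_image_openI R m M i _ oV.
exists (chart i @` (chart_dom i `&` (dat (sq j)).1.2)); first by exists q.
have sub : (chart i @` (chart_dom i `&` (dat (sq j)).1.2)) `<=` chart i @` chart_dom i.
  by move=> _ [q' [q'i _] <-]; exists q'.
move: k l; apply: (eq_smooth_mx oSi _ (smooth_mx_sub sub (sS j.+1 i))) => _ [q' [q'i q'V] <-].
by rewrite !local_formE // (BE j.+1) //; exact: wV.
Qed.

End Gluing.

(** * The transverse CR structure *)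

Section TransverseCR.
Variables (R : realType) (n r s : nat).
Local Notation m := (2 * n + r)%N.
Local Notation C := R[i].
Variables (M : manifold R m) (L : M -> {vspace gtan R m}).
Hypotheses (hL : complex_dirac L)
  (hr : forall p : M, real_index L p = r)
  (hs : forall p : M, dirac_order L p = s)
  (hn : forall p : M, dirac_type L p = n).
Local Notation kd := (r - s)%N.
Local Notation cc := (@coord_change R m M).

Lemma compatible_form_affine (W : {vspace gtan R m}) (t : R) B B' :
  compatible_form W B -> compatible_form W B' -> compatible_form W (t *: B + (1 - t) *: B').
Proof.
move=> h h' X xi Y eta XW YW; have e := h _ _ _ _ XW YW; have e' := h' _ _ _ _ XW YW.
have -> : X *m cmx (t *: B + (1 - t) *: B') *m Y^T =
    t%:C%C *: (X *m cmx B *m Y^T) + (1 - t)%:C%C *: (X *m cmx B' *m Y^T).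
  rewrite cmxD cmxZ cmxZ; move: (cmx B) (cmx B') (t%:C%C) ((1 - t)%:C%C) => b b' u w.
  by rewrite mulmxDr mulmxDl -!scalemxAr -!scalemxAl.
move: (X *m _ *m _) (X *m _ *m _) e e' => A A' e e'.
by rewrite 3!mxE e e' -mulrDl -rmorphD /= addrC subrK mul1r.
Qed.

Lemma exists_compatible_two_form : exists B : M -> 'M[R]_m, real_two_form B /\
  forall q, compatible_form (L q) (B q).
Proof.
have [B [PB sB]] : exists B, (forall q, (B q)^T = - B q /\ compatible_form (L q) (B q)) /\ smooth_form B.
  apply: (@glue_forms R m M (fun q B => B^T = - B /\ compatible_form (L q) B)).
    move=> q t B B' [sB cB] [sB' cB']; split; last exact: compatible_form_affine.
    by rewrite linearD !linearZ /= sB sB' !scalerN opprD.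
  move=> p; have [U [V [d [a [b [Q' [B [Up ls]]]]]]]] := exists_local_structure hL hr hs hn p.
  exists (chart_at p), U, V, B; split; [exact: ls_open ls|exact: Up|exact: ls_dom ls|exact: ls_image ls|].
  split=> [|q Uq]; first exact: ls_B ls.
  split; last exact: ls_compatible ls _ Uq.
  have := ls_skew ls (ls_image ls Uq); rewrite /chart_form.
  move: (B _) (cc _ _ _) => A K AT.
  by rewrite !trmx_mul trmxK AT mulNmx mulmxN mulmxA.
by exists B; split=> [|q]; [split=> [p|]; [exact: (PB p).1|exact: sB]|exact: (PB q).2].
Qed.

Lemma mem_E_L q X : X \in E_L L q <-> exists xi, (X, xi) \in L q.
Proof. by split=> [/mem_tangent_part|h]; last exact/mem_tangent_part. Qed.

(** Compatibility makes X + i_X B pair to zero with all of L exactly as X + xi does, and L contains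
    everything orthogonal to it. *)
Lemma compatible_form_mem q B X : compatible_form (L q) B ->
  X \in E_L L q -> (X, X *m cmx B) \in L q.
Proof.
move=> cB /mem_E_L[xi h]; apply: (lagrangian_mem (dirac_lagrangian hL q)) => Y eta h'.
rewrite (cB _ _ _ _ h h'); exact: (lagrangian_pair (dirac_lagrangian hL q) h h').
Qed.

(** For X + xi in L the difference xi - i_X B annihilates E. Conversely, adding an annihilator of E
    to X + i_X B does not affect its pairing with L. *)
Lemma compatible_form_dirac q B J : compatible_form (L q) B -> CR_compatible (E_L L q) J ->
  L q = exp_form_space B (plus_ann (cr_fibre (D_L L q) (Delta_L L q) J)).
Proof.
move=> cB JC; have fE v : v \in cr_fibre (D_L L q) (Delta_L L q) J <-> v \in E_L L q.
  exact: CR_compatible_fibre JC v.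
apply/vspaceP => -[X xi]; apply/idP/idP => [h|/mem_exp_form_space[[Y zeta]]].
  have XE : X \in E_L L q by apply/mem_E_L; exists xi.
  apply/mem_exp_form_space; exists (X, xi - X *m cmx B); last by rewrite /exp_form /= subrK.
  rewrite mem_plus_ann; apply/andP; split; first exact/fE.
  apply/mem_ann => Y /fE/mem_E_L[eta h'].
  have := cB _ _ _ _ h h'; rewrite /= mulmxBl.
  move: (X *m _ *m _) (xi *m _) => u v uv.
  by rewrite mxE [X in _ + X]mxE uv subrr.
rewrite mem_plus_ann => /andP[/fE YE /mem_ann za] [-> ->].
have h := compatible_form_mem cB YE.
apply: (lagrangian_mem (dirac_lagrangian hL q)) => Z eta h'.
have ZE : Z \in cr_fibre (D_L L q) (Delta_L L q) J by apply/fE/mem_E_L; exists eta.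
have := lagrangian_pair (dirac_lagrangian hL q) h h'; rewrite /= mulmxDl.
have := za Z ZE; move: (zeta *m _) (eta *m _) (Y *m _ *m _) => u v w u0.
have -> : (u + w) 0 0 = w 0 0 by rewrite mxE u0 add0r.
by [].
Qed.

Lemma E_L_involutive (B : M -> 'M[R]_m) : real_two_form B ->
  (forall q, compatible_form (L q) (B q)) -> cinvolutive (E_L L).
Proof.
move=> [_ sB] cB U X Y oU [sX XE] [sY YE] p Up.
have sec Z : smooth_cvec U Z -> (forall q, U q -> Z q \in E_L L q) ->
    section_on (@smooth_gtan R m M) L U (fun q => (Z q, Z q *m cmx (B q))).
  move=> sZ ZE; split; last by move=> q Uq; apply: compatible_form_mem => //; exact: ZE.
  split=> // i; have oS := @chart_image_openI R m M i _ oU.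
  suff s2 : csmooth_mx (chart i @` (chart_dom i `&` U)) (local_ccovec i (fun q => Z q *m cmx (B q))).
    by move=> k; have /csmooth_mxP := s2; apply.
  have sZ' : csmooth_mx (chart i @` (chart_dom i `&` U)) (local_cvec i Z).
    by apply/csmooth_mxP => l k; rewrite (ord1 l); exact: sZ.
  have sB' : csmooth_mx (chart i @` (chart_dom i `&` U)) (fun x => cmx (local_form i B x)).
    by apply: csmooth_cmx => k l; apply: smooth_on_sub (sB i k l) => _ [q [qi _] <-]; exists q.
  apply: (eq_csmooth_mx oS _ (csmooth_mxM oS sZ' sB')) => _ [q [qi _] <-].
  rewrite local_formE // /local_cvec /local_ccovec (chartK qi).
  have h := coord_changeK (chart_at_dom q) qi.
  move: (cc _ _ _) (cc _ _ _) (B q) (Z q) h => K K' b z h.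
  by rewrite !cmxM !mulmxA -(mulmxA z) -cmxM h cmx1 mulmx1 cmxT.
have := dirac_closed hL oU (sec X sX XE) (sec Y sY YE) Up.
(* The vector component of the Dorfman bracket is the Lie bracket; its covector component serves as
   the witness. *)
by move=> h; apply/mem_E_L; eexists; exact: h.
Qed.

Section LocalFrame.
Variables (i0 : chart_index M) (U : set M) (V : set 'rV[R]_m)
  (d : 'rV[R]_m -> 'M[R]_(kd, m)) (a b : 'rV[R]_m -> 'M[R]_(n, m))
  (Q' : 'rV[R]_m -> 'M[R]_(m, kd + (n + n))) (B : 'rV[R]_m -> 'M[R]_m).
Hypothesis ls : local_structure L i0 U V d a b Q' B.
Let Q x := col_mx (d x) (col_mx (a x) (b x)).
Let G x := col_mx (cmx (d x)) (cmx (a x) + 'i%C *: cmx (b x)).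
Let J0 x := Q' x *m @adapted_J0 R kd n *m Q x.

Lemma frame_inverse q : U q ->
  col_mx (chart_field i0 d q) (col_mx (chart_field i0 a q) (chart_field i0 b q)) *m
    (cc (chart_at q) i0 q *m Q' (chart i0 q)) = 1%:M.
Proof.
move=> Uq; have e := ls_inverse ls (ls_image ls Uq).
have h := coord_changeK (ls_dom ls Uq) (chart_at_dom q).
rewrite /chart_field -!mul_col_mx mulmxA -(mulmxA _ (cc i0 _ q)).
by move: (cc _ _ _) (cc _ _ _) h => K K' ->; rewrite mulmx1 e.
Qed.

Lemma frame_E q : U q -> forall v, v \in E_L L q <->
  (v <= col_mx (cmx (chart_field i0 d q))
    (cmx (chart_field i0 a q) + 'i%C *: cmx (chart_field i0 b q)))%MS.
Proof.
move=> Uq v; apply: (iff_trans (ls_E ls Uq v)).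
by rewrite mul_col_mx mulmxDl -scalemxAl /chart_field !cmxM.
Qed.

Lemma frame_CR q : U q -> CR_compatible (E_L L q)
  (cc (chart_at q) i0 q *m J0 (chart i0 q) *m cc i0 (chart_at q) q).
Proof.
move=> Uq; have := adapted_CR (frame_inverse Uq) (frame_E Uq).
by rewrite /J0 /Q /chart_field -!mul_col_mx !mulmxA.
Qed.

Lemma smooth_Q : smooth_mx V Q.
Proof. by apply: smooth_mx_col; [exact: ls_d ls|apply: smooth_mx_col; [exact: ls_a ls|exact: ls_b ls]]. Qed.

Lemma smooth_J0 : smooth_mx V J0.
Proof.
have oV := ls_openV ls; apply: smooth_mxM => //; last exact: smooth_Q.
by apply: smooth_mxM => //; [exact: ls_Q' ls|exact: smooth_mx_cst].
Qed.

Lemma frame_D q : U q -> basis_of (D_L L q) [seq row l (chart_field i0 Q q) | l <- enum 'I_(kd + (n + n))].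
Proof.
move=> Uq; have := adapted_row_free (frame_inverse Uq).
have := adapted_mem_D (frame_E Uq).
rewrite /chart_field -!mul_col_mx => h f; apply: basis_of_rows f _ => v.
by apply/idP/idP => /h.
Qed.

Lemma frame_Delta_mem q : U q -> forall v, v \in Delta_L L q <-> (v <= chart_field i0 d q)%MS.
Proof. by move=> Uq v; exact: adapted_mem_Delta (frame_inverse Uq) (frame_E Uq) v. Qed.

Lemma frame_Delta_free q : U q -> row_free (chart_field i0 d q).
Proof. by move=> Uq; exact: adapted_row_free_d (frame_inverse Uq). Qed.

Lemma frame_Delta q : U q -> basis_of (Delta_L L q) [seq row l (chart_field i0 d q) | l <- enum 'I_kd].
Proof.
move=> Uq; apply: basis_of_rows (frame_Delta_free Uq) _ => v.
by apply/idP/idP => /(frame_Delta_mem Uq).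
Qed.

Lemma smooth_G : csmooth_mx V G.
Proof.
have sd := ls_d ls; have sa := ls_a ls; have sb := ls_b ls.
have reG x : re_mx (G x) = col_mx (d x) (a x).
  by rewrite /G /re_mx map_col_mx -!/(re_mx _) re_cmx re_complex_mx.
have imG x : im_mx (G x) = col_mx 0 (b x).
  by rewrite /G /im_mx map_col_mx -!/(im_mx _) im_cmx im_complex_mx.
split.
  by under [X in smooth_mx _ X]funext do rewrite reG; exact: smooth_mx_col.
by under [X in smooth_mx _ X]funext do rewrite imG; apply: smooth_mx_col => //; exact: smooth_mx_cst.
Qed.

Lemma frame_E_basis q : U q ->
  basis_of (E_L L q) [seq row l (chart_cfield i0 G q) | l <- enum 'I_(kd + n)].
Proof.
move=> Uq; have := adapted_row_free_G (frame_inverse Uq).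
have := frame_E Uq.
have -> : col_mx (cmx (chart_field i0 d q))
    (cmx (chart_field i0 a q) + 'i%C *: cmx (chart_field i0 b q)) = chart_cfield i0 G q.
  by rewrite /chart_cfield /G mul_col_mx mulmxDl -scalemxAl /chart_field !cmxM.
by move=> h f; apply: basis_of_rows f _ => v; apply/idP/idP => /h.
Qed.

End LocalFrame.

Lemma D_L_regular : regular_distribution (D_L L).
Proof.
exists (kd + (n + n))%N => p.
have [U [V [d [a [b [Q' [B [Up ls]]]]]]]] := exists_local_structure hL hr hs hn p.
pose Q x := col_mx (d x) (col_mx (a x) (b x)).
exists U, (fun l q => row l (chart_field (chart_at p) Q q)); split=> //.
- exact: ls_open ls.
- move=> l; exact: (smooth_chart_field (ls_open ls) (ls_dom ls) (ls_image ls) l (smooth_Q ls)).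
- exact: frame_D ls.
Qed.

Lemma Delta_L_regular : regular_distribution (Delta_L L).
Proof.
exists kd => p.
have [U [V [d [a [b [Q' [B [Up ls]]]]]]]] := exists_local_structure hL hr hs hn p.
exists U, (fun l q => row l (chart_field (chart_at p) d q)); split=> //.
- exact: ls_open ls.
- move=> l; exact: (smooth_chart_field (ls_open ls) (ls_dom ls) (ls_image ls) l (ls_d ls)).
- exact: frame_Delta ls.
Qed.

Lemma E_L_regular : regular_cdistribution (E_L L).
Proof.
exists (kd + n)%N => p.
have [U [V [d [a [b [Q' [B [Up ls]]]]]]]] := exists_local_structure hL hr hs hn p.
pose G x := col_mx (cmx (d x)) (cmx (a x) + 'i%C *: cmx (b x)).
exists U, (fun l q => row l (chart_cfield (chart_at p) G q)); split=> //.
- exact: ls_open ls.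
- move=> l; exact: (smooth_chart_cfield (ls_open ls) (ls_dom ls) (ls_image ls) l (smooth_G ls)).
- exact: frame_E_basis ls.
Qed.

(** Chosen point by point without regularity; [CR_compatible_smooth] recovers the smoothness of the
    induced map. *)
Lemma exists_CR_compatible : exists J : M -> 'M[R]_m, forall q, CR_compatible (E_L L q) (J q).
Proof.
suff /choice[J JC] : forall q : M, exists J : 'M[R]_m, CR_compatible (E_L L q) J by exists J.
move=> q.
have [U [V [d [a [b [Q' [B [Up ls]]]]]]]] := exists_local_structure hL hr hs hn q.
by eexists; exact: frame_CR ls _ Up.
Qed.

(** Near p, J is replaced by the smooth J' of a local frame. Both are compatible with E, so X J' and
    X J differ by a vector of Delta. *)
Lemma CR_compatible_smooth (J : M -> 'M[R]_m) : (forall q, CR_compatible (E_L L q) (J q)) ->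
  forall (U : set M) (X : M -> 'rV[R]_m) p, open U -> U p ->
  section_on (@smooth_vec R m M) (D_L L) U X -> exists (V : set M) (Y : M -> 'rV[R]_m),
    [/\ open V, V p, V `<=` U, section_on (@smooth_vec R m M) (D_L L) V Y &
        forall q, V q -> Y q - X q *m J q \in Delta_L L q].
Proof.
move=> JC U X p oU Up [sX XD].
have [U0 [V [d [a [b [Q' [B [U0p ls]]]]]]]] := exists_local_structure hL hr hs hn p.
pose i0 := chart_at p.
pose J0 x := Q' x *m @adapted_J0 R kd n *m col_mx (d x) (col_mx (a x) (b x)).
pose J' q := cc (chart_at q) i0 q *m J0 (chart i0 q) *m cc i0 (chart_at q) q.
have J'C q : U0 q -> CR_compatible (E_L L q) (J' q) := frame_CR ls (q := q).
have oW : open (U `&` U0) by apply: openI => //; exact: ls_open ls.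
exists (U `&` U0), (fun q => X q *m J' q); split=> //; last first.
  by move=> q [Uq U0q]; exact: (CR_compatible_unique (JC q) (J'C q U0q) (XD q Uq)).
split; last by move=> q [Uq U0q]; exact: (CR_compatible_D (J'C q U0q) (XD q Uq)).
move=> j; have oS := @chart_image_openI R m M j _ oW.
set S := chart j @` _ in oS *.
suff : smooth_mx S (local_vec j (fun q => X q *m J' q)) by move=> h k; exact: h.
have Wi : U `&` U0 `<=` chart_dom i0 by move=> q [_ /(ls_dom ls)].
have sX' : smooth_mx S (local_vec j X).
  move=> l k; rewrite (ord1 l); apply: smooth_on_sub (sX j k).
  by move=> _ [q [qj [Uq _]] <-]; exists q.
have sT := @transition_smoothI R m M j i0 _ Wi.
have sK : smooth_mx S (fun x => 'J (transition j i0) x) by exact: smooth_jacobian.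
have sK' := smooth_coord_change j oW Wi.
have SV x : S x -> V (transition j i0 x).
  by move=> [q [qj [_ U0q]] <-]; rewrite (transitionE i0 qj); exact: ls_image ls _ U0q.
have sJ : smooth_mx S (fun x => J0 (transition j i0 x)).
  exact: (smooth_mx_comp oS SV sT (smooth_J0 ls)).
apply: (eq_smooth_mx oS _ (smooth_mxM oS (smooth_mxM oS (smooth_mxM oS sX' sK) sJ) sK')).
move=> _ [q [qj W] <-]; have qi := Wi q W; have qa := chart_at_dom q.
have e1 : 'J (transition j i0) (chart j q) = cc j i0 q by exact: erefl.
have e2 : 'J (transition i0 j) (chart i0 q) = cc i0 j q by exact: erefl.
rewrite (transitionE i0 qj) e1 e2 /local_vec (chartK qj) /J'.
have e3 := coord_changeM qa qj qi; have e4 := coord_changeM qi qa qj.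
have assoc (v : 'rV[R]_m) (A A1 J1 A2 A3 : 'M[R]_m) :
  v *m A *m A1 *m J1 *m (A2 *m A3) = v *m (A *m A1 *m J1 *m A2) *m A3 by rewrite !mulmxA.
rewrite -e4 -e3; exact: assoc.
Qed.

End TransverseCR.

(** * Integrability of Delta_L *)

Section BracketInCharts.
Variables (R : realType) (m : nat).
Local Notation C := R[i].
Implicit Types (U : set 'rV[R]_m) (H : 'rV[R]_m -> 'rV[R]_m).

Lemma derive_sum_mul U (f g : 'I_m -> 'rV[R]_m -> R) x v : U x ->
  (forall a, smooth_on U (f a)) -> (forall a, smooth_on U (g a)) ->
  'D_v (fun y => \sum_a f a y * g a y) x = \sum_a ('D_v (f a) x * g a x + f a x * 'D_v (g a) x).
Proof.
move=> Ux sf sg.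
have df a : derivable (f a) x v by apply: diff_derivable; exact: smooth_on_differentiable (sf a) Ux.
have dg a : derivable (g a) x v by apply: diff_derivable; exact: smooth_on_differentiable (sg a) Ux.
have -> : (fun y => \sum_a f a y * g a y) = \sum_a (f a * g a).
  by apply/funext => y; rewrite fct_sumE.
rewrite derive_sum => [|a]; last exact: derivableM.
by apply: eq_bigr => a _; rewrite deriveM // addrC [g a x *: _]mulrC.
Qed.

Definition real_lie H1 H2 (x : 'rV[R]_m) : 'rV[R]_m :=
  \row_l (\sum_b H1 x 0 b * 'D_(delta_mx 0 b) (fun y => H2 y 0 l) x
          - \sum_b H2 x 0 b * 'D_(delta_mx 0 b) (fun y => H1 y 0 l) x).

(* The second derivatives of theta cancel by Schwarz. *)
Lemma real_lie_jacobian U H1 H2 (theta : 'rV[R]_m -> 'rV[R]_m) x k : open U -> U x ->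
  smooth_map_on U H1 -> smooth_map_on U H2 -> smooth_map_on U theta ->
  \sum_b H1 x 0 b * 'D_(delta_mx 0 b) (fun y => (H2 y *m 'J theta y) 0 k) x -
  \sum_b H2 x 0 b * 'D_(delta_mx 0 b) (fun y => (H1 y *m 'J theta y) 0 k) x =
  (real_lie H1 H2 x *m 'J theta x) 0 k.
Proof.
move=> oU Ux s1 s2 st.
pose J a := 'D_(delta_mx 0 a) (fun y => theta y 0 k).
have JE a y : U y -> 'J theta y a k = J a y.
  by move=> Uy; rewrite jacobianE //; exact: smooth_map_differentiable st Uy.
have sJ a : smooth_on U (J a) by exact: smooth_on_partial (st k).
have DE H b : smooth_map_on U H -> 'D_(delta_mx 0 b) (fun y => (H y *m 'J theta y) 0 k) x =
    \sum_a ('D_(delta_mx 0 b) (fun y => H y 0 a) x * J a x + H x 0 a * 'D_(delta_mx 0 b) (J a) x).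
  move=> sH; rewrite -(derive_sum_mul _ Ux sH sJ); apply: near_eq_derive.
  apply: filterS (open_nbhs_nbhs (conj oU Ux)) => y Uy.
  by rewrite mxE; apply: eq_bigr => a _; rewrite JE.
have part H H' : smooth_map_on U H' ->
    \sum_b H x 0 b * 'D_(delta_mx 0 b) (fun y => (H' y *m 'J theta y) 0 k) x =
    \sum_a (\sum_b H x 0 b * 'D_(delta_mx 0 b) (fun y => H' y 0 a) x) * J a x +
    \sum_b \sum_a H x 0 b * H' x 0 a * 'D_(delta_mx 0 b) (J a) x.
  move=> sH'; under eq_bigr => b _ do rewrite DE // mulr_sumr.
  under [X in X + _]eq_bigr => a _ do rewrite mulr_suml.
  rewrite [X in X + _]exchange_big /= -big_split; apply: eq_bigr => b _.
  by rewrite -big_split; apply: eq_bigr => a _; rewrite /= mulrDr !mulrA.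
have cancel (A1 A2 j h1 h2 : 'I_m -> R) (X : 'I_m -> 'I_m -> R) : (forall b a, X b a = X a b) ->
    (\sum_a A1 a * j a + \sum_b \sum_a h1 b * h2 a * X b a) -
    (\sum_a A2 a * j a + \sum_b \sum_a h2 b * h1 a * X b a) = \sum_a (A1 a - A2 a) * j a.
  move=> XX; rewrite [X in _ - (_ + X)]exchange_big /=.
  have -> : \sum_a \sum_b h2 b * h1 a * X b a = \sum_b \sum_a h1 b * h2 a * X b a.
    by apply: eq_bigr => b _; apply: eq_bigr => a _; rewrite XX [h1 _ * _]mulrC.
  by rewrite opprD addrACA subrr addr0 -sumrB; apply: eq_bigr => a _; rewrite mulrBl.
apply: (etrans (congr2 (fun u v : R => u - v) (part H1 H2 s2) (part H2 H1 s1))).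
have schwarz b a : 'D_(delta_mx 0 b) (J a) x = 'D_(delta_mx 0 a) (J b) x.
  exact: partial_commute oU Ux (st k 3%N).
apply: (etrans (cancel _ _ _ _ _ (fun b a => 'D_(delta_mx 0 b) (J a) x) schwarz)).
rewrite [RHS]mxE; apply: eq_bigr => a _.
by rewrite JE // [real_lie _ _ _ _ _]mxE.
Qed.

Variable M : manifold R m.
Local Notation cc := (@coord_change R m M).

(** Coordinate invariance of the bracket for real fields: [lie_bracket] works in the preferred chart
    at q, and this moves the computation to the chart [i0] of the frame. *)
Lemma lie_bracket_chart (i0 : chart_index M) (U : set M) (H1 H2 : 'rV[R]_m -> 'rV[R]_m)
    (Z1 Z2 : M -> 'rV[C]_m) q : open U -> U `<=` chart_dom i0 -> U q ->
  smooth_map_on (chart i0 @` (chart_dom i0 `&` U)) H1 ->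
  smooth_map_on (chart i0 @` (chart_dom i0 `&` U)) H2 ->
  (forall q', U q' -> Z1 q' = cmx (H1 (chart i0 q') *m cc i0 (chart_at q') q')) ->
  (forall q', U q' -> Z2 q' = cmx (H2 (chart i0 q') *m cc i0 (chart_at q') q')) ->
  lie_bracket Z1 Z2 q = cmx (real_lie H1 H2 (chart i0 q) *m cc i0 (chart_at q) q).
Proof.
move=> oU Ui Uq s1 s2 Z1E Z2E; rewrite /lie_bracket.
move: (chart_at q) (chart_at_dom q) => j qj; have qi := Ui q Uq.
pose U' := U `&` chart_dom j.
have oU' : open U' by apply: openI => //; exact: chart_dom_open.
have U'i : U' `<=` chart_dom i0 by move=> q' [/Ui].
have U'j : U' `<=` chart_dom j by move=> q' [].
pose S := chart i0 @` (chart_dom i0 `&` U'); pose T := chart j @` (chart_dom j `&` U').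
have oS : open S by exact: chart_image_openI.
have oT : open T by exact: chart_image_openI.
have Sq : S (chart i0 q) by exists q.
have Tq : T (chart j q) by exists q.
pose theta := @transition R m M i0 j; pose tau := @transition R m M j i0.
have sth : smooth_map_on S theta by exact: transition_smoothI.
have sta : smooth_map_on T tau by exact: transition_smoothI.
have subS H : smooth_map_on (chart i0 @` (chart_dom i0 `&` U)) H -> smooth_map_on S H.
  by move=> sH l; apply: smooth_on_sub (sH l) => _ [q' [q'i [q'U _]] <-]; exists q'.
have {}s1 := subS _ s1; have {}s2 := subS _ s2.
pose P H y := H y *m 'J theta y.
have sP H : smooth_map_on S H -> forall k, smooth_on S (fun y => P H y 0 k).
  move=> sH k; have sH' : smooth_mx S H by move=> l k'; rewrite (ord1 l); exact: sH.
  exact: (smooth_mxM oS sH' (smooth_jacobian oS sth)).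
have locE H Z : (forall q', U q' -> Z q' = cmx (H (chart i0 q') *m cc i0 (chart_at q') q')) ->
    forall y, T y -> local_cvec j Z y = cmx (P H (tau y)).
  move=> ZE _ [q' [q'j q'U] <-]; have q'i := U'i q' q'U; have q'a := chart_at_dom q'.
  rewrite /local_cvec (chartK q'j) (ZE q' q'U.1) /tau (transitionE i0 q'j) /P -cmxM -mulmxA.
  by rewrite (coord_changeM q'i q'a q'j).
have dtau : differentiable tau (chart j q) := smooth_map_differentiable sta Tq.
have tauq : tau (chart j q) = chart i0 q by exact: transitionE.
have cpE H Z : (forall q', U q' -> Z q' = cmx (H (chart i0 q') *m cc i0 (chart_at q') q')) ->
    smooth_map_on S H -> forall c k, cpartial c (fun y => local_cvec j Z y 0 k) (chart j q) =
    (\sum_b 'J tau (chart j q) c b * 'D_(delta_mx 0 b) (fun y => P H y 0 k) (chart i0 q))%:C%C.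
  move=> ZE sH c k.
  have nT : nbhs (chart j q) T := open_nbhs_nbhs (conj oT Tq).
  have nRe : {near chart j q, (fun y => complex.Re (local_cvec j Z y 0 k)) =1
      (fun y => P H y 0 k) \o tau}.
    by apply: filterS nT => y Ty; rewrite (locE H Z ZE y Ty) mxE.
  have nIm : {near chart j q, (fun y => complex.Im (local_cvec j Z y 0 k)) =1 cst 0}.
    by apply: filterS nT => y Ty; rewrite (locE H Z ZE y Ty) mxE.
  rewrite /cpartial (near_eq_derive _ nRe) (near_eq_derive _ nIm) derive_cst.
  have dP : differentiable (fun y => P H y 0 k) (tau (chart j q)).
    by rewrite tauq; exact: smooth_on_differentiable (sP H sH k) Sq.
  refine (congr1 (fun u : R => Complex u 0) _).
  apply: (etrans (derive_comp_partial (delta_mx 0 c) dtau dP)).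
  apply: eq_bigr => b _; rewrite tauq.
  exact: (congr1 (fun u : R => u * _) (esym (jacobianE c b dtau))).
have part H Z H' Z' : (forall q', U q' -> Z q' = cmx (H (chart i0 q') *m cc i0 (chart_at q') q')) ->
    (forall q', U q' -> Z' q' = cmx (H' (chart i0 q') *m cc i0 (chart_at q') q')) ->
    smooth_map_on S H' -> forall k,
    \sum_c local_cvec j Z (chart j q) 0 c * cpartial c (fun y => local_cvec j Z' y 0 k) (chart j q) =
    (\sum_b H (chart i0 q) 0 b * 'D_(delta_mx 0 b) (fun y => P H' y 0 k) (chart i0 q))%:C%C.
  move=> ZE ZE' sH' k.
  under eq_bigr => c _ do rewrite (cpE H' Z' ZE' sH') (locE H Z ZE _ Tq) tauq mxE -rmorphM.
  rewrite -rmorph_sum /=; congr (_%:C%C).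
  under eq_bigr => c _ do rewrite mulr_sumr.
  rewrite exchange_big /=; apply: eq_bigr => b _.
  under eq_bigr => c _ do rewrite mulrA.
  rewrite -mulr_suml; congr (_ * _).
  (* The Jacobian of tau produced by the chain rule undoes the Jacobian of theta that carries H into
     chart j. *)
  have inv : P H (chart i0 q) *m 'J tau (chart j q) = H (chart i0 q).
    rewrite /P -mulmxA; have e : 'J theta (chart i0 q) *m 'J tau (chart j q) = 1%:M.
      exact: (coord_changeK qi qj).
    by rewrite e mulmx1.
  apply: (etrans _ (congr1 (fun v : 'rV[R]_m => v 0 b) inv)).
  by apply: esym; exact: mxE.
apply/rowP => k; rewrite mxE sumrB.
apply: (etrans (congr2 (fun u v : C => u - v) (part _ _ _ _ Z1E Z2E s2 k) (part _ _ _ _ Z2E Z1E s1 k))).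
apply: (etrans (esym (rmorphB (real_complex R) _ _))).
apply: (etrans (congr1 (real_complex R) (real_lie_jacobian k oS Sq s1 s2 sth))).
by apply: esym; exact: mxE.
Qed.

End BracketInCharts.

(** * Commuting frames of Delta and its leaves *)

Section Frobenius.
Variables (R : realType) (n r s : nat).
Local Notation m := (2 * n + r)%N.
Local Notation C := R[i].
Variables (M : manifold R m) (L : M -> {vspace gtan R m}).
Hypotheses (hL : complex_dirac L)
  (hr : forall p : M, real_index L p = r)
  (hs : forall p : M, dirac_order L p = s)
  (hn : forall p : M, dirac_type L p = n).
Local Notation kd := (r - s)%N.
Local Notation cc := (@coord_change R m M).
Hypothesis invE : cinvolutive (E_L L).

Section LocalFrame.
Variables (i0 : chart_index M) (U : set M) (V : set 'rV[R]_m)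
  (d : 'rV[R]_m -> 'M[R]_(kd, m)) (a b : 'rV[R]_m -> 'M[R]_(n, m))
  (Q' : 'rV[R]_m -> 'M[R]_(m, kd + (n + n))) (B : 'rV[R]_m -> 'M[R]_m).
Hypothesis ls : local_structure L i0 U V d a b Q' B.
Variables (V1 : set 'rV[R]_m) (D : 'rV[R]_m -> 'M[R]_(kd, m)) (N : 'M[R]_(m, kd)).
Hypotheses (oV1 : open V1) (sD : smooth_mx V1 D) (DN : forall x, V1 x -> D x *m N = 1%:M)
  (Dd : forall x, V1 x -> (D x :=: d x)%MS).
Let U1 := U `&` (chart_dom i0 `&` chart i0 @^-1` V1).
Let S1 := chart i0 @` (chart_dom i0 `&` U1).

Lemma leaf_dom_open : open U1.
Proof. by apply: openI; [exact: ls_open ls|exact: chart_preimage_open]. Qed.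

Lemma leaf_frame_mem q : U1 q -> forall v, v \in Delta_L L q <-> (v <= chart_field i0 D q)%MS.
Proof.
move=> [Uq [qi qV]] v; apply: (iff_trans (frame_Delta_mem ls Uq v)).
by rewrite /chart_field (eqmxMr _ (Dd qV)).
Qed.

Lemma leaf_frame_free q : U1 q -> row_free (chart_field i0 D q).
Proof.
move=> [Uq [qi qV]]; have := frame_Delta_free ls Uq.
by rewrite /row_free /chart_field (eqmxMr _ (Dd qV)).
Qed.

(** The rows of D are real sections of E. Their bracket lies in E by involutivity and is real, and
    real vectors of E are those of Delta. *)
Lemma Delta_bracket q i j : U1 q ->
  (real_lie (fun x => row i (D x)) (fun x => row j (D x)) (chart i0 q) <= D (chart i0 q))%MS.
Proof.
move=> U1q; have [Uq [qi qV]] := U1q; set H1 := fun x => row i _; set H2 := fun x => row j _.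
have oU1 := leaf_dom_open; have U1i : U1 `<=` chart_dom i0 by move=> q' [_ []].
have U1V q' : U1 q' -> V1 (chart i0 q') by case=> _ [].
pose Z l q' : 'rV[C]_m := row l (chart_cfield i0 (fun x => cmx (D x)) q').
have ZE l q' : Z l q' = cmx (row l (D (chart i0 q')) *m cc i0 (chart_at q') q').
  by rewrite /Z /chart_cfield -row_mul -cmxM /cmx map_row.
have sZ l : smooth_cvec U1 (Z l) := smooth_chart_cfield oU1 U1i U1V l (csmooth_cmx sD).
have secZ l : section_on (@smooth_cvec R m M) (E_L L) U1 (Z l).
  split=> // q' U1q'; rewrite ZE; apply/mem_realDelta; apply/(leaf_frame_mem U1q').
  by rewrite /chart_field -row_mul row_sub.
have sS l : smooth_map_on S1 (fun x => row l (D x)).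
  move=> k; under [X in smooth_on _ X]funext do rewrite mxE.
  by apply: smooth_on_sub (sD l k) => _ [q' [_ /U1V q'V] <-].
have := invE oU1 (secZ i) (secZ j) U1q.
rewrite (lie_bracket_chart oU1 U1i U1q (sS i) (sS j) (fun q' _ => ZE i q') (fun q' _ => ZE j q')).
move/mem_realDelta/(leaf_frame_mem U1q); rewrite /chart_field => h.
have K := coord_changeK qi (chart_at_dom q).
have := submxMr (cc (chart_at q) i0 q) h.
by rewrite -!mulmxA K !mulmx1.
Qed.

(** Differentiating D N = 1 shows that the bracket br of two rows satisfies br N = 0. As br = c D
    for some c, it follows that c = c D N = 0. *)
Lemma Delta_commuting x i j l : S1 x ->
  \sum_q D x i q * 'D_(delta_mx 0 q) (fun y => D y j l) x =
  \sum_q D x j q * 'D_(delta_mx 0 q) (fun y => D y i l) x.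
Proof.
move=> [q [qi U1q] xE]; have [_ [_ V1x]] := U1q; rewrite /= xE in V1x.
have := Delta_bracket i j U1q; rewrite xE; set br := real_lie _ _ _.
have brE k : br 0 k = \sum_b D x i b * 'D_(delta_mx 0 b) (fun y => D y j k) x -
    \sum_b D x j b * 'D_(delta_mx 0 b) (fun y => D y i k) x.
  have e k' c : (fun y => row k' (D y) 0 c) = (fun y => D y k' c) by apply/funext => y; rewrite mxE.
  rewrite /br mxE !e; congr (_ - _); apply: eq_bigr => b' _; congr (_ * _); exact: mxE.
have N0 k c b' : \sum_l' 'D_(delta_mx 0 b') (fun y => D y k l') x * N l' c = 0.
  have := @derive_sum_mul R m V1 (fun l' y => D y k l') (fun l' => cst (N l' c)) x (delta_mx 0 b') V1x
    (sD k) (fun l' => smooth_on_cst _ _).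
  under [in X in _ = X -> _]eq_bigr => l' _ do rewrite derive_cst mulr0 addr0.
  move=> <-; rewrite (near_eq_derive (g := cst ((1%:M : 'M[R]_kd) k c))) ?derive_cst //.
  by apply: filterS (open_nbhs_nbhs (conj oV1 V1x)) => y /DN <-; rewrite mxE.
have brN : br *m N = 0.
  apply/rowP => c; rewrite [LHS]mxE [RHS]mxE.
  under eq_bigr => k _ do rewrite brE mulrBl !mulr_suml.
  rewrite sumrB exchange_big [X in _ - X]exchange_big /=.
  rewrite !big1 ?subrr // => b' _; under eq_bigr => k _ do rewrite -mulrA.
    by rewrite -mulr_sumr N0 mulr0.
  by rewrite -mulr_sumr N0 mulr0.
move=> /submxP[c bc]; move: brN; rewrite bc -mulmxA DN // mulmx1 => c0.
by move: (brE l); rewrite bc c0 mul0mx mxE => /esym/subr0_eq.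
Qed.

End LocalFrame.

Lemma open_preimageI k (W : set 'rV[R]_k) (g : 'rV[R]_k -> 'rV[R]_m) (A : set 'rV[R]_m) :
  open W -> smooth_map_on W g -> open A -> open (W `&` g @^-1` A).
Proof.
move=> oW sg oA; rewrite openE => w [Ww gA].
have cg := differentiable_continuous (smooth_map_differentiable sg Ww).
exact: filterI (open_nbhs_nbhs (conj oW Ww)) (cg _ (open_nbhs_nbhs (conj oA gA))).
Qed.

Lemma Delta_L_integrable : integrable_distribution (Delta_L L).
Proof.
move=> p; have [U [V [d [a [b [Q' [B [Up ls]]]]]]]] := exists_local_structure hL hr hs hn p.
move: (chart_at p) (chart_at_dom p) ls => i0 pi ls; have Vp := ls_image ls Up.
have fd : row_free (d (chart i0 p)).
  have := frame_Delta_free ls Up; rewrite /chart_field /row_free mxrankMfree //.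
  by apply/row_freeP; exists (cc (chart_at p) i0 p); exact: coord_changeK (chart_at_dom p).
(* N is a right inverse of d at p, so d N stays invertible nearby and can be normalised away. *)
have [N [V1 [oV1 V1p V1V uN _]]] := smooth_right_inverse (ls_openV ls) Vp (ls_d ls) fd.
pose D x := invmx (d x *m N) *m d x.
have sd1 : smooth_mx V1 d := smooth_mx_sub V1V (ls_d ls).
have sD : smooth_mx V1 D.
  apply: smooth_mxM => //; apply: smooth_invmx => //.
  by apply: smooth_mxM => //; exact: smooth_mx_cst.
have DN x : V1 x -> D x *m N = 1%:M by move=> /uN u; rewrite /D -mulmxA mulVmx.
have Dd x : V1 x -> (D x :=: d x)%MS.
  by move=> /uN u; apply: eqmxMfull; rewrite row_full_unit unitmx_inv.
pose U1 := U `&` (chart_dom i0 `&` chart i0 @^-1` V1).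
pose S1 := chart i0 @` (chart_dom i0 `&` U1).
have oU1 : open U1 := leaf_dom_open ls oV1.
have oS1 : open S1 by exact: chart_image_openI.
have S1p : S1 (chart i0 p) by exists p.
have S1V : S1 `<=` V1 by move=> _ [q [_ [_ [_ qV]]] <-].
have [W [sigma [[oW W0 sigma0] [WS inj ssig Jsig]]]] :=
  commuting_frame_integral oS1 S1p (smooth_mx_sub S1V sD) (fun x Sx => DN x (S1V x Sx))
    (fun x Sx i j l => Delta_commuting ls oV1 sD DN Dd i j l Sx).
have leafU w : W w -> U1 (chart_inv i0 (sigma w)) /\ chart i0 (chart_inv i0 (sigma w)) = sigma w.
  by move=> /WS[q [qi qU] <-]; rewrite (chartK qi).
have dsig w : W w -> differentiable sigma w := smooth_map_differentiable ssig (x := w).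
exists kd, W, (chart_inv i0 \o sigma); split; first by split=> //=; rewrite sigma0 chartK.
split.
- move=> w Ww; apply: continuous_comp; first exact: differentiable_continuous (dsig w Ww).
  by apply: chart_inv_continuous; have [[_ [q _]] e] := leafU w Ww; eexists; [exact: q|exact: e].
- move=> w w' Ww Ww' e; apply: inj => //.
  by rewrite -(leafU w Ww).2 -(leafU w' Ww').2; congr (chart i0 _).
- move=> i; pose A := chart i0 @` (chart_dom i0 `&` chart_dom i).
  have oA : open A by apply: chart_image_openI; exact: chart_dom_open.
  have -> : W `&` (chart_inv i0 \o sigma) @^-1` chart_dom i = W `&` sigma @^-1` A.
    apply/seteqP; split=> w [Ww] /=.
      by move=> h; have [[_ [q _]] e] := leafU w Ww; split=> //; exists (chart_inv i0 (sigma w)).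
    by move=> [q [qi qj] e]; split=> //=; rewrite -e chartK.
  have oWA := open_preimageI oW ssig oA.
  have h1 w : (W `&` sigma @^-1` A) w -> A (sigma w) by case.
  have h2 : smooth_map_on (W `&` sigma @^-1` A) sigma.
    by move=> l; apply: smooth_on_sub (ssig l) => w [].
  move=> k; exact: (smooth_on_comp oWA h1 h2 (@transition_smooth R m M i0 i k)).
move=> w Ww /=; have [U1q e] := leafU w Ww.
move: (chart_inv i0 (sigma w)) U1q e => q U1q e; have [_ [qi _]] := U1q.
(* In the preferred chart at q the Jacobian of the leaf is the frame D itself, whose rows are free
   and span Delta. *)
have -> : 'J (chart (chart_at q) \o (chart_inv i0 \o sigma)) w = chart_field i0 D q.
  have dt : differentiable (transition i0 (chart_at q)) (sigma w).
    by rewrite -e; exact: transition_differentiable qi (chart_at_dom q).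
  apply: (etrans (jacobian_comp (dsig w Ww) dt)).
  by rewrite /chart_field /coord_change e Jsig.
split; first exact: (leaf_frame_free ls Dd U1q).
by move=> v; apply/idP/idP => /(leaf_frame_mem ls Dd U1q v).
Qed.

End Frobenius.

Theorem proposition4p19 (R : realType) (n r s : nat)
    (M : manifold R (2 * n + r)) (L : M -> {vspace gtan R (2 * n + r)})
    (hL : complex_dirac L)
    (hr : forall p : M, real_index L p = r)
    (hs : forall p : M, dirac_order L p = s)
    (hn : forall p : M, dirac_type L p = n) :
  exists (D Delta : M -> {vspace 'rV[R]_(2 * n + r)})
         (J B : M -> 'M[R]_(2 * n + r)),
    [/\ transverse_CR D Delta J,
        forall p : M, D p = D_L L p /\ Delta p = Delta_L L p,
        real_two_form B &
        forall p : M, L p = exp_form_space (B p) (dirac_of_CR D Delta J p)].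
Proof.
have [B [B2 cB]] := exists_compatible_two_form hL hr hs hn.
have [J JC] := exists_CR_compatible hL hr hs hn.
have invE := E_L_involutive hL B2 cB.
(* The fibre rebuilt from D, Delta and J is E again, so regularity and involutivity need only be
   known for E. *)
have fibre : (fun p => cr_fibre (D_L L p) (Delta_L L p) (J p)) = E_L L.
  apply/funext => p; apply/vspaceP => v; apply/idP/idP => h.
    exact: (CR_compatible_fibre (JC p) v).1 h.
  exact: (CR_compatible_fibre (JC p) v).2 h.
exists (D_L L), (Delta_L L), J, B; split; first split.
- move=> p; apply/subvP => v h.
  have vE : cmx v \in E_L L p := (mem_realDelta _ _).1 h.
  apply: (etrans (mem_real_part _ v)).
  exact: (subvP (addvSl _ _)) vE.
- exact: D_L_regular hL hr hs hn.
- exact: Delta_L_regular hL hr hs hn.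
- exact: Delta_L_integrable hL hr hs hn invE.
- move=> p v; exact: (CR_compatible_D (JC p)).
- move=> p v; exact: (CR_compatible_Delta (JC p)).
- exact: (CR_compatible_smooth hL hr hs hn JC).
- move=> p v; exact: (CR_compatible_square (JC p)).
- rewrite fibre; exact: E_L_regular hL hr hs hn.
- rewrite fibre; exact: invE.
- move=> p; split; exact: erefl.
- exact: B2.
- move=> p; exact: (compatible_form_dirac hL (cB p) (JC p)).
Qed.
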